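(* Fix $1<p<\infty$. Let $g\in L_p(\mathbf R^n)$ and define the dyadic average extension $$u(t,x):=\frac1{|Q|}\int_Q g(y)\,dy,\qquad (t,x)\in W_Q,\ Q\in\mathcal D,$$ where $W_Q:=(\ell(Q)/2,\ell(Q))\times Q$ is the dyadic Whitney region above the dyadic cube $Q\subset\mathbf R^n$ of side length $\ell(Q)$. Then, for any $0<\epsilon<1$, there exists $f:\mathbf R^{1+n}_+\to\mathbf R$ which is constant on each dyadic Whitney region, with pointwise estimates $$N_{\mathcal D}(f-u)\le\epsilon\,M_{\mathcal D}g,\qquad C_{\mathcal D}(\nabla f)\lesssim\epsilon^{-1}M_{\mathcal D}(M_{\mathcal D}g),$$ and implied norm estimates $$\|N(f-u)\|_{L_p(\mathbf R^n)}\le\epsilon\|g\|_{L_p(\mathbf R^n)},\qquad \|C(\nabla f)\|_{L_p(\mathbf R^n)}\lesssim\epsilon^{-1}\|g\|_{L_p(\mathbf R^n)}.$$ Moreover, for any fixed $\alpha<\infty$, the non-tangential limits $\lim_{(t,y)\to(0,x),\ |y-x|<\alpha t}f(t,y)=:f(0,x)$ exist for almost every $x\in\mathbf R^n$, and $\|f(0,\cdot)-g\|_{L_p(\mathbf R^n)}\le\epsilon\|g\|_{L_p(\mathbf R^n)}$.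
   Context: $\mathbf R^{1+n}_+=\{(t,x):t>0,\ x\in\mathbf R^n\}$. $\mathcal D=\bigcup_{j\in\mathbf Z}\mathcal D_j$ is a fixed system of (open) dyadic cubes in $\mathbf R^n$, $\mathcal D_j$ being the cubes of side length $2^{-j}$, such that the dyadic cubes form a connected tree under inclusion (any two dyadic cubes are contained in a common dyadic cube). $\widehat Q:=(0,\ell(Q))\times Q$ is the Carleson box above $Q$. The dyadic functionals are $$N_{\mathcal D}f(x):=\sup_{Q:\,x\in Q\in\mathcal D}\ \sup_{(t,y)\in W_Q}|f(t,y)|,\qquad C_{\mathcal D}\mu(x):=\sup_{Q:\,x\in Q\in\mathcal D}\frac1{|Q|}\iint_{\widehat Q}d|\mu|(t,y),$$ $$M_{\mathcal D}g(x):=\sup_{Q:\,x\in Q\in\mathcal D}\frac1{|Q|}\int_Q|g(y)|\,dy.$$ The non-dyadic functionals are $Nf(x):=\operatorname{ess\,sup}_{|y-x|<t}|f(t,y)|$ and $C\mu(x):=\sup_{Q\ni x}|Q|^{-1}\iint_{\widehat Q}d|\mu|(t,y)$, the last supremum being over all cubes $Q\subset\mathbf R^n$ containing $x$. Here $\nabla f$ is the distributional gradient in $(t,x)$ of $f$ on $\mathbf R^{1+n}_+$, a locally finite measure since $f$ is constant on dyadic Whitney regions, and $|\nabla f|$ is its total variation. $a\lesssim b$ means $a\le Cb$ with a constant $C$ independent of $g$ and $\epsilon$. *)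

(* Defs.v *)
From HB Require Import structures.
From mathcomp Require Import all_boot all_order all_algebra.
From mathcomp Require Import all_classical all_reals all_analysis ess_sup_inf.

Set Implicit Arguments.
Unset Strict Implicit.
Unset Printing Implicit Defensive.

Import Order.TTheory GRing.Theory Num.Theory.
Import numFieldNormedType.Exports.

Local Open Scope classical_set_scope.
Local Open Scope ring_scope.

(* [R^n] is ['rV[R]_n] and [R^(1+n)] is [R * 'rV[R]_n], the first component
   being the variable [t].  The library gives these types their usual topology
   (hence derivatives, compactness, ...); the product sigma-algebra and the
   Lebesgue measure on ['rV[R]_n] are added here. *)

Section measurable_rV.
Context (R : realType) (n : nat).

Let coord : 'I_n -> 'rV[R]_n -> R := fun i x => x 0 i.

Let rV_set0 : g_sigma_preimage coord set0.
Proof. exact: sigma_algebra0. Qed.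

Let rV_setC A : g_sigma_preimage coord A -> g_sigma_preimage coord (~` A).
Proof. exact: sigma_algebraC. Qed.

Let rV_bigcup (F : _^nat) : (forall i, g_sigma_preimage coord (F i)) ->
  g_sigma_preimage coord (\bigcup_i (F i)).
Proof. exact: sigma_algebra_bigcup. Qed.

HB.instance Definition _ := @isMeasurable.Build default_measure_display
  'rV[R]_n (g_sigma_preimage coord) rV_set0 rV_setC rV_bigcup.

End measurable_rV.

Lemma measurable_coord (R : realType) n (i : 'I_n) :
  measurable_fun [set: 'rV[R]_n] (fun x : 'rV[R]_n => x 0 i).
Proof.
move=> _ Y mY; rewrite setTI; apply: sub_sigma_algebra => /=.
rewrite -bigcup_seq/=; exists i => /=; first by rewrite mem_index_enum.
by exists Y => //; rewrite setTI.
Qed.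

Lemma measurable_fun_rV d (T : measurableType d) (R : realType) n
    (f : T -> 'rV[R]_n) :
  (forall i, measurable_fun [set: T] (fun x => f x 0 i)) ->
  measurable_fun [set: T] f.
Proof.
move=> mf _ A mA; rewrite setTI.
pose G := [set B : set 'rV[R]_n | measurable (f @^-1` B)].
suff : @measurable _ 'rV[R]_n `<=` G by apply.
apply: smallest_sub.
- split; rewrite /G/=.
  + by rewrite preimage_set0.
  + by move=> B mB; rewrite setTD preimage_setC; exact: measurableC.
  + by move=> F mF; rewrite preimage_bigcup; exact: bigcup_measurable.
- rewrite -bigcup_seq => B [i _ [C mC <-]]; rewrite setTI /G/=.
  by have := mf i measurableT C mC; rewrite setTI.
Qed.

(* [measurableTypeR R] is the alias of [R] on which [lebesgue_measure] is
   declared; it has the topology of [R] by conversion. *)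
Notation R1n R n := (measurableTypeR R * 'rV[R]_n)%type.

Section lebesgue_rV.
Context (R : realType).

Definition rVcons n (z : R1n R n) : 'rV[R]_n.+1 :=
  \row_i (if unlift ord0 i is Some j then z.2 0 j else z.1).

Definition rVuncons n (v : 'rV[R]_n.+1) : R1n R n :=
  (v 0 0, \row_j v 0 (lift ord0 j)).

Lemma rVconsK n : cancel (@rVcons n) (@rVuncons n).
Proof.
move=> [t x]; rewrite /rVuncons mxE unlift_none; congr pair.
by apply/rowP => j; rewrite !mxE liftK.
Qed.

Lemma measurable_rVcons n : measurable_fun [set: (R1n R n)] (@rVcons n).
Proof.
apply: measurable_fun_rV => i; under eq_fun do rewrite mxE.
case: unliftP => [j _|_]; last exact: measurable_fst.
by apply: (measurableT_comp (measurable_coord j)); exact: measurable_snd.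
Qed.

Lemma measurable_rVuncons n :
  measurable_fun [set: 'rV[R]_n.+1] (@rVuncons n).
Proof.
apply: measurable_fun_pair; first exact: measurable_coord.
apply: measurable_fun_rV => j; under eq_fun do rewrite mxE.
exact: measurable_coord.
Qed.

Section push.
Context (n : nat) (m : {sigma_finite_measure set 'rV[R]_n -> \bar R}).

Let lm := (@lebesgue_measure R \x m)%E.

Let lm_sigma_finite : sigma_finite setT lm.
Proof.
have /sigma_finiteP[F [TF ndF Foo]] := sigma_finiteT (@lebesgue_measure R).
have /sigma_finiteP[G [TG ndG Goo]] := sigma_finiteT m.
exists (fun k => F k `*` G k).
  rewrite -setXTT TF TG predeqE => -[x y]; split.
    move=> [/= [i _ Fix_] [k _ Gky]]; exists (maxn i k) => //; split.
    - by move: x Fix_; exact/subsetPset/ndF/leq_maxl.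
    - by move: y Gky; exact/subsetPset/ndG/leq_maxr.
  by move=> [i _ []/= ? ?]; split; exists i.
move=> k; have [? ?] := Foo k; have [? ?] := Goo k.
split; first exact: measurableX.
by rewrite /lm product_measure1E// lte_mul_pinfty// ge0_fin_numE.
Qed.

Definition rVpush : set 'rV[R]_n.+1 -> \bar R :=
  pushforward (@lebesgue_measure R \x m)%E (@rVcons n).

Let rVpush0 : rVpush set0 = 0%E.
Proof. by rewrite /rVpush /pushforward preimage_set0 measure0. Qed.

Let rVpush_ge0 A : (0 <= rVpush A)%E.
Proof. by rewrite /rVpush /pushforward measure_ge0. Qed.

Let rVpush_sigma_additive : semi_sigma_additive rVpush.
Proof.
have mpre A : measurable A -> measurable (@rVcons n @^-1` A).
  by move=> mA; rewrite -[X in measurable X]setTI; exact: measurable_rVcons.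
move=> F mF tF mUF; rewrite /rVpush /pushforward preimage_bigcup.
apply: measure_semi_sigma_additive.
- by move=> i; exact: mpre.
- apply/trivIsetP => /= i j _ _ ij; rewrite -preimage_setI.
  by move/trivIsetP : tF => /(_ _ _ _ _ ij) ->//; rewrite preimage_set0.
- by rewrite -preimage_bigcup; exact: mpre.
Qed.

HB.instance Definition _ :=
  isMeasure.Build _ _ _ rVpush rVpush0 rVpush_ge0 rVpush_sigma_additive.

Let rVpush_sigma_finite : sigma_finite setT rVpush.
Proof.
have [F TF mF] := lm_sigma_finite.
exists (fun i => @rVuncons n @^-1` F i).
  by rewrite -preimage_bigcup -TF preimage_setT.
move=> i; have [mFi Fioo] := mF i; split.
  by rewrite -[X in measurable X]setTI; exact: measurable_rVuncons.
rewrite /rVpush /pushforward -comp_preimage.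
by rewrite (_ : _ \o _ = id) ?preimage_id//; apply/funext => z /=; rewrite rVconsK.
Qed.

HB.instance Definition _ :=
  Measure_isSigmaFinite.Build _ _ _ rVpush rVpush_sigma_finite.

End push.

(* The [n]-dimensional Lebesgue measure: [leb n.+1] is the image of the product
   of the one-dimensional Lebesgue measure and [leb n]. *)
Fixpoint leb n : {sigma_finite_measure set 'rV[R]_n -> \bar R} :=
  match n with
  | 0 => [the {sigma_finite_measure set _ -> \bar R} of \d_(0 : 'rV[R]_0)]
  | n'.+1 => [the {sigma_finite_measure set _ -> \bar R} of rVpush (leb n')]
  end.

Definition leb1 n : {measure set (R1n R n) -> \bar R} :=
  [the {measure set _ -> \bar R} of (@lebesgue_measure R \x leb n)%E].

End lebesgue_rV.
Arguments leb {R} n.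
Arguments leb1 {R} n.

Section basics.
Context (R : realType) (n : nat).
Implicit Types (x y a : 'rV[R]_n) (l : R) (z : R1n R n) (A : set 'rV[R]_n).

(* The library norm of ['rV[R]_n] is the maximum norm. *)
Definition enorm x : R := Num.sqrt (\sum_i x 0 i ^+ 2).

Definition halfspace : set (R1n R n) := [set z | 0 < z.1].

Definition cube a l : set 'rV[R]_n :=
  [set x | forall i, a 0 i < x 0 i < a 0 i + l].

Definition carleson l A : set (R1n R n) := [set z | 0 < z.1 < l /\ A z.2].

Definition whitney l A : set (R1n R n) := [set z | l / 2 < z.1 < l /\ A z.2].

Definition cone (alpha : R) x : set (R1n R n) :=
  [set z | 0 < z.1 /\ enorm (z.2 - x) < alpha * z.1].

Definition vol A : R := fine (leb n A).

(* The functionals below are suprema of nonnegative quantities; adding [0]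
   makes the supremum over an empty family [0] rather than [-oo]. *)
Definition sup0 (X : set (\bar R)) : \bar R := ereal_sup (X `|` [set 0%E]).

End basics.

Section dyadic.
Context (R : realType) (n : nat).

(* The pair [(j, k)] stands for the cube of side [2^-j] at position [k] in the
   lattice of the cubes of generation [j], one corner of which is [o j].  The
   offsets [o j] are needed: with [o j = 0] the cubes of different orthants
   have no common ancestor. *)
Definition dindex := (int * 'rV[int]_n)%type.

Definition dside (Q : dindex) : R := 2 ^ (- Q.1).

Definition dcube_of (o : int -> 'rV[R]_n) (Q : dindex) : set 'rV[R]_n :=
  cube (o Q.1 + dside Q *: map_mx intr Q.2) (dside Q).

Record dyadic_system := DyadicSystem {
  dorigin : int -> 'rV[R]_n ;
  dyadic_nested : forall (j : int) (k : 'rV[int]_n), exists k' : 'rV[int]_n,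
    dcube_of dorigin (j + 1, k) `<=` dcube_of dorigin (j, k') ;
  dyadic_connected : forall Q1 Q2 : dindex, exists Q : dindex,
    dcube_of dorigin Q1 `<=` dcube_of dorigin Q /\
    dcube_of dorigin Q2 `<=` dcube_of dorigin Q }.

Variable D : dyadic_system.

Definition dcube (Q : dindex) := dcube_of (dorigin D) Q.

Definition dcarleson (Q : dindex) := carleson (dside Q) (dcube Q).

Definition dwhitney (Q : dindex) := whitney (dside Q) (dcube Q).

Definition whitney_constant (f : R1n R n -> R) : Prop :=
  forall Q z z', dwhitney Q z -> dwhitney Q z' -> f z = f z'.

(* The extension is left unspecified off the Whitney regions, i.e. on a null
   set. *)
Definition is_dyadic_extension (g : 'rV[R]_n -> R) (u : R1n R n -> R) : Prop :=
  forall Q z, dwhitney Q z ->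
    u z = (vol (dcube Q))^-1 * \int[leb n]_(y in dcube Q) g y.

End dyadic.

(* An R^(1+n)-valued locally finite Borel measure on the half-space; each
   component is the difference of two nonnegative locally finite measures.  The
   component [None] is the one along [t], and [Some i] the one along [x_i].
   Values outside the half-space are irrelevant. *)
Record vmeasure (R : realType) (n : nat) := VMeasure {
  vpos : option 'I_n -> {measure set (R1n R n) -> \bar R} ;
  vneg : option 'I_n -> {measure set (R1n R n) -> \bar R} ;
  vmeasure_locally_finite : forall i (K : set (R1n R n)),
    compact K -> K `<=` @halfspace R n ->
    (vpos i K < +oo)%E /\ (vneg i K < +oo)%E }.

Section gradient.
Context (R : realType) (n : nat).
Implicit Types (f phi : R1n R n -> R) (m : vmeasure R n).

(* Only meaningful for Borel subsets of a compact subset of the half-space,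
   where both terms are finite. *)
Definition vcomp m (i : option 'I_n) (A : set (R1n R n)) : R :=
  fine (vpos m i A) - fine (vneg m i A).

Definition vnorm m (A : set (R1n R n)) : R :=
  Num.sqrt (\sum_i vcomp m i A ^+ 2).

(* The total variation [|m|(E)], for [E] Borel in the half-space. *)
Definition total_variation m (E : set (R1n R n)) : \bar R :=
  ereal_sup [set s | exists (N : nat) (A : nat -> set (R1n R n)),
    [/\ forall k, measurable (A k) /\ A k `<=` E,
        forall k, exists2 K, compact K & A k `<=` K /\ K `<=` @halfspace R n,
        trivIset setT A &
        s = (\sum_(k < N) vnorm m (A k))%:E]].

Fixpoint Ck (k : nat) phi : Prop :=
  continuous phi /\
  if k is k'.+1 then
    forall v, (forall z, derivable phi z v) /\ Ck k' ('D_v phi)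
  else True.

Definition test_function phi : Prop :=
  (forall k, Ck k phi) /\
  exists K, [/\ compact K, K `<=` @halfspace R n & forall z, ~ K z -> phi z = 0].

Definition dir (i : option 'I_n) : R1n R n :=
  if i is Some i' then (0, delta_mx 0 i') else (1, 0).

Definition locally_integrable f : Prop :=
  forall K, compact K -> K `<=` @halfspace R n ->
    (leb1 n).-integrable K (EFin \o f).

Definition is_gradient f m : Prop :=
  locally_integrable f /\
  forall i phi, test_function phi ->
    \int[leb1 n]_(z in @halfspace R n) (f z * 'D_(dir i) phi z) =
    - (\int[vpos m i]_(z in @halfspace R n) phi z -
       \int[vneg m i]_(z in @halfspace R n) phi z).

End gradient.

Section functionals.
Context (R : realType) (n : nat).
Local Open Scope ereal_scope.

Section dyadic_functionals.
Variable D : dyadic_system R n.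

Definition ND (f : R1n R n -> R) (x : 'rV[R]_n) : \bar R :=
  sup0 [set s | exists Q z, [/\ dcube D Q x, dwhitney D Q z & s = `|f z|%:E]].

Definition CD (m : vmeasure R n) (x : 'rV[R]_n) : \bar R :=
  sup0 [set s | exists2 Q, dcube D Q x &
    s = (vol (dcube D Q))^-1%:E * total_variation m (dcarleson D Q)].

Definition MD (g : 'rV[R]_n -> \bar R) (x : 'rV[R]_n) : \bar R :=
  sup0 [set s | exists2 Q, dcube D Q x &
    s = (vol (dcube D Q))^-1%:E * \int[leb n]_(y in dcube D Q) `|g y|].

End dyadic_functionals.

(* The essential supremum of [|f|] over a cone, written as that of the
   nonnegative function equal to [|f|] on the cone and to [0] elsewhere. *)
Definition NT (f : R1n R n -> R) (x : 'rV[R]_n) : \bar R :=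
  ess_sup (leb1 n) (fun z => (`|f z| * \1_(cone 1 x) z)%:E).

Definition CT (m : vmeasure R n) (x : 'rV[R]_n) : \bar R :=
  sup0 [set s | exists a l, [/\ (0 < l)%R, cube a l x &
    s = (vol (cube a l))^-1%:E * total_variation m (carleson l (cube a l))]].

Definition Lp_norm (p : R) (h : 'rV[R]_n -> \bar R) : \bar R :=
  'N[leb n]_(p%:E)[h].

End functionals.

Definition nontangential_limit (R : realType) (n : nat) (alpha : R)
    (f : R1n R n -> R) (x : 'rV[R]_n) (l : R) : Prop :=
  f z @[z --> within (cone alpha x) (nbhs ((0, x) : R1n R n))] --> l.

(* Main.v *)
Require Import Defs.
From HB Require Import structures.
From mathcomp Require Import all_boot all_order all_algebra.
From mathcomp Require Import all_classical all_reals all_analysis ess_sup_inf.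
From mathcomp Require Import measurable_realfun ring lra zify.

Set Implicit Arguments.
Unset Strict Implicit.
Unset Printing Implicit Defensive.

Import Order.TTheory GRing.Theory Num.Theory.
Import numFieldNormedType.Exports.

Local Open Scope classical_set_scope.
Local Open Scope ring_scope.

(** The function [f] is a stopping-time modification of the dyadic averages.
    Going down the tree of dyadic cubes, [f] keeps the value of the parent as
    long as it is within [e * m Q] of the average [u Q], where [m Q] is the
    largest average of [|g|] over [Q] and its ancestors, and is reset to [u Q]
    otherwise.  Since [m Q] is at most the dyadic maximal function [Mg] on [Q],
    the estimate of [f - u] holds by construction ([stop_close]).  The tree has
    no largest cube from which to start; the construction starts from the chain
    of the ancestors of a fixed cube, along which [f = u].

    The gradient of [f] is a measure on the faces of the Whitney regions, whose
    density is the jump of [f] ([is_gradient_jump]); the integration by parts is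
    a telescoping sum on each line parallel to an axis.  The mass of the
    gradient over a Carleson box is therefore a sum of averages of jumps over
    the generations of the tree.  For vertical jumps, from a cube to its parent,
    the sum is bounded by a Bellman function argument: at a reset the energy
    [(u - f)^2 / m] drops by at least [e] times the jump, while its increase
    between resets is that of [u^2 / m], up to terms controlled by the increase
    of [m] ([bellman_supersolution]).  This bounds [e] times the sum by a
    multiple of the average of [m] over the small subcubes ([sum_vjump_stop]),
    hence by the average of [Mg]; the iterated maximal function appears in this
    way.  A lateral jump is at most two vertical jumps plus the lateral jump of
    the parents, which occurs for half of the children only; so lateral jumps
    are absorbed by a geometric series ([sum_hjump]).

    The functionals that are not dyadic are dominated by the maximal function
    [mstar] over dyadic cubes dilated by [5]: at each scale, the cubes met by a
    cone or a Carleson box are neighbours of the dyadic cube of [x].  Its [L_p]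
    bound ([integral_mstar]) comes from the inequality of Doob on the tree,
    proved with the supermartingale [M^p - q * M^(p - 1) * w], by translating
    each generation separately.  The constant of this bound is absorbed by
    running the construction with a fixed multiple of [eps].

    Finally the vertical and lateral jumps of [f] are summable along almost
    every branch, so that [f] has limits along branches ([limit_ae]), and its
    differences between neighbours tend to [0]; this gives the nontangential
    limits ([nontangential]).  As the averages of [g] are uniform limits of such
    functions [f] with [e] tending to [0], they converge too, and dominated
    convergence identifies their limit as [g] ([lebesgue_differentiation]);
    passing to the limit in [|f - u| <= e * Mg] gives the last estimate. *)

(** * The dyadic tree *)

Section floor.
Variable R : realType.
Implicit Types (y : R) (m : int).

Lemma floor_itv y m : (Num.floor y == m) = (m%:~R <= y < m%:~R + 1).
Proof. by rewrite floor_eq intrD. Qed.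

Lemma floor_bounds y : (Num.floor y)%:~R <= y < (Num.floor y)%:~R + 1.
Proof. by rewrite -floor_itv. Qed.

End floor.

Section dyadic_index.
Context (R : realType) (n : nat) (D : dyadic_system R n).
Implicit Types (Q P S : dindex n) (x : 'rV[R]_n) (v : 'rV[int]_n).
Implicit Types (b : {ffun 'I_n -> bool}) (j : int).

(** The index of the half-open cube of generation [j] that contains [x].
    Half-open cubes leave no exceptional set, which makes [locate] total and
    turns the tree structure into arithmetic on integer vectors. *)
Definition locate j x : dindex n :=
  (j, \row_i Num.floor ((x 0 i - dorigin D j 0 i) * 2 ^ j)).

Definition offset j : 'rV[int]_n :=
  \row_i Num.floor ((dorigin D (j + 1) 0 i - dorigin D j 0 i) * 2 ^ (j + 1)).

Definition par Q : dindex n :=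
  (Q.1 - 1, \row_i divz (Q.2 0 i + offset (Q.1 - 1) 0 i) 2).

Definition child b Q : dindex n :=
  (Q.1 + 1, \row_i (Q.2 0 i * 2 + (b i)%:Z - offset Q.1 0 i)).

Definition nbr v Q : dindex n := (Q.1, Q.2 + v).

Lemma side_gt0 Q : 0 < dside R Q. Proof. by rewrite /dside exprz_gt0. Qed.

Lemma pow2_gt0 j : 0 < (2 : R) ^ j. Proof. by rewrite exprz_gt0. Qed.

Lemma pow2N j : (2 : R) ^ (- j) = (2 ^ j)^-1.
Proof. by rewrite -invr_expz. Qed.

Lemma pow2S j : (2 : R) ^ (j + 1) = 2 ^ j * 2.
Proof. by rewrite expfzDr // expr1z. Qed.

Lemma pow2P j : (2 : R) ^ (j - 1) = 2 ^ j / 2.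
Proof. by rewrite expfzDr // pow2N expr1z. Qed.

Lemma dcubeE Q x : dcube D Q x <->
  forall i, (Q.2 0 i)%:~R < (x 0 i - dorigin D Q.1 0 i) * 2 ^ Q.1
            < (Q.2 0 i)%:~R + 1.
Proof.
have p0 := pow2_gt0 Q.1.
have E o k : (o + (2 ^ Q.1)^-1 * k - o) * 2 ^ Q.1 = k :> R.
  by rewrite addrAC subrr add0r mulrC mulVKf// gt_eqF.
have E1 o k : (o + (2 ^ Q.1)^-1 * k + (2 ^ Q.1)^-1 - o) * 2 ^ Q.1 = k + 1 :> R.
  have -> : o + (2 ^ Q.1)^-1 * k + (2 ^ Q.1)^-1 = o + (2 ^ Q.1)^-1 * (k + 1).
    by rewrite mulrDr mulr1 addrA.
  by rewrite E.
have L (o a c : R) : (a < c) = ((a - o) * 2 ^ Q.1 < (c - o) * 2 ^ Q.1).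
  by rewrite (ltr_pM2r p0) (ltrD2r (- o)).
rewrite /dcube /dcube_of /cube /dside; split => + i => /(_ i) /=;
  rewrite !mxE /= pow2N.
  by rewrite (L (dorigin D Q.1 0 i)) [X in _ && X](L (dorigin D Q.1 0 i)) E E1.
by rewrite [in X in _ -> X](L (dorigin D Q.1 0 i)) [X in _ -> _ && X](L (dorigin D Q.1 0 i)) E E1.
Qed.

Lemma dcube_locate Q x : dcube D Q x -> locate Q.1 x = Q.
Proof.
move=> /dcubeE h; rewrite /locate; case: Q h => j k /= h; congr pair.
apply/rowP => i; rewrite mxE; apply/eqP; rewrite floor_itv.
by have /andP[/ltW -> ->] := h i.
Qed.

Lemma locateP Q x : locate Q.1 x = Q <->
  forall i, (Q.2 0 i)%:~R <= (x 0 i - dorigin D Q.1 0 i) * 2 ^ Q.1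
            < (Q.2 0 i)%:~R + 1.
Proof.
case: Q => j k /=; split=> [[<-] i|h].
  by rewrite mxE floor_bounds.
by congr pair; apply/rowP => i; rewrite mxE; apply/eqP; rewrite floor_itv.
Qed.

Lemma dcube_center Q : exists x, dcube D Q x.
Proof.
exists (\row_i (dorigin D Q.1 0 i + ((Q.2 0 i)%:~R + 2^-1) / 2 ^ Q.1)).
apply/dcubeE => i; rewrite mxE addrAC subrr add0r divfK ?gt_eqF ?pow2_gt0//.
by rewrite ltrDl invr_gt0 ltr0n/= ltrD2l invf_lt1// ltr1n.
Qed.

(** The nestedness axiom forces the lattices of two consecutive generations
    to be aligned.  In units of the finer side, [t] being the distance of the
    two origins, the finer cubes at positions [0] and [1] give coarser cubes
    at [k0] and [k1] with [2 k0 <= t <= 2 k0 + 1] and [2 k1 <= t + 1 <= 2 k1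
    + 1]; since [k1] is [k0] or [k0 + 1], one of these inequalities is an
    equality and [t] is an integer. *)
Lemma offsetE j i : dorigin D (j + 1) 0 i =
  dorigin D j 0 i + (offset j 0 i)%:~R / 2 ^ (j + 1).
Proof.
set t := (dorigin D (j + 1) 0 i - dorigin D j 0 i) * 2 ^ (j + 1).
suff ti : ((Num.floor t)%:~R : R) = t.
  by rewrite /offset mxE -/t ti /t mulfK ?gt_eqF ?pow2_gt0// addrCA subrr addr0.
have key k : exists k' : int, 2 * k'%:~R <= t + k%:~R <= 2 * k'%:~R + 1.
  have [k' sub] := dyadic_nested D j (const_mx k).
  exists (k' 0 i).
  (* the point at relative position [e] of the finer cube, tested for [e]
     close to [0] and to [1] *)
  have H (e : R) : 0 < e < 1 ->
      2 * (k' 0 i)%:~R < t + k%:~R + e < 2 * (k' 0 i)%:~R + 2.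
    move=> /andP[e0 e1].
    have := sub (\row_i (dorigin D (j + 1) 0 i + (k%:~R + e) / 2 ^ (j + 1))).
    have p0 := pow2_gt0 (j + 1); have p0' := pow2_gt0 j.
    have Hin : dcube_of (dorigin D) (j + 1, const_mx k)
       (\row_i (dorigin D (j + 1) 0 i + (k%:~R + e) / 2 ^ (j + 1))).
      apply/dcubeE => i' /=; rewrite !mxE addrAC subrr add0r divfK ?gt_eqF//.
      by rewrite ltrDl e0/= ltrD2l.
    move=> /(_ Hin) /dcubeE /(_ i) /=; rewrite mxE.
    have -> : (dorigin D (j + 1) 0 i + (k%:~R + e) / 2 ^ (j + 1) - dorigin D j 0 i)
       * 2 ^ j = (t + k%:~R + e) / 2.
      rewrite /t pow2S; field; rewrite ?gt_eqF ?pow2_gt0//.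
    lra.
  apply/andP; split.
    apply/ler_addgt0Pr => e e0.
    have [e1|e1] := ltP e 1.
      by have := H e; rewrite e0 e1 => /(_ isT) /andP[/ltW].
    have := H 2^-1; lra.
  apply/ler_addgt0Pr => e e0.
  have [e1|e1] := ltP e 1.
    by have := H (1 - e); lra.
  by have := H 2^-1; lra.
have [k0 h0] := key 0; have [k1 h1] := key 1.
have k01 : 2 * k0%:~R <= t <= 2 * k0%:~R + 1 by lra.
have h1' : 2 * k1%:~R - 1 <= t <= 2 * k1%:~R by lra.
have : (2 * k1 - 1 <= 2 * k0 + 1 :> int)%R.
  by rewrite -(ler_int R) intrB intrD !intrM; lra.
have : (2 * k0 <= 2 * k1 :> int)%R.
  by rewrite -(ler_int R) !intrM; lra.
move=> a1 a2.
have [E|E] : k1 = k0 \/ k1 = k0 + 1 by lia.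
  have -> : t = (2 * k0)%:~R by move: h1' k01; rewrite E !intrM; lra.
  by rewrite intrKfloor.
have -> : t = (2 * k0 + 1)%:~R.
  by move: h1' k01; rewrite E !(intrD,intrM,intrB); lra.
by rewrite intrKfloor.
Qed.

Lemma par_locate j x : par (locate j x) = locate (j - 1) x.
Proof.
rewrite /par /locate /=; congr pair; apply/rowP => i; rewrite !mxE.
have := offsetE (j - 1) i; rewrite subrK /offset mxE subrK.
set th := Num.floor ((dorigin D j 0 i - _) * _) => oE.
set y := (x 0 i - _) * 2 ^ j.
have -> : (x 0 i - dorigin D (j - 1) 0 i) * 2 ^ (j - 1) = (y + th%:~R) / 2.
  by rewrite /y oE pow2P; field; rewrite ?gt_eqF ?pow2_gt0.
apply/esym/eqP; rewrite floor_itv.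
have := floor_bounds y.
set f := Num.floor y => h1.
set q := divz _ 2.
have : (2 * q <= f + th :> int)%R by rewrite /q; lia.
have : (f + th <= 2 * q + 1 :> int)%R by rewrite /q; lia.
rewrite -!(ler_int R) !(intrD,intrM); move: h1; lra.
Qed.

Lemma par_child b Q : par (child b Q) = Q.
Proof.
case: Q => j k; rewrite /par /child /= addrK; congr pair.
apply/rowP => i; rewrite !mxE subrK; case: (b i); lia.
Qed.

Lemma childP Q : exists b, child b (par Q) = Q.
Proof.
exists [ffun i => modz (Q.2 0 i + offset (Q.1 - 1) 0 i) 2 == 1].
case: Q => j k; rewrite /par /child /= subrK; congr pair.
apply/rowP => i; rewrite mxE [(\row__ _) 0 i]mxE ffunE.
set m := k 0 i + _.
have -> : ((modz m 2 == 1) : nat)%:Z = modz m 2.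
  have := modz_ge0 m (isT : (2 : int) != 0).
  have := ltz_pmod m (isT : 0 < (2 : int)).
  by case: eqP => [->//|/eqP ne] /= ? ?; lia.
by rewrite -divz_eq /m addrK.
Qed.

Lemma child_inj Q : injective (child^~ Q).
Proof.
move=> b b' [/rowP E]; apply/ffunP => i; have := E i; rewrite !mxE.
by case: (b i); case: (b' i) => //; lia.
Qed.

Lemma gen_par Q : (par Q).1 = Q.1 - 1. Proof. by []. Qed.
Lemma gen_child b Q : (child b Q).1 = Q.1 + 1. Proof. by []. Qed.

Lemma gen_anc k Q : (iter k par Q).1 = Q.1 - k%:Z.
Proof.
elim: k => [|k IH]; first by rewrite subr0.
by rewrite iterS gen_par IH; lia.
Qed.

Lemma anc_locate k j x : iter k par (locate j x) = locate (j - k%:Z) x.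
Proof.
elim: k => [|k IH] /=; first by rewrite subr0.
by rewrite IH par_locate; congr locate; lia.
Qed.

Lemma side_child b Q : dside R (child b Q) = dside R Q / 2.
Proof. by rewrite /dside gen_child opprD pow2P. Qed.

Lemma side_par Q : dside R (par Q) = dside R Q * 2.
Proof. by rewrite /dside gen_par opprB addrC pow2S. Qed.

(** Inclusion of open cubes is ancestry.  The generations compare as expected
    because the points at relative positions [1/4] and [3/4] of [Q] are half
    a side of [Q] apart and less than a side of [P] apart; then both cubes
    are located by a common point.  In dimension [0] all the cubes are equal
    as sets, so that the generations could not be recovered. *)
Lemma dcube_sub_anc (hn : (0 < n)%N) Q P : dcube D Q `<=` dcube D P ->
  exists k, iter k par Q = P.
Proof.
move=> QP; pose i0 := Ordinal hn.
have ls : P.1 <= Q.1.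
  rewrite leNgt; apply/negP => PQ.
  have [x xQ] := dcube_center Q.
  have p0 := pow2_gt0 Q.1.
  have H (e : R) : 0 < e < 1 -> dcube D P (\row_i (dorigin D Q.1 0 i + ((Q.2 0 i)%:~R + e) / 2 ^ Q.1)).
    move=> /andP[e0 e1]; apply: QP; apply/dcubeE => i.
    rewrite mxE addrAC subrr add0r divfK ?gt_eqF ?pow2_gt0//.
    by rewrite ltrDl e0/= ltrD2l.
  have H1 : 0 < (4^-1 : R) < 1 by lra.
  have H3 : 0 < (3 / 4 : R) < 1 by lra.
  have /dcubeE /(_ i0) := H _ H1; have /dcubeE /(_ i0) := H _ H3.
  rewrite !mxE.
  have : (2 * 2 ^ Q.1 <= 2 ^ P.1 :> R).
    by rewrite mulrC -pow2S ler_weXz2l ?ler1n//; lia.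
  set c := 2 ^ P.1; set d := 2 ^ Q.1 => cd.
  have d0 : 0 < d by exact: pow2_gt0.
  set o := dorigin D Q.1 0 i0; set o' := dorigin D P.1 0 i0.
  set k := (Q.2 0 i0)%:~R; set k' := (P.2 0 i0)%:~R.
  move=> /andP[_ h2] /andP[h1 _].
  have : (o + (k + 3 / 4) / d - o') * c - (o + (k + 4^-1) / d - o') * c < 1 by lra.
  rewrite -mulrBl.
  have -> : o + (k + 3 / 4) / d - o' - (o + (k + 4^-1) / d - o') = 2^-1 / d.
    field; by rewrite gt_eqF.
  rewrite mulrAC ltr_pdivrMr// mul1r mulrC ltr_pdivrMr// mulrC.
  by rewrite ltNge cd.
have [x xQ] := dcube_center Q.
exists `|Q.1 - P.1|%N.
transitivity (iter `|Q.1 - P.1| par (locate Q.1 x)).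
  by rewrite (dcube_locate xQ).
rewrite anc_locate -[RHS](dcube_locate (QP _ xQ)); congr locate; lia.
Qed.

Lemma anc_common (hn : (0 < n)%N) P Q : exists k l, iter k par P = iter l par Q.
Proof.
have [S [/(dcube_sub_anc hn)[k <-] /(dcube_sub_anc hn)[l E]]] :=
  dyadic_connected D P Q.
by exists k, l.
Qed.

End dyadic_index.

(** * Averages over children and jumps between cubes *)

Section averaging.
Context (R : realType) (n : nat) (D : dyadic_system R n).
Implicit Types (Q P S : dindex n) (v : 'rV[int]_n) (h : dindex n -> R).
Implicit Types (b : {ffun 'I_n -> bool}) (i : 'I_n).

Local Notation par := (par D).
Local Notation child := (child D).

(** Conditional expectation read on the tree: when [h] gives the values at
    generation [j + k] of a step function, [iter k avg h] gives its
    conditional expectation at generation [j].  A martingale is a function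
    with [avg h = h]. *)
Definition avg h P : R := (2 ^+ n)^-1 * \sum_b h (child b P).

Definition half_avg (s : bool) i h P : R :=
  (2 ^+ n)^-1 * \sum_(b : {ffun 'I_n -> bool} | b i == s) h (child b P).

Let N0 : 0 < (2 : R) ^+ n. Proof. by rewrite exprn_gt0. Qed.
Let N1 : 0 <= ((2 : R) ^+ n)^-1. Proof. by rewrite invr_ge0 ltW. Qed.

Lemma le_avg h h' P : (forall b, h (child b P) <= h' (child b P)) ->
  avg h P <= avg h' P.
Proof. by move=> hh'; rewrite ler_wpM2l// ler_sum. Qed.

Lemma avg_cst (a : R) P : avg (fun=> a) P = a.
Proof.
rewrite /avg sumr_const card_ffun card_bool card_ord -[a *+ _]mulr_natl natrX mulrA.
by rewrite mulVf ?mul1r// gt_eqF.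
Qed.

Lemma avgD h h' P : avg (fun Q => h Q + h' Q) P = avg h P + avg h' P.
Proof. by rewrite /avg big_split mulrDr. Qed.

Lemma avgZ (a : R) h P : avg (fun Q => a * h Q) P = a * avg h P.
Proof. by rewrite /avg -mulr_sumr mulrCA. Qed.

Lemma avgB h h' P : avg (fun Q => h Q - h' Q) P = avg h P - avg h' P.
Proof. by rewrite /avg sumrB mulrBr. Qed.

Lemma half_avgD s i h P : half_avg s i h P + half_avg (~~ s) i h P = avg h P.
Proof.
rewrite -mulrDr; congr (_ * _); rewrite [RHS](bigID (fun b => b i == s))/=.
by congr (_ + _); apply: eq_bigl => b; case: (b i) s => -[].
Qed.

Lemma half_avg_ge0 s i h P : (forall Q, 0 <= h Q) -> 0 <= half_avg s i h P.
Proof. by move=> h0; rewrite mulr_ge0// sumr_ge0. Qed.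

Lemma avg_ge0 h P : (forall Q, 0 <= h Q) -> 0 <= avg h P.
Proof. by move=> h0; rewrite mulr_ge0// sumr_ge0. Qed.

(** A nonnegative martingale grows by a factor [2 ^ n] at most from a cube to
    a child; this is the doubling property of Lebesgue measure. *)
Lemma child_le_avg h P b : (forall Q, 0 <= h Q) ->
  h (child b P) <= 2 ^+ n * avg h P.
Proof.
move=> h0; rewrite mulrA divff ?gt_eqF// mul1r (bigD1 b)//= lerDl.
exact: sumr_ge0.
Qed.

Lemma iter_avgS k h P : iter k.+1 avg h P = iter k avg (avg h) P.
Proof. by rewrite iterSr. Qed.

(** Only the values [k] generations below [P] matter. *)
Lemma le_iter_avg k h h' P : (forall Q, iter k par Q = P -> h Q <= h' Q) ->
  iter k avg h P <= iter k avg h' P.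
Proof.
elim: k P => [|k IH] P hh'; first exact: hh'.
apply: le_avg => b; apply: IH => Q QP; apply: hh'.
by rewrite iterS QP par_child.
Qed.

Lemma iter_avgD k h h' P :
  iter k avg (fun Q => h Q + h' Q) P = iter k avg h P + iter k avg h' P.
Proof.
elim: k P => [//|k IH] P; rewrite !iterS -avgD; congr avg.
exact/funext.
Qed.

Lemma iter_avgZ k (a : R) h P :
  iter k avg (fun Q => a * h Q) P = a * iter k avg h P.
Proof.
elim: k P => [//|k IH] P; rewrite !iterS -avgZ; congr avg.
exact/funext.
Qed.

Lemma iter_avgB k h h' P :
  iter k avg (fun Q => h Q - h' Q) P = iter k avg h P - iter k avg h' P.
Proof.
elim: k P => [//|k IH] P; rewrite !iterS -avgB; congr avg.
exact/funext.
Qed.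

Lemma iter_avg_ge0 k h P : (forall Q, 0 <= h Q) -> 0 <= iter k avg h P.
Proof. by move=> h0; elim: k P => [//|k IH] P; apply: avg_ge0. Qed.

Lemma iter_avg_martingale k h P : (forall Q, avg h Q = h Q) ->
  iter k avg h P = h P.
Proof.
move=> hm; elim: k => [//|k IH]; rewrite iterS.
have -> : iter k avg h = h; last exact: hm.
by elim: {IH}k => [//|k IH]; rewrite iterS IH; apply/funext.
Qed.

Definition step (s : bool) i : 'rV[int]_n :=
  if s then delta_mx 0 i else - delta_mx 0 i.

Definition flip i b : {ffun 'I_n -> bool} :=
  [ffun k => if k == i then ~~ b k else b k].

Lemma flipK i : involutive (flip i).
Proof. by move=> b; apply/ffunP => k; rewrite !ffunE; case: eqP; rewrite ?negbK. Qed.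

Lemma flip_id i b : flip i b i = ~~ b i. Proof. by rewrite ffunE eqxx. Qed.

(** A unit translation of a child changes its binary digit in the direction
    [i]; it stays under [P] or, when there is a carry, goes to the child of
    the neighbour of [P] with the flipped digit. *)
Lemma nbr_child s i b P : nbr (step s i) (child b P) =
  child (flip i b) (if b i == s then nbr (step s i) P else P).
Proof.
have stE l : step s i 0 l = if l == i then (if s then 1 else -1) else 0.
  by rewrite /step; case: s; rewrite !mxE eqxx /=; case: eqP => //; rewrite oppr0.
case: P => j k; rewrite /nbr /child; case: eqP => E /=; congr pair;
  apply/rowP => l; rewrite !mxE ffunE !stE; set o := Num.floor _.
  by case: eqP => [->|_]; rewrite ?E; case: (s); rewrite /=; lia.
case: eqP => [->|_]; last by lia.
by move: E; case: (b i); case: (s) => //= _; lia.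
Qed.

Lemma avg_nbr s i h P : avg (h \o nbr (step s i)) P =
  half_avg s i h P + half_avg (~~ s) i h (nbr (step s i) P).
Proof.
rewrite /avg /half_avg -mulrDr; congr (_ * _).
rewrite (bigID (fun b => b i == s))/= addrC; congr (_ + _).
  rewrite (reindex_inj (inv_inj (@flipK i)))/=.
  apply: eq_big => b; rewrite flip_id; first by case: (b i) s => -[].
  by move=> /negbTE bs; rewrite nbr_child flip_id bs flipK.
rewrite (reindex_inj (inv_inj (@flipK i)))/=.
apply: eq_big => b; rewrite flip_id; first by case: (b i) s => -[].
by move=> bs; rewrite nbr_child flip_id bs flipK.
Qed.

(** Translates of the descendants of [P] by one unit are, without repetition,
    descendants of [P] or of its neighbour.  The induction works on half
    averages: one half of the children stays under [P], the other half moves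
    to the neighbour, and the halves that are added back are nonnegative. *)
Lemma iter_avg_nbr k s i h P : (forall Q, 0 <= h Q) ->
  iter k avg (h \o nbr (step s i)) P <=
  iter k avg h P + iter k avg h (nbr (step s i) P).
Proof.
elim: k h => [|k IH] h h0; first by rewrite /= lerDr.
rewrite !iter_avgS.
have -> : avg (h \o nbr (step s i)) = fun Q => half_avg s i h Q +
    (half_avg (~~ s) i h \o nbr (step s i)) Q.
  by apply/funext => Q; rewrite avg_nbr.
have E Q : iter k avg (avg h) Q =
    iter k avg (half_avg s i h) Q + iter k avg (half_avg (~~ s) i h) Q.
  by rewrite -iter_avgD; congr (iter k _ _ _); apply/funext => S; rewrite half_avgD.
rewrite iter_avgD !E -addrA lerD2l.
apply: (le_trans (IH _ _)) => [Q|]; first exact: half_avg_ge0.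
by rewrite lerD2l lerDr iter_avg_ge0// => Q; exact: half_avg_ge0.
Qed.

(** Finiteness, for each cube, of the normalized integral over it of the sum
    of [h] over the cubes around a point that lie in [P]. *)
Definition summable_below h := forall P, exists B : R, forall M : nat,
  \sum_(k < M) iter k avg h P <= B.

Lemma summable_below_nbr h v : (forall Q, 0 <= h Q) ->
  summable_below h -> summable_below (h \o nbr v).
Proof.
have nbrD v1 v2 Q : nbr v1 (nbr v2 Q) = nbr (v2 + v1) Q.
  by rewrite /nbr/= addrA.
have st s i h' : (forall Q, 0 <= h' Q) -> summable_below h' ->
    summable_below (h' \o nbr (step s i)).
  move=> h0 hs P; have [B1 H1] := hs P; have [B2 H2] := hs (nbr (step s i) P).
  exists (B1 + B2) => M; apply: le_trans (lerD (H1 M) (H2 M)).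
  by rewrite -big_split ler_sum// => k _; exact: iter_avg_nbr.
have stn s i m h' : (forall Q, 0 <= h' Q) -> summable_below h' ->
    summable_below (h' \o nbr (step s i *+ m)).
  elim: m h' => [|m IH] h' h0 hs.
    have -> // : h' \o nbr (step s i *+ 0) = h'.
    by apply/funext => -[j k]; rewrite /= /nbr mulr0n addr0.
  have -> : h' \o nbr (step s i *+ m.+1) =
     (h' \o nbr (step s i *+ m)) \o nbr (step s i).
    by apply/funext => Q /=; rewrite nbrD -mulrS.
  by apply: st; [move=> Q /=|exact: IH].
move=> h0 hs; rewrite (row_sum_delta v).
elim/big_ind : _ h h0 hs => [h h0 hs|v1 v2 H1 H2 h h0 hs|i _ h h0 hs].
- have -> // : h \o nbr 0 = h.
  by apply/funext => -[j k]; rewrite /= /nbr addr0.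
- have -> : h \o nbr (v1 + v2) = (h \o nbr v2) \o nbr v1.
    by apply/funext => Q /=; rewrite nbrD.
  by apply: H1 => [Q/=|]; [|exact: H2].
- case: (v 0 i) => m.
    have -> : m%:Z *: delta_mx 0 i = step true i *+ m.
      by rewrite /step -scaler_nat natz.
    exact: stn.
  have -> : Negz m *: delta_mx 0 i = step false i *+ m.+1.
    by rewrite /step NegzE scaleNr -scaler_nat natz scalerN.
  exact: stn.
Qed.

Section lateral.
Variables (f : dindex n -> R) (i : 'I_n).

(** Vertical jumps are taken across the top of a Whitney region, lateral ones
    across its lower face in the direction [i]. *)
Definition vjump Q : R := `|f Q - f (par Q)|.

Definition hjump Q : R := `|f Q - f (nbr (step false i) Q)|.

Lemma vjump_ge0 Q : 0 <= vjump Q. Proof. exact: normr_ge0. Qed.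
Lemma hjump_ge0 Q : 0 <= hjump Q. Proof. exact: normr_ge0. Qed.

(** Two laterally adjacent cubes are compared through their parents, at the
    cost of two vertical jumps.  The parents coincide for the children whose
    digit in the direction [i] is [1]; otherwise they are themselves
    laterally adjacent. *)
Lemma hjump_child b P : hjump (child b P) <= vjump (child b P) +
  vjump (nbr (step false i) (child b P)) + (~~ b i)%:R * hjump P.
Proof.
rewrite /hjump /vjump nbr_child !par_child.
set x := f (child b P); set y := f (child _ _).
case: (b i) => /=; rewrite ?mul0r ?addr0 ?mul1r.
  by rewrite [`|y - _|]distrC ler_distD.
set z := f (nbr _ _).
rewrite [`|y - _|]distrC addrAC; apply: le_trans (ler_distD z _ _) _.
by rewrite lerD2r ler_distD.
Qed.

(** The factor [1/2] is the proportion of children whose left neighbour has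
    another parent. *)
Lemma avg_hjump P : avg hjump P <= avg vjump P +
  avg (vjump \o nbr (step false i)) P + 2^-1 * hjump P.
Proof.
rewrite -avgD.
have -> : 2^-1 * hjump P =
    (2 ^+ n)^-1 * \sum_(b : {ffun 'I_n -> bool}) (~~ b i)%:R * hjump P.
  rewrite -mulr_suml mulrA; congr (_ * _).
  have E : \sum_(b : {ffun 'I_n -> bool}) (~~ b i)%:R =
      \sum_(b : {ffun 'I_n -> bool}) (b i)%:R :> R.
    rewrite (reindex_inj (inv_inj (@flipK i))) /=.
    by apply: eq_bigr => b _; rewrite flip_id negbK.
  have : \sum_(b : {ffun 'I_n -> bool}) (~~ b i)%:R +
      \sum_(b : {ffun 'I_n -> bool}) (b i)%:R = 2 ^+ n :> R.
    rewrite -big_split/= (eq_bigr (fun=> 1)); last first.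
      by move=> b _; case: (b i); rewrite ?addr0 ?add0r.
    by rewrite sumr_const card_ffun card_bool card_ord natrX.
  rewrite -E; set S := \sum_b _ => H.
  have -> : S = 2 ^+ n * 2^-1 by lra.
  by rewrite mulKf// gt_eqF.
rewrite /avg -mulrDr -big_split/= ler_wpM2l// ler_sum// => b _.
exact: hjump_child.
Qed.

(** Lateral jumps are controlled by vertical ones alone: by [avg_hjump] the
    sum [X] of the averages of the lateral jumps satisfies [X <= A + X / 2],
    where [A] involves vertical jumps and the lateral jump of [P]. *)
Lemma sum_hjump P M : \sum_(k < M.+1) iter k avg hjump P <=
  2 * hjump P + 4 * (\sum_(k < M) iter k.+1 avg vjump P) +
  2 * (\sum_(k < M) iter k.+1 avg vjump (nbr (step false i) P)).
Proof.
have stp k : iter k.+1 avg hjump P <= 2 * iter k.+1 avg vjump P +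
    iter k.+1 avg vjump (nbr (step false i) P) + 2^-1 * iter k avg hjump P.
  rewrite iter_avgS.
  apply: (@le_trans _ _ (iter k avg (fun Q => avg vjump Q +
     avg (vjump \o nbr (step false i)) Q + 2^-1 * hjump Q) P)).
    by apply: le_iter_avg => Q _; exact: avg_hjump.
  rewrite iter_avgD iter_avgD (iter_avgZ k 2^-1 hjump) -!iter_avgS lerD2r.
  rewrite mulrDl mul1r -addrA lerD2l.
  exact: iter_avg_nbr vjump_ge0.
set X := \sum_(k < M.+1) _; set A := \sum_(k < M) _; set B := \sum_(k < M) _.
have X0 : \sum_(k < M) iter k avg hjump P <= X.
  by rewrite /X big_ord_recr/= lerDl iter_avg_ge0//; exact: hjump_ge0.
suff : X <= hjump P + (2 * A + B + 2^-1 * X) by lra.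
rewrite {1}/X big_ord_recl/= lerD2l.
apply: (@le_trans _ _ (\sum_(k < M) (2 * iter k.+1 avg vjump P +
    iter k.+1 avg vjump (nbr (step false i) P) + 2^-1 * iter k avg hjump P))).
  by apply: ler_sum => k _; exact: stp.
rewrite big_split big_split/= -mulr_sumr -[X in _ + X <= _]mulr_sumr lerD2l.
by rewrite ler_wpM2l.
Qed.

End lateral.
End averaging.

Section lateral_inside.
Context (R : realType) (n : nat) (D : dyadic_system R n).
Implicit Types (Q P : dindex n) (f : dindex n -> R) (i : 'I_n).

Local Notation par := (par D).
Local Notation avg := (avg D).

Definition below P Q : Prop := exists k, iter k par Q = P.

Lemma below_gen P Q k : below P Q -> Q.1 = P.1 + k%:Z -> iter k par Q = P.
Proof.
move=> [l E]; have := gen_anc D l Q; rewrite E => EP EQ.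
by have <- : l = k by lia.
Qed.

Lemma belowxx P : below P P. Proof. by exists 0%N. Qed.

Lemma nbr_step_neq s i P : nbr (step s i) P <> P.
Proof.
case: P => j k [/rowP/(_ i)]; rewrite /step; case: s; rewrite !mxE !eqxx /=; lia.
Qed.

(** Only the lateral faces that lie in the interior of [P]. *)
Definition hjump_inside f i P Q : R :=
  if `[< below P Q /\ below P (nbr (step false i) Q) >] then hjump f i Q else 0.

(** Subtracting [f P] and cutting off outside [P] gives a function [g] with
    the same lateral jumps inside [P].  Its vertical jumps strictly below [P]
    are those of [f], whereas [g] vanishes at [P] and under the neighbour of
    [P], which makes every other term of [sum_hjump] disappear. *)
Lemma sum_hjump_inside f i P M :
  \sum_(k < M.+1) iter k avg (hjump_inside f i P) P <=
  4 * (\sum_(k < M) iter k.+1 avg (vjump D f) P).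
Proof.
pose g Q := if `[< below P Q >] then f Q - f P else 0.
have gN Q : below (nbr (step false i) P) Q -> g Q = 0.
  move=> [l E]; rewrite /g; case: asboolP => // /(@below_gen _ _ l).
  have := gen_anc D l Q; rewrite E /= => EP.
  have QP : Q.1 = P.1 + l%:Z by lia.
  by move=> /(_ QP) /(@nbr_step_neq false i P).
have h1 k : iter k avg (hjump_inside f i P) P <= iter k avg (hjump g i) P.
  apply: le_iter_avg => Q _; rewrite /hjump_inside; case: asboolP; last first.
    by move=> _; exact: hjump_ge0.
  move=> [h1 h2]; rewrite /hjump /g; do 2 (case: asboolP => // _).
  by rewrite opprB addrA subrK.
apply: (le_trans (ler_sum _ (fun (k : 'I_M.+1) _ => h1 k))).
apply: (le_trans (sum_hjump D g i P M)).
have -> : hjump g i P = 0.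
  rewrite /hjump (gN (nbr _ _)); last exact: belowxx.
  by rewrite /g; case: asboolP => _; rewrite ?subrr ?subr0 normr0.
rewrite mulr0 add0r.
have -> : \sum_(k < M) iter k.+1 avg (vjump D g) (nbr (step false i) P) = 0.
  apply: big1 => k _; apply/eqP; rewrite eq_le iter_avg_ge0 ?andbT; last first.
    by move=> Q; exact: vjump_ge0.
  apply: (@le_trans _ _ (iter k.+1 avg (fun=> 0) (nbr (step false i) P))).
    apply: le_iter_avg => Q E; rewrite /vjump !gN ?subrr ?normr0//.
      by exists k; rewrite -iterSr.
    by exists k.+1.
  rewrite iter_avg_martingale// => Q; exact: avg_cst.
rewrite mulr0 addr0 ler_wpM2l// ler_sum// => k _; apply: le_iter_avg => Q E.
rewrite /vjump /g; case: asboolP => [_|]; last by case; exists k.+1.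
case: asboolP => [_|]; last by case; exists k; rewrite -iterSr.
by rewrite opprB addrA subrK.
Qed.

End lateral_inside.

(** * The stopping-time approximation *)

Section stopping.
Context (R : realType) (n : nat) (D : dyadic_system R n) (hn : (0 < n)%N).
Variables (Q0 : dindex n) (u m : dindex n -> R) (e : R).
Implicit Types (Q P : dindex n).

Local Notation par := (par D).
Local Notation child := (child D).
Local Notation avg := (avg D).

(** The ancestors of a fixed cube.  The tree has no root from which a
    stopping construction could start; every branch meets this chain, which
    replaces the root. *)
Definition chain Q : Prop := below D Q Q0.

Lemma chain_par Q : chain Q -> chain (par Q).
Proof. by move=> [k <-]; exists k.+1. Qed.

Lemma ex_chain Q : exists k, `[< chain (iter k par Q) >].
Proof.
have [k [l E]] := anc_common D hn Q Q0.
by exists k; apply/asboolP; rewrite E; exists l.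
Qed.

Definition chain_depth Q : nat := ex_minn (ex_chain Q).

Fixpoint stopped k Q : R :=
  if k is k'.+1 then
    let y := stopped k' (par Q) in if `|u Q - y| <= e * m Q then y else u Q
  else u Q.

(** The approximation follows [u] on the chain.  Elsewhere it keeps the value
    of the parent as long as this value is within [e * m] of [u], and is
    reset to [u] otherwise. *)
Definition stop Q : R := stopped (chain_depth Q) Q.

Lemma stop_chain Q : chain Q -> stop Q = u Q.
Proof.
rewrite /stop /chain_depth; case: ex_minnP => k _ mk cQ.
by have := mk 0%N; rewrite /= asboolT// => /(_ isT); case: k {mk}.
Qed.

Lemma stop_rec Q : ~ chain Q ->
  stop Q = if `|u Q - stop (par Q)| <= e * m Q then stop (par Q) else u Q.
Proof.
rewrite /stop => nQ; have -> // : chain_depth Q = (chain_depth (par Q)).+1.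
rewrite /chain_depth; case: ex_minnP => -[/asboolP//|k /asboolP ck mk].
case: ex_minnP => l /asboolP cl ml; congr S; apply/eqP; rewrite eqn_leq.
apply/andP; split.
  have := mk l.+1; rewrite iterSr ltnS; apply; exact/asboolP.
by apply: ml; rewrite -iterSr; exact/asboolP.
Qed.

(* In the application [u] is the martingale of the averages of a function,
   [w] that of the averages of its absolute value, and [m] the largest value
   of [w] over the ancestors. *)
Variable w : dindex n -> R.
Hypothesis e01 : 0 < e < 1.
Hypothesis avg_u : forall Q, avg u Q = u Q.
Hypothesis avg_w : forall Q, avg w Q = w Q.
Hypothesis uw : forall Q, `|u Q| <= w Q.
Hypothesis wm : forall Q, w Q <= m Q.
Hypothesis m_par : forall Q, m (par Q) <= m Q.
Hypothesis m_max : forall Q, m Q <= Num.max (m (par Q)) (w Q).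

Let e0 : 0 < e. Proof. by case/andP: e01. Qed.
Let e1 : e < 1. Proof. by case/andP: e01. Qed.
Let N := (2 : R) ^+ n.
Let N0 : 0 < N. Proof. by rewrite exprn_gt0. Qed.
Let N2 : 2 <= N.
Proof. by rewrite -[leLHS]expr1 ler_eXn2l// ltr1n. Qed.
Let w0 Q : 0 <= w Q. Proof. exact: le_trans (uw Q). Qed.
Let m0 Q : 0 <= m Q. Proof. exact: le_trans (wm Q). Qed.
Let um Q : `|u Q| <= m Q. Proof. exact: le_trans (uw Q) (wm Q). Qed.

Lemma doubling b P : m (child b P) <= N * m P.
Proof.
apply: (le_trans (m_max _)); rewrite par_child ge_max; apply/andP; split.
  by rewrite ler_peMl// (le_trans _ N2)// ler1n.
by apply: (le_trans (child_le_avg D P b w0)); rewrite avg_w ler_wpM2l// ltW.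
Qed.

Lemma stop_close Q : `|stop Q - u Q| <= e * m Q.
Proof.
have em : 0 <= e * m Q by rewrite mulr_ge0// ltW.
have [cQ|nQ] := pselect (chain Q); first by rewrite stop_chain// subrr normr0.
rewrite stop_rec//; case: ifPn => [|_]; first by rewrite distrC.
by rewrite subrr normr0.
Qed.

Lemma stop_le Q : `|stop Q| <= 2 * m Q.
Proof.
rewrite -(subrK (u Q) (stop Q)) (le_trans (ler_normD _ _))//.
have := stop_close Q; have := um Q; have := m0 Q.
have : e * m Q <= 1 * m Q by rewrite ler_wpM2r// ltW.
lra.
Qed.

Let d Q := u Q - stop Q.
Let ch Q : R := `[< chain Q >]%:R.

(** A Bellman function for the vertical variation.  A reset brings the first
    term down to [0] from a value that is at least [e] times the jump;
    between resets [(u - stop)^2] grows on average exactly like [u^2], which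
    the second term removes.  The third term pays for the growth of the
    denominators [m] (by doubling), and the last one for the resets along the
    chain: at most one child of a cube is in the chain, hence the average of
    the indicator is at most half its value. *)
Definition bellman Q : R := d Q ^+ 2 / m Q - u Q ^+ 2 / m Q - N * m Q
  + 2 * e * (m Q * ch Q - 2 * m Q).

Lemma chain_unique b b' P : chain (child b P) -> chain (child b' P) -> b = b'.
Proof.
move=> [k E] [l E']; apply: (@child_inj _ _ D P); rewrite /= -E -E'.
have := gen_anc D k Q0; have := gen_anc D l Q0; rewrite E E' !gen_child => ? ?.
have kl : k = l by lia.
by rewrite -E -E' kl.
Qed.

Lemma avg_chain P : avg ch P <= 2^-1 * ch P.
Proof.
suff H : avg ch P <= N^-1 * ch P.
  apply: (le_trans H); rewrite ler_wpM2r// lef_pV2// posrE//.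
rewrite /avg ler_wpM2l ?invr_ge0 ?(ltW N0)//.
have [[b cb]|nb] := pselect (exists b, chain (child b P)).
  rewrite (bigD1 b)//= big1 ?addr0; last first.
    move=> b' /eqP b'b; rewrite /ch; case: asboolP => // cb'.
    by case: b'b; exact: chain_unique cb' cb.
  rewrite /ch; case: asboolP => //; case: asboolP => // nP.
  by case: nP; rewrite -(par_child D b P); exact: chain_par.
rewrite big1// => b _; rewrite /ch; case: asboolP => // cb.
by case: nb; exists b.
Qed.

(** A reset occurs when [|u Q - stop P| > e * m Q]; then the jump is [|u Q -
    stop P|] and [e * m P] times it is at most [(u Q - stop P)^2].  On the
    chain a jump is at most [2 * m Q]. *)
Lemma vjump_stop b P (Q := child b P) :
  d Q ^+ 2 / m Q + e * vjump D stop Q <=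
  (u Q - stop P) ^+ 2 / m P + 2 * e * (m Q * ch Q).
Proof.
have pQ : par Q = P by rewrite /Q par_child.
have mPQ : m P <= m Q by rewrite -pQ.
have [mP0|mP0] := eqVneq (m P) 0.
  have mQ0 : m Q = 0.
    by apply/eqP; rewrite eq_le m0 andbT (le_trans (doubling b P))// mP0 mulr0.
  have z S : m S = 0 -> stop S = 0.
    move=> mS; apply/eqP; rewrite -normr_eq0 eq_le normr_ge0 andbT.
    by rewrite (le_trans (stop_le S))// mS mulr0.
  by rewrite /vjump pQ !z// mP0 mQ0 invr0 !mulr0 mul0r subrr normr0 !mulr0 addr0.
have mP : 0 < m P by rewrite lt_def mP0 m0.
have mQ : 0 < m Q by exact: lt_le_trans mPQ.
have iPQ : (m Q)^-1 <= (m P)^-1 by rewrite lef_pV2.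
have e2 : 0 <= 2 * e * (m Q * ch Q).
  by rewrite !mulr_ge0// ?ltW// /ch ler0n.
rewrite /vjump pQ /d.
have [cQ|nQ] := pselect (chain Q).
  have cP : chain P by rewrite -pQ; exact: chain_par.
  rewrite !stop_chain// subrr expr0n/= mul0r add0r /ch asboolT// mulr1.
  have : `|u Q - u P| <= 2 * m Q.
    rewrite (le_trans (ler_normB _ _))//; have := um Q; have := um P; lra.
  have : 0 <= (u Q - u P) ^+ 2 / m P by rewrite divr_ge0// ?sqr_ge0 ?ltW.
  move=> H1 H2; have : e * `|u Q - u P| <= e * (2 * m Q).
    by rewrite ler_wpM2l// ltW.
  lra.
rewrite [stop Q]stop_rec// pQ; case: ifPn => [_|].
  rewrite subrr normr0 mulr0 addr0 -[leLHS]addr0 lerD//.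
  by rewrite ler_wpM2l// sqr_ge0.
rewrite -ltNge => jump; rewrite subrr expr0n/= mul0r add0r.
rewrite -[leLHS]addr0 lerD// ler_pdivlMr//.
rewrite -[_ ^+ 2](@real_normK _ (u Q - stop P)) ?num_real// expr2 mulrAC.
rewrite ler_wpM2r// (le_trans _ (ltW jump))// ler_wpM2l// ltW//.
Qed.

(** Replacing [m P] by [m Q] in the denominator of [u Q ^ 2] loses at most
    [(m Q / m P) * (m Q - m P)], and the first factor is at most [N] by
    doubling. *)
Lemma energy_step b P (Q := child b P) :
  u Q ^+ 2 / m P + N * m P <= u Q ^+ 2 / m Q + N * m Q.
Proof.
have mPQ : m P <= m Q by rewrite -{1}(par_child D b P).
have [mP0|mP0] := eqVneq (m P) 0.
  rewrite mP0 invr0 !mulr0 add0r addr_ge0 ?divr_ge0 ?sqr_ge0//.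
  by rewrite mulr_ge0// ltW.
have mP : 0 < m P by rewrite lt_def mP0 m0.
have mQ : 0 < m Q by exact: lt_le_trans mPQ.
have uQ : u Q ^+ 2 <= m Q * m Q.
  rewrite -[_ ^+ 2](@real_normK _ (u Q)) ?num_real// expr2.
  by rewrite ler_pM.
have E : u Q ^+ 2 / m P - u Q ^+ 2 / m Q =
    u Q ^+ 2 * ((m Q - m P) / (m P * m Q)).
  by field; rewrite !gt_eqF.
suff : u Q ^+ 2 / m P - u Q ^+ 2 / m Q <= N * (m Q - m P) by lra.
rewrite E; apply: (@le_trans _ _ (m Q * m Q * ((m Q - m P) / (m P * m Q)))).
  by rewrite ler_wpM2r// divr_ge0 ?subr_ge0// mulr_ge0.
have -> : m Q * m Q * ((m Q - m P) / (m P * m Q)) = m Q / m P * (m Q - m P).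
  by field; rewrite !gt_eqF.
rewrite ler_wpM2r ?subr_ge0// ler_pdivrMr//; exact: doubling.
Qed.

(** After [vjump_stop] and [energy_step] the left-hand side is bounded by the
    average of a function that is affine in [u] and in the indicator of the
    chain, where the martingale property of [u] applies. *)
Lemma bellman_supersolution P :
  avg (fun Q => bellman Q + e * vjump D stop Q) P <= bellman P.
Proof.
(* the majorant [F] is affine in [u], with coefficients that depend on [P]
   only *)
pose F Q := (stop P ^+ 2 / m P - N * m P - 4 * e * m P) +
  ((- (2 * stop P / m P)) * u Q + 4 * e * m P * ch Q).
apply: (@le_trans _ _ (avg F P)).
  apply: le_avg => b; set Q := child b P.
  have := vjump_stop b P; have := energy_step b P; rewrite /= -/Q => h1 h2.
  have mPQ : m P <= m Q by rewrite -{1}(par_child D b P).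
  have h3 : e * m P * (1 - ch Q) <= e * m Q * (1 - ch Q).
    rewrite ler_wpM2r ?ler_wpM2l ?(ltW e0)//.
    by rewrite /ch; case: asboolP; rewrite ?subrr ?subr0.
  have E : (u Q - stop P) ^+ 2 / m P = u Q ^+ 2 / m P + stop P ^+ 2 / m P
      - 2 * stop P / m P * u Q by ring.
  rewrite /bellman /F; rewrite E in h2; lra.
rewrite /F avgD avg_cst avgD !avgZ avg_u.
have h : 4 * e * m P * avg ch P <= 4 * e * m P * (2^-1 * ch P).
  by rewrite ler_wpM2l ?avg_chain// !mulr_ge0// ltW.
have E : d P ^+ 2 / m P - u P ^+ 2 / m P =
   stop P ^+ 2 / m P - 2 * stop P / m P * u P by rewrite /d; ring.
rewrite /bellman E; lra.
Qed.

Lemma le_iter_majorant M P : m P <= iter M avg m P.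
Proof.
elim: M P => [//|k IH] P; rewrite iterS; apply: (@le_trans _ _ (avg m P)).
  rewrite -{1}(avg_cst D (m P) P); apply: le_avg => b.
  by rewrite -{1}(par_child D b P).
by apply: le_avg => b; exact: IH.
Qed.

(** Summing [bellman_supersolution] over the generations telescopes to the
    difference of the Bellman function at [P] and of its average [M]
    generations below, and the function lies between [- (5 + N) * m] and [3 *
    m]. *)
Lemma sum_vjump_stop P M :
  e * \sum_(k < M) iter k.+1 avg (vjump D stop) P <=
  (8 + N) * iter M avg m P.
Proof.
have step1 k : e * iter k.+1 avg (vjump D stop) P <=
    iter k avg bellman P - iter k.+1 avg bellman P.
  rewrite lerBrDr -iter_avgZ -iter_avgD iter_avgS.
  apply: le_iter_avg => Q _; apply: le_trans (bellman_supersolution Q).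
  by apply: le_avg => b; rewrite addrC.
have tele : e * \sum_(k < M) iter k.+1 avg (vjump D stop) P <=
    bellman P - iter M avg bellman P.
  elim: M => [|M IH]; first by rewrite big_ord0 mulr0 subrr.
  rewrite big_ord_recr/= mulrDr.
  have := step1 M; rewrite /=; lra.
have ub : bellman P <= 3 * m P.
  rewrite /bellman.
  have h1 : d P ^+ 2 / m P <= m P.
    have [->|mP] := eqVneq (m P) 0; first by rewrite invr0 mulr0.
    rewrite ler_pdivrMr ?lt_def ?mP ?m0//.
    rewrite -[_ ^+ 2](@real_normK _ (d P)) ?num_real// expr2.
    have : `|d P| <= m P.
      rewrite /d distrC (le_trans (stop_close P))//.
      by rewrite -[leRHS]mul1r ler_wpM2r// ltW.
    by move=> h; rewrite ler_pM.
  have h2 : 0 <= u P ^+ 2 / m P by rewrite divr_ge0// sqr_ge0.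
  have h3 : 0 <= N * m P by rewrite mulr_ge0// ltW.
  have h4 : e * (m P * ch P - 2 * m P) <= 0.
    rewrite pmulr_rle0// -[m P * _ - _]opprB oppr_le0 subr_ge0.
    rewrite /ch; case: asboolP => _; rewrite ?mulr1 ?mulr0; have := m0 P; lra.
  have := m0 P; lra.
have lb Q : - bellman Q <= (5 + N) * m Q.
  rewrite /bellman.
  have h1 : u Q ^+ 2 / m Q <= m Q.
    have [->|mP] := eqVneq (m Q) 0; first by rewrite invr0 mulr0.
    rewrite ler_pdivrMr ?lt_def ?mP ?m0//.
    rewrite -[_ ^+ 2](@real_normK _ (u Q)) ?num_real// expr2.
    by rewrite ler_pM.
  have h2 : 0 <= d Q ^+ 2 / m Q by rewrite divr_ge0// sqr_ge0.
  have h4 : 0 <= e * (m Q * ch Q) by rewrite !mulr_ge0// ?ltW// /ch ler0n.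
  have h5 : e * m Q <= m Q by rewrite -[leRHS]mul1r ler_wpM2r// ltW.
  have := m0 Q; lra.
have mP := le_iter_majorant M P.
have lb' : - iter M avg bellman P <= (5 + N) * iter M avg m P.
  rewrite -iter_avgZ -mulN1r -iter_avgZ; apply: le_iter_avg => Q _.
  by rewrite mulN1r.
lra.
Qed.

End stopping.

(** * Half-open cubes and Lebesgue measure *)

Section countable_fibers.
Context d (T : measurableType d) (I : countType) (k : T -> I).
Hypothesis mk : forall i, measurable (k @^-1` [set i]).

Lemma measurable_fibers (P : set I) : measurable (k @^-1` P).
Proof.
have -> : k @^-1` P = \bigcup_(i in P) (k @^-1` [set i]).
  apply/seteqP; split => [x Px|x [i Pi ki]]; first by exists (k x).
  by rewrite /preimage/= -ki in Pi *.
have -> : \bigcup_(i in P) (k @^-1` [set i]) =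
    \bigcup_m (if unpickle m is Some i then
      (if `[< P i >] then k @^-1` [set i] else set0) else set0).
  apply/seteqP; split => [x [i Pi xi]|x [m _]].
    by exists (pickle i) => //; rewrite pickleK asboolT.
  by case: unpickle => // i; case: asboolP => // Pi ki; exists i.
apply: bigcup_measurable => m _; case: unpickle => // i.
by case: asboolP.
Qed.

(** Functions that factor through countably many cells are measurable as soon
    as the cells are, whatever the second factor is. *)
Lemma measurable_fun_fibers d' (T' : measurableType d') (F : I -> T') :
  measurable_fun setT (F \o k).
Proof.
by move=> _ Y mY; rewrite setTI; exact: (measurable_fibers (F @^-1` Y)).
Qed.

End countable_fibers.

Section boxes.
Context (R : realType).

Definition box n (I : 'I_n -> set R) : set 'rV[R]_n :=
  [set x | forall i, I i (x 0 i)].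

Lemma measurable_box n (I : 'I_n -> set R) : (forall i, measurable (I i)) ->
  measurable (box I).
Proof.
move=> mI; have -> : box I = \big[setI/setT]_(i <- enum 'I_n)
    ((fun x : 'rV[R]_n => x 0 i) @^-1` I i).
  rewrite -bigcap_seq; apply/seteqP; split => [x Ix i _|x Ix i]; first exact: Ix.
  by apply: Ix; rewrite /= mem_enum.
apply: bigsetI_measurable => i _; rewrite -[X in measurable X]setTI.
exact: measurable_coord.
Qed.

Lemma leb_box n (I : 'I_n -> set R) (l : 'I_n -> R) :
  (forall i, measurable (I i)) ->
  (forall i, lebesgue_measure (I i) = (l i)%:E) ->
  leb n (box I) = (\prod_i l i)%:E.
Proof.
elim: n I l => [|n IH] I l mI lI.
  rewrite big_ord0 /= diracE mem_set//; by case.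
have -> : leb n.+1 (box I) =
    ((@lebesgue_measure R \x leb n)%E (@rVcons R n @^-1` box I)) by [].
have -> : @rVcons R n @^-1` box I =
    I ord0 `*` box (fun i : 'I_n => I (lift ord0 i)).
  apply/seteqP; split => [[t x] /= tx|[t x] /= [It Ix] i].
    split; first by have := tx ord0; rewrite /rVcons mxE unlift_none.
    by move=> i /=; have := tx (lift ord0 i); rewrite /rVcons mxE liftK.
  rewrite /rVcons mxE; case: unliftP => [j ->|->]; [exact: Ix|exact: It].
rewrite product_measure1E; [|exact: mI|exact: measurable_box].
rewrite big_ord_recl EFinM; congr mule; first exact: lI.
exact: (IH _ (fun i => l (lift ord0 i))).
Qed.

End boxes.

Section dyadic_measure.
Context (R : realType) (n : nat) (D : dyadic_system R n).
Implicit Types (Q P : dindex n) (x : 'rV[R]_n).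

Local Notation par := (par D).
Local Notation child := (child D).
Local Notation avg := (avg D).
Local Notation locate := (locate D).

(** The half-open cubes of one generation partition the space; the open cube
    of the same index differs from the half-open one by a null set
    ([leb_boundary]). *)
Definition hcube Q : set 'rV[R]_n := [set x | locate Q.1 x = Q].

Definition dvol Q : R := dside R Q ^+ n.

Lemma dvol_gt0 Q : 0 < dvol Q. Proof. by rewrite exprn_gt0// side_gt0. Qed.

Lemma dvol_child b P : 2 ^+ n * dvol (child b P) = dvol P.
Proof. by rewrite /dvol side_child -exprMn mulrC divfK. Qed.

Definition corner Q i : R := dorigin D Q.1 0 i + dside R Q * (Q.2 0 i)%:~R.

Lemma hcubeE Q : hcube Q =
  box (fun i => `[corner Q i, corner Q i + dside R Q[%classic).
Proof.
have p0 := pow2_gt0 R Q.1; have s0 := side_gt0 R Q.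
have E : 2 ^ Q.1 = (dside R Q)^-1 by rewrite /dside pow2N invrK.
apply/seteqP; split => x.
  move=> /locateP h i /=; rewrite in_itv/= /corner; have := h i.
  rewrite E ler_pdivlMr// ltr_pdivrMr// mulrDl mul1r; lra.
move=> h; apply/locateP => i; have := h i; rewrite /= in_itv/= /corner E.
rewrite ler_pdivlMr// ltr_pdivrMr// mulrDl mul1r; lra.
Qed.

Lemma dcube_box Q : dcube D Q =
  box (fun i => `]corner Q i, corner Q i + dside R Q[%classic).
Proof.
have p0 := pow2_gt0 R Q.1; have s0 := side_gt0 R Q.
have E : 2 ^ Q.1 = (dside R Q)^-1 by rewrite /dside pow2N invrK.
apply/seteqP; split => x.
  move=> /dcubeE h i /=; rewrite in_itv/= /corner; have := h i.
  rewrite E ltr_pdivlMr// ltr_pdivrMr// mulrDl mul1r; lra.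
move=> h; apply/dcubeE => i; have := h i; rewrite /= in_itv/= /corner E.
rewrite ltr_pdivlMr// ltr_pdivrMr// mulrDl mul1r; lra.
Qed.

Lemma measurable_hcube Q : measurable (hcube Q).
Proof. by rewrite hcubeE; apply: measurable_box => i; exact: measurable_itv. Qed.

Lemma measurable_dcube Q : measurable (dcube D Q).
Proof. by rewrite dcube_box; apply: measurable_box => i; exact: measurable_itv. Qed.

Let prod_side Q : \prod_(i < n) dside R Q = dvol Q.
Proof. by rewrite prodr_const card_ord. Qed.

Lemma leb_hcube Q : leb n (hcube Q) = (dvol Q)%:E.
Proof.
rewrite hcubeE (leb_box (l := fun=> dside R Q)) ?prod_side//.
by move=> i; rewrite lebesgue_measure_itv/= lte_fin ltrDl side_gt0 -EFinD addrAC subrr add0r.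
Qed.

Lemma leb_dcube Q : leb n (dcube D Q) = (dvol Q)%:E.
Proof.
rewrite dcube_box (leb_box (l := fun=> dside R Q)) ?prod_side//.
by move=> i; rewrite lebesgue_measure_itv/= lte_fin ltrDl side_gt0 -EFinD addrAC subrr add0r.
Qed.

Lemma vol_dcube Q : vol (dcube D Q) = dvol Q.
Proof. by rewrite /vol leb_dcube. Qed.

Lemma dcube_sub_hcube Q : dcube D Q `<=` hcube Q.
Proof. by move=> x /dcube_locate. Qed.

Lemma leb_boundary Q : leb n (hcube Q `\` dcube D Q) = 0%E.
Proof.
rewrite measureD//; [|exact: measurable_hcube|exact: measurable_dcube|].
  rewrite setIidr; last exact: dcube_sub_hcube.
  by rewrite [X in (X - _)%E]leb_hcube [X in (_ - X)%E]leb_dcube subee.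
by rewrite [X in (X < _)%E]leb_hcube ltry.
Qed.

Lemma integral_dcube Q (h : 'rV[R]_n -> \bar R) :
  measurable_fun [set: 'rV[R]_n] h ->
  (\int[leb n]_(x in dcube D Q) h x = \int[leb n]_(x in hcube Q) h x)%E.
Proof.
move=> mh; have mH := measurable_hcube Q; have mD := measurable_dcube Q.
have H (g : 'rV[R]_n -> \bar R) : measurable_fun [set: 'rV[R]_n] g ->
    (forall x, 0 <= g x)%E ->
  (\int[leb n]_(x in dcube D Q) g x = \int[leb n]_(x in hcube Q) g x)%E.
  move=> mg g0.
  rewrite [RHS](@ge0_negligible_integral _ _ _ _ _ (hcube Q `\` dcube D Q))//.
  - by rewrite setDD setIidr//; exact: dcube_sub_hcube.
  - exact: measurableD.
  - exact: measurable_funS mg.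
  - exact: leb_boundary.
rewrite integralE [RHS]integralE; congr (_ - _)%E; apply: H => //.
  exact: measurable_funepos.
exact: measurable_funeneg.
Qed.

Lemma measurable_fun_locate j d' (T' : measurableType d') (F : dindex n -> T') :
  measurable_fun [set: 'rV[R]_n] (F \o locate j).
Proof.
apply: measurable_fun_fibers => Q.
have [jQ|jQ] := eqVneq Q.1 j.
  rewrite (_ : _ @^-1` _ = hcube Q); first exact: measurable_hcube.
  by rewrite /hcube jQ.
rewrite (_ : _ @^-1` _ = set0)//.
by apply/seteqP; split => [x /= E|//]; move: jQ; rewrite -E eqxx.
Qed.

Lemma hcube_locate j x : hcube (locate j x) x. Proof. by []. Qed.

Lemma hcube_child P : hcube P = \big[setU/set0]_b hcube (child b P).
Proof.
rewrite -bigcup_seq; apply/seteqP; split => x.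
  move=> xP; have [b E] := childP D (locate (P.1 + 1) x).
  exists b; first by rewrite /= mem_index_enum.
  have PE : P = par (locate (P.1 + 1) x) by rewrite par_locate addrK.
  by rewrite /hcube /= {2}PE E.
by move=> [b _] /=; rewrite /hcube /= => E; rewrite -[RHS](par_child D b P) -E par_locate addrK.
Qed.

Lemma hcube_inj P Q x : P.1 = Q.1 -> hcube P x -> hcube Q x -> P = Q.
Proof. by rewrite /hcube /= => <- <- <-. Qed.

Lemma hcube_anc k Q x : hcube Q x -> hcube (iter k par Q) x.
Proof. by rewrite /hcube /= gen_anc => <-; rewrite anc_locate. Qed.

(** The sets [E m P] stand for the part of a region above [P] that lies [m]
    generations below: as they split along the children, an integral that is
    known on each [E 0 Q] is an iterated average on [E m P].  It serves for
    cubes and for slabs of the half-space. *)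
Lemma integral_tree d (T : measurableType d) (mu : {measure set T -> \bar R})
    (E : nat -> dindex n -> set T) (h : T -> \bar R) (G : dindex n -> R) :
  (forall m P, measurable (E m P)) ->
  (forall m P, E m.+1 P = \big[setU/set0]_b E m (child b P)) ->
  (forall m P b b', b <> b' -> E m (child b P) `&` E m (child b' P) = set0) ->
  measurable_fun [set: T] h -> (forall z, 0 <= h z)%E ->
  forall m P,
  (forall Q, iter m par Q = P -> \int[mu]_(z in E 0%N Q) h z = (dvol Q * G Q)%:E)%E ->
  (\int[mu]_(z in E m P) h z = (dvol P * iter m avg G P)%:E)%E.
Proof.
move=> mE EU E0 mh h0; elim=> [|m IH] P HQ; first exact: HQ.
rewrite EU ge0_integral_bigsetU//=; last 3 first.
- exact: index_enum_uniq.
- apply/trivIsetP => b b' _ _ /eqP bb'; exact: E0.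
- by apply: measurable_funS mh.
rewrite (eq_bigr (fun b => (dvol (child b P) * iter m avg G (child b P))%:E)).
  rewrite sumEFin; congr EFin.
  rewrite -[avg _ P]/((2 ^+ n)^-1 * \sum_b iter m avg G (child b P)).
  rewrite mulrA mulr_sumr; apply: eq_bigr => b _.
  by rewrite -(dvol_child b P); field; rewrite expf_neq0.
move=> b _; apply: IH => Q QP; apply: HQ.
by rewrite iterS QP par_child.
Qed.

Lemma integral_hcube_locate m P (F : dindex n -> R) : (forall Q, 0 <= F Q) ->
  (\int[leb n]_(x in hcube P) (F (locate (P.1 + m%:Z) x))%:E =
   (dvol P * iter m avg F P)%:E)%E.
Proof.
move=> F0; pose j := P.1 + m%:Z.
apply: (@integral_tree _ _ (leb n) (fun=> hcube) (fun x => (F (locate j x))%:E)).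
- by move=> _ Q; exact: measurable_hcube.
- by move=> _ Q; exact: hcube_child.
- move=> _ Q b b' bb'; apply/seteqP; split => // x [] h1 h2; apply: bb'.
  by apply: (@child_inj _ _ D Q); exact: hcube_inj h1 h2.
- apply/measurable_EFinP; exact: measurable_fun_locate.
- by move=> x; rewrite lee_fin.
- move=> Q QP.
  have QE : Q.1 = j by rewrite /j -QP gen_anc subrK.
  rewrite (eq_integral (cst (F Q)%:E)).
    rewrite integral_cst; last exact: measurable_hcube.
    by rewrite [X in (_ * X)%E]leb_hcube -EFinM mulrC.
  by move=> x; rewrite inE /hcube /= QE => ->.
Qed.

Definition mean (h : 'rV[R]_n -> \bar R) P : R :=
  fine (\int[leb n]_(x in hcube P) h x) / dvol P.

Definition locally_finite_integral (h : 'rV[R]_n -> \bar R) :=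
  forall P, (\int[leb n]_(x in hcube P) h x < +oo)%E.

Section mean.
Variable h : 'rV[R]_n -> \bar R.
Hypothesis mh : measurable_fun [set: 'rV[R]_n] h.
Hypothesis h0 : forall x, (0 <= h x)%E.

Lemma mean_ge0 P : 0 <= mean h P.
Proof.
rewrite /mean divr_ge0 ?(ltW (dvol_gt0 P))// fine_ge0//.
by apply: integral_ge0 => x _; exact: h0.
Qed.

Hypothesis hfin : locally_finite_integral h.

Lemma integral_mean P :
  (\int[leb n]_(x in hcube P) h x = (dvol P * mean h P)%:E)%E.
Proof.
rewrite /mean mulrC divfK ?gt_eqF ?dvol_gt0// fineK// ge0_fin_numE//.
by apply: integral_ge0 => x _; exact: h0.
Qed.

(** The martingale property of the averages of a function. *)
Lemma avg_mean P : avg (mean h) P = mean h P.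
Proof.
have : (\int[leb n]_(x in hcube P) h x = (dvol P * iter 1 avg (mean h) P)%:E)%E.
  apply: (@integral_tree _ _ (leb n) (fun=> hcube) h) => //.
  - by move=> _ Q; exact: measurable_hcube.
  - by move=> _ Q; exact: hcube_child.
  - move=> _ Q b b' bb'; apply/seteqP; split => // x [] h1 h2; apply: bb'.
    by apply: (@child_inj _ _ D Q); exact: hcube_inj h1 h2.
  - by move=> Q _; exact: integral_mean.
rewrite integral_mean => -[] /(mulfI _) <- //.
by rewrite gt_eqF// dvol_gt0.
Qed.

(** A lower bound on the open cube suffices, the boundary being negligible. *)
Lemma le_mean (a : R) P : (forall x, dcube D P x -> a%:E <= h x)%E -> a <= mean h P.
Proof.
move=> ah; have [a0|a0] := leP a 0; first by rewrite (le_trans a0)// mean_ge0.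
rewrite -(ler_pM2l (dvol_gt0 P)) -lee_fin -integral_mean -integral_dcube//.
have -> : (dvol P * a)%:E = (\int[leb n]_(x in dcube D P) a%:E)%E.
  rewrite integral_cst; last exact: measurable_dcube.
  by rewrite [X in (_ * X)%E]leb_dcube -EFinM mulrC.
apply: ge0_le_integral => //.
- exact: measurable_dcube.
- by move=> x _; rewrite lee_fin ltW.
- exact: measurable_funS mh.
Qed.

End mean.

End dyadic_measure.

(** * Inequalities for integrals *)

Section ereal_integral.
Local Open Scope ereal_scope.
Context d (T : measurableType d) (R : realType).
Variable mu : {measure set T -> \bar R}.

(** The integral of a nonnegative function is a supremum over simple
    functions below it, hence monotone without reference to measurability.
    This makes it applicable to the uncountable suprema [NT] and [CT]. *)
Lemma le_integral_ge0 (D : set T) (f g : T -> \bar R) :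
  (forall x, D x -> 0 <= f x) -> (forall x, D x -> f x <= g x) ->
  \int[mu]_(x in D) f x <= \int[mu]_(x in D) g x.
Proof.
move=> f0 fg; rewrite !ge0_integralE//; last first.
  by move=> x Dx; apply: le_trans (fg x Dx); exact: f0.
apply: ge_ereal_sup => _ [k kf <-]; apply: ereal_sup_ubound; exists k => // x.
apply: (le_trans (kf x)).
by apply: lee_restrict => y; exact: fg.
Qed.

Lemma limn_einf_ge (u : (\bar R)^nat) (a : \bar R) :
  (\forall k \near \oo, a <= u k) -> a <= limn_einf u.
Proof.
move=> [N _ aN]; rewrite limn_einf_lim.
apply: lime_ge; first exact: is_cvg_einfs.
exists N => // k /= Nk; apply: le_ereal_inf_tmp => _ [m /= km <-].
by apply: aN => /=; exact: leq_trans km.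
Qed.

Lemma limn_einf_le (u : (\bar R)^nat) (a : \bar R) :
  (forall k, u k <= a) -> limn_einf u <= a.
Proof.
move=> ua; rewrite limn_einf_lim.
apply: lime_le; first exact: is_cvg_einfs.
apply: nearW => k; apply: le_trans (ua k).
by apply: ereal_inf_lbound; exists k => //=.
Qed.

Lemma le_poweR (a b : \bar R) (r : R) : (0 <= r)%R -> 0 <= a -> a <= b ->
  a `^ r <= b `^ r.
Proof.
move=> r0 a0 ab; apply: gt0_ler_poweR => //; rewrite in_itv/= ?a0 ?leey//.
by rewrite (le_trans a0 ab).
Qed.

Lemma Lnorm_le (p : R) (f g : T -> \bar R) (C : R) : (0 < p)%R -> (0 <= C)%R ->
  \int[mu]_x (`|f x| `^ p) <= (C `^ p)%:E * \int[mu]_x (`|g x| `^ p) ->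
  'N[mu]_(p%:E)[f] <= C%:E * 'N[mu]_(p%:E)[g].
Proof.
move=> p0 C0 H; have p0' : p != 0%R by rewrite gt_eqF.
have i0 (h : T -> \bar R) : 0 <= \int[mu]_x (`|h x| `^ p).
  by apply: integral_ge0 => x _; exact: poweR_ge0.
rewrite !unlock /=.
apply: (@le_trans _ _ (((C `^ p)%:E * \int[mu]_x (`|g x| `^ p)) `^ p^-1)).
  by apply: le_poweR => //; rewrite invr_ge0 ltW.
rewrite poweRM ?lee_fin ?powR_ge0// poweR_EFin -powRrM divff// powRr1//.
Qed.

End ereal_integral.

(** * The maximal inequality of Doob on the tree *)

Section young.
Context (R : realType) (p : R).
Hypothesis p1 : 1 < p.

Lemma young (a b : R) : 0 <= a -> 0 <= b ->
  p * a `^ (p - 1) * b <= (p - 1) * a `^ p + b `^ p.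
Proof.
move=> a0 b0; have p0 : 0 < p by rewrite (lt_trans _ p1).
have q0 : 0 < p / (p - 1) by rewrite divr_gt0// subr_gt0.
have pq : (p / (p - 1))^-1 + p^-1 = 1.
  by field; rewrite gt_eqF//= gt_eqF// subr_gt0.
have := conjugate_powR (powR_ge0 a (p - 1)) b0 q0 p0 pq.
rewrite -powRrM mulrCA divff ?mulr1; last by rewrite gt_eqF// subr_gt0.
move=> H; have : p * (a `^ (p - 1) * b) <= p * (a `^ p / (p / (p - 1)) + b `^ p / p).
  by rewrite ler_pM2l.
have -> : p * (a `^ p / (p / (p - 1)) + b `^ p / p) = (p - 1) * a `^ p + b `^ p.
  by field; rewrite !gt_eqF//= subr_gt0.
by rewrite mulrA.
Qed.

End young.

Section doob.
Context (R : realType) (n : nat) (D : dyadic_system R n) (p : R) (p1 : 1 < p).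
Variable w : dindex n -> R.
Hypothesis w0 : forall Q, 0 <= w Q.
Hypothesis avg_w : forall Q, avg D w Q = w Q.
Implicit Types (P Q : dindex n).

Local Notation par := (par D).
Local Notation avg := (avg D).

(** The number of generations is bounded so that the induction in [doob] can
    start. *)
Fixpoint runmax k Q : R :=
  if k is k'.+1 then Num.max (w Q) (runmax k' (par Q)) else w Q.

Lemma runmax_ge k Q : w Q <= runmax k Q.
Proof. by case: k => [|k]//=; rewrite le_max lexx. Qed.

Lemma runmax_ge0 k Q : 0 <= runmax k Q.
Proof. exact: le_trans (w0 Q) (runmax_ge k Q). Qed.

Let p0 : 0 < p. Proof. exact: lt_trans p1. Qed.
Let p10 : 0 < p - 1. Proof. by rewrite subr_gt0. Qed.

(** With [q = p / (p - 1)] the function [Phi = M^p - q * M^(p - 1) * w] is a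
    supermartingale, [M] being the running maximum: when [M] is unchanged it
    is affine in [w], and when [w] exceeds [M] Young's inequality applies.
    It starts at a nonpositive value, and Young's inequality with [2 * w]
    bounds [M^p] by [2 * Phi + 2^p / (p - 1) * w^p]. *)
Lemma doob k P : iter k avg (fun Q => runmax k Q `^ p) P <=
  2 `^ p / (p - 1) * iter k avg (fun Q => w Q `^ p) P.
Proof.
pose q := p / (p - 1); have q0 : 0 < q by rewrite divr_gt0.
pose Phi k Q := runmax k Q `^ p - q * runmax k Q `^ (p - 1) * w Q.
have powB1 (a : R) : 0 <= a -> a `^ (p - 1) * a = a `^ p.
  by move=> a0; rewrite mulrC mulr_powRB1.
have step j Q : avg (Phi j.+1) Q <= Phi j Q.
  pose L S := runmax j Q `^ p + (- (q * runmax j Q `^ (p - 1))) * w S.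
  apply: (@le_trans _ _ (avg L Q)); last first.
    by rewrite /L avgD avg_cst avgZ avg_w /Phi mulNr.
  apply: le_avg => b; rewrite /Phi /L /= par_child mulNr.
  set x := w _; set M := runmax j Q.
  have M0 : 0 <= M by exact: runmax_ge0.
  have x0 : 0 <= x by exact: w0.
  have [//|Mx] := leP x M; rewrite -mulrA powB1//.
  have := young p1 M0 x0.
  have qE : (p - 1) * q = p by rewrite /q mulrCA divff ?mulr1// gt_eqF.
  move=> H; rewrite -(ler_pM2l p10).
  have -> : (p - 1) * (x `^ p - q * x `^ p) = - x `^ p.
    by rewrite mulrBr mulrA qE mulrBl mul1r addrAC subrr add0r.
  have -> : (p - 1) * (M `^ p - q * M `^ (p - 1) * x) =
      (p - 1) * M `^ p - ((p - 1) * q) * M `^ (p - 1) * x by ring.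
  by rewrite qE; lra.
have tele : iter k avg (Phi k) P <= Phi 0%N P.
  elim: k => [//|k IH]; rewrite iter_avgS; apply: le_trans IH.
  by apply: le_iter_avg => Q _; exact: step.
have Phi0 : Phi 0%N P <= 0.
  rewrite /Phi /= -mulrA powB1// -[X in X - _]mul1r -mulrBl mulr_le0_ge0//.
    by rewrite subr_le0 /q ler_pdivlMr// mul1r lerBlDr lerDl.
  exact: powR_ge0.
have pt Q : runmax k Q `^ p <= 2 * Phi k Q + 2 `^ p / (p - 1) * w Q `^ p.
  have := young p1 (runmax_ge0 k Q) (mulr_ge0 (ler0n R 2) (w0 Q)).
  rewrite powRM// /Phi => H.
  set A := runmax k Q `^ p in H *.
  have H2 : 2 * q * runmax k Q `^ (p - 1) * w Q <= A + 2 `^ p / (p - 1) * w Q `^ p.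
    rewrite -(ler_pM2l p10).
    have -> : (p - 1) * (2 * q * runmax k Q `^ (p - 1) * w Q) =
       p * runmax k Q `^ (p - 1) * (2 * w Q).
      by rewrite /q; field; rewrite gt_eqF.
    apply: (le_trans H); rewrite mulrDr lerD2l.
    have -> // : (p - 1) * (2 `^ p / (p - 1) * w Q `^ p) = 2 `^ p * w Q `^ p.
    by field; rewrite gt_eqF.
  lra.
apply: (@le_trans _ _ (iter k avg (fun Q => 2 * Phi k Q + 2 `^ p / (p - 1) * w Q `^ p) P)).
  by apply: le_iter_avg => Q _; exact: pt.
by rewrite iter_avgD !iter_avgZ gerDr pmulr_rle0//; exact: le_trans Phi0.
Qed.

(** The contribution of generation [k] to the power of the running maximum.
    Decomposing the maximum into increments allows each generation to be
    translated separately, which a translation of a whole branch of the tree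
    would not preserve. *)
Definition increment k Q : R :=
  if k is k'.+1 then runmax k Q `^ p - runmax k' (par Q) `^ p else w Q `^ p.

Lemma increment_ge0 k Q : 0 <= increment k Q.
Proof.
case: k => [|k] /=; first exact: powR_ge0.
rewrite subr_ge0 ge0_ler_powR ?nnegrE ?runmax_ge0// ?(ltW p0)//.
  by rewrite le_max w0.
by rewrite le_max lexx orbT.
Qed.

Lemma sum_increment k Q :
  runmax k Q `^ p = \sum_(j < k.+1) increment j (iter (k - j) par Q).
Proof.
elim: k Q => [|k IH] Q; first by rewrite big_ord_recl big_ord0 addr0.
rewrite big_ord_recr /= subnn /= addrC -[LHS](subrK (runmax k (par Q) `^ p)).
congr (_ + _); rewrite IH; apply: eq_bigr => j _.
by rewrite subSn -?iterSr// -ltnS.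
Qed.

Lemma avg_par (h : dindex n -> R) P : avg (h \o par) P = h P.
Proof.
rewrite -[RHS](avg_cst D (h P) P); apply/eqP; rewrite eq_le.
by rewrite !le_avg// => b /=; rewrite par_child.
Qed.

Lemma sum_avg_increment k P :
  \sum_(j < k.+1) iter j avg (increment j) P =
  iter k avg (fun Q => runmax k Q `^ p) P.
Proof.
elim: k => [|k IH]; first by rewrite big_ord_recl big_ord0 addr0.
rewrite big_ord_recr /= IH -[iter k avg _ P]/(iter k avg _ P).
have -> : avg (iter k avg (increment k.+1)) P = iter k.+1 avg (fun Q => runmax k.+1 Q `^ p) P
    - iter k avg (fun Q => runmax k Q `^ p) P.
  have -> : avg (iter k avg (increment k.+1)) P = iter k.+1 avg (increment k.+1) P by [].
  rewrite /increment iter_avgB; congr (_ - _).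
  rewrite iter_avgS; congr (iter k avg _ _); apply/funext => Q.
  by rewrite (avg_par (fun Q => runmax k Q `^ p)).
by rewrite addrC subrK.
Qed.

End doob.

Section translation.
Local Open Scope ereal_scope.
Context (R : realType) (n : nat) (D : dyadic_system R n).
Implicit Types (Q : dindex n) (F : dindex n -> R).

Lemma integral_locate_esum j F : (forall Q, 0 <= F Q)%R ->
  \int[leb n]_x (F (locate D j x))%:E =
  \esum_(k in [set: 'rV[int]_n]) ((F (j, k))%:E * (dvol R (j, k))%:E).
Proof.
move=> F0.
pose E (i : nat) : set 'rV[R]_n :=
  if pickle_inv i is Some k then hcube D (j, k) else set0.
have TE : setT = \bigcup_i E i.
  apply/esym/seteqP; split => // x _; exists (pickle (locate D j x).2) => //.
  by rewrite /E pickleK_inv.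
rewrite TE ge0_integral_bigcup//=; last 4 first.
- by move=> i; rewrite /E; case: pickle_inv => // k; exact: measurable_hcube.
- rewrite -TE; apply/measurable_EFinP; exact: measurable_fun_locate.
- by move=> x _; rewrite lee_fin.
- apply/trivIsetP => i i' _ _ ii'; apply/seteqP; split => // x [].
  rewrite /E; have := @pickle_invK 'rV[int]_n i.
  have := @pickle_invK 'rV[int]_n i'.
  case: (pickle_inv i) => // k; case: (pickle_inv i') => // k' /= e1 e2.
  rewrite /hcube /= => -> [kk']; move: ii'.
  by rewrite -e1 -e2 kk' eqxx.
pose c (i : nat) : \bar R :=
  if pickle_inv i is Some k then (F (j, k))%:E * (dvol R (j, k))%:E else 0.
have c0 i : 0 <= c i.
  by rewrite /c; case: pickle_inv => // k; rewrite mule_ge0 ?lee_fin ?(ltW (dvol_gt0 R (j, k))).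
rewrite (eq_eseriesr (g := c)); last first.
  move=> i _; rewrite /c /E; case: pickle_inv => [k|]; last by rewrite integral_set0.
  rewrite (eq_integral (cst (F (j, k))%:E)).
    rewrite integral_cst; last exact: measurable_hcube.
    by congr (_ * _); exact: leb_hcube.
  by move=> x; rewrite inE /hcube /= => ->.
rewrite nneseries_esumT//.
pose J : set nat := [set i | pickle_inv i != None :> option 'rV[int]_n].
transitivity (\esum_(i in J) c i).
  rewrite [RHS]esum_mkcond; apply: eq_esum => i _; case: ifPn => //.
  by rewrite notin_setE /J /c /=; case: pickle_inv => // k [].
rewrite (reindex_esum [set: 'rV[int]_n] J pickle); last first.
  split=> [k _|k k' _ _ |i]; first by rewrite /J /= pickleK_inv.
    by move=> E1; apply: (pcan_inj (@pickleK _)) E1.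
  rewrite /J /=; have := @pickle_invK 'rV[int]_n i.
  by case: pickle_inv => // k /= <- _; exists k.
by apply: eq_esum => k _; rewrite /c pickleK_inv.
Qed.

(** The translates of a step function of generation [j] by a lattice vector
    only permute its cells, all of the same volume. *)
Lemma integral_nbr j v F : (forall Q, 0 <= F Q)%R ->
  \int[leb n]_x (F (nbr v (locate D j x)))%:E =
  \int[leb n]_x (F (locate D j x))%:E.
Proof.
move=> F0; rewrite (integral_locate_esum j F0).
rewrite (@integral_locate_esum j (fun Q => F (nbr v Q)))//.
rewrite [RHS](reindex_esum [set: 'rV[int]_n] [set: 'rV[int]_n] (+%R^~ v)).
  by apply: eq_esum => k _.
split=> // [k k' _ _ /addIr //|k _]; exists (k - v)%R => //.
by rewrite subrK.
Qed.

End translation.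

(** * The maximal function over dilated dyadic cubes *)

Section neighbours.
Context (n : nat).
Implicit Types (P Q : dindex n) (v : {ffun 'I_n -> 'I_5}).

(** Offsets range from [-2] to [2] in each coordinate.  One unit is for the
    aperture of the cones and the Carleson boxes over arbitrary cubes, the
    other for the lateral neighbours of adjacent cubes. *)
Definition offs v : 'rV[int]_n := \row_i ((v i : nat)%:Z - 2).

Definition near_cube P Q := exists v, P = nbr (offs v) Q.

Lemma near_cubeP P Q : near_cube P Q <->
  P.1 = Q.1 /\ forall i, -2 <= P.2 0 i - Q.2 0 i <= 2.
Proof.
split=> [[v ->]|].
  split=> // i.
  have -> : (nbr (offs v) Q).2 0 i - Q.2 0 i = (v i : nat)%:Z - 2.
    by rewrite /nbr /= mxE [offs _ _ _]mxE; ring.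
  by have := ltn_ord (v i); lia.
case: P Q => j k [j' k'] /= [-> H].
have lt5 i : (absz (k 0%R i - k' 0%R i + 2)%R < 5)%N by have := H i; lia.
exists [ffun i => Ordinal (lt5 i)]; congr pair.
by apply/rowP => i; rewrite !mxE ffunE /=; have := H i; lia.
Qed.

Lemma near_cube_refl P : near_cube P P.
Proof. by apply/near_cubeP; split => // i; rewrite subrr. Qed.

End neighbours.

Section neighbours_ancestors.
Context (R : realType) (n : nat) (D : dyadic_system R n).
Implicit Types (P Q : dindex n).

(** A displacement by at most [2] becomes one by at most [1] after halving,
    whatever the parities. *)
Lemma near_par P Q : near_cube P Q -> near_cube (par D P) (par D Q).
Proof.
case: P Q => j k [j' k'] /near_cubeP[/= -> H]; apply/near_cubeP; split => // i.
rewrite /= [(\row__ _) 0 i]mxE [X in _ - X]mxE /=; set o := offset _ _ _ _.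
have := H i; lia.
Qed.

Lemma near_anc k P Q : near_cube P Q -> near_cube (iter k (par D) P) (iter k (par D) Q).
Proof. by move=> PQ; elim: k => // k IH; apply: near_par. Qed.

End neighbours_ancestors.

Section maximal.
Context (R : realType) (n : nat) (D : dyadic_system R n) (hn : (0 < n)%N).
Implicit Types (P Q : dindex n) (x : 'rV[R]_n).

Local Notation par := (par D).
Local Notation avg := (avg D).
Local Notation locate := (locate D).
Local Open Scope ereal_scope.

(** The maximal function over the dyadic cubes whose dilate by [5] contains
    [x].  It dominates all the functionals that are not dyadic, because the
    cubes near [x] at a given scale are near the dyadic cube of [x] at this
    scale. *)
Definition mstar (h : 'rV[R]_n -> \bar R) x : \bar R :=
  ereal_sup [set y | exists j P, near_cube P (locate j x) /\ y = (mean D h P)%:E].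

Lemma mstar_ge h j P x : near_cube P (locate j x) -> (mean D h P)%:E <= mstar h x.
Proof. by move=> Px; apply: ereal_sup_ubound; exists j, P. Qed.

Variables (p : R) (p1 : (1 < p)%R).
Let p0 : (0 < p)%R. Proof. exact: lt_trans p1. Qed.

Section fixed_function.
Variable h : 'rV[R]_n -> \bar R.
Hypothesis mh : measurable_fun [set: 'rV[R]_n] h.
Hypothesis h0 : forall x, 0 <= h x.
Hypothesis hp : \int[leb n]_x (h x `^ p) < +oo.

Let hpow x := h x `^ p.

Let mhp : measurable_fun [set: 'rV[R]_n] hpow.
Proof. exact: (measurableT_comp (measurable_poweR _)). Qed.

Let hpow0 x : 0 <= hpow x. Proof. exact: poweR_ge0. Qed.

Lemma integral_pow_cube P :
  \int[leb n]_(x in hcube D P) hpow x <= \int[leb n]_x hpow x.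
Proof.
apply: ge0_subset_integral => //; exact: measurable_hcube.
Qed.

Lemma pow_locally_finite : locally_finite_integral D hpow.
Proof. by move=> P; apply: le_lt_trans hp; exact: integral_pow_cube. Qed.

Lemma Lp_locally_finite : locally_finite_integral D h.
Proof.
move=> P; have mP := measurable_hcube D P.
apply: (@le_lt_trans _ _ (\int[leb n]_(x in hcube D P) (1 + hpow x))).
  apply: le_integral_ge0 => x _; first exact: h0.
  rewrite /hpow; have := h0 x; case: (h x) => [r| |] //; last first.
    by rewrite poweRyr ?gt_eqF// addey.
  rewrite lee_fin poweR_EFin => r0; rewrite -EFinD lee_fin.
  have [r1|r1] := leP r 1%R; first by rewrite (le_trans r1)// lerDl powR_ge0.
  by apply: (le_trans (le1r_powR (ltW r1) (ltW p1))); rewrite lerDr.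
rewrite ge0_integralD//; last exact: measurable_funS mhp.
rewrite integral_cst// mul1e lte_add_pinfty ?pow_locally_finite//.
by rewrite [X in X < _](leb_hcube D P) ltry.
Qed.

Let hfin := Lp_locally_finite.

Local Notation w := (mean D h).

(** Jensen's inequality, by integrating the tangent line inequality of
    [young] at the mean. *)
Lemma mean_pow P : (w P `^ p <= mean D hpow P)%R.
Proof.
have mP := measurable_hcube D P.
set a := w P; have a0 : (0 <= a)%R by exact: mean_ge0.
have pa0 : (0 <= p * a `^ (p - 1))%R by rewrite mulr_ge0 ?powR_ge0// ltW.
have pap : (0 <= (p - 1) * a `^ p)%R.
  by rewrite mulr_ge0 ?powR_ge0// subr_ge0 ltW.
have : \int[leb n]_(x in hcube D P) ((p * a `^ (p - 1))%:E * h x) <=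
    \int[leb n]_(x in hcube D P) (((p - 1) * a `^ p)%:E + hpow x).
  apply: le_integral_ge0 => x _; first by rewrite mule_ge0// lee_fin.
  rewrite /hpow; have := h0 x; case: (h x) => [r| |] //.
    by rewrite poweR_EFin !lee_fin => r0; exact: young.
  by move=> _; rewrite poweRyr ?gt_eqF// addey// leey.
rewrite ge0_integralZl//; last exact: measurable_funS mh.
rewrite (integral_mean h0 hfin) -/a ge0_integralD//; last exact: measurable_funS mhp.
rewrite integral_cst// [X in _ * X + _](leb_hcube D P).
rewrite (integral_mean hpow0 pow_locally_finite) -!EFinM -EFinD lee_fin.
have -> : (p * a `^ (p - 1) * (dvol R P * a) = dvol R P * (p * a `^ p))%R.
  by rewrite -(mulr_powRB1 a0 p0); ring.
rewrite [X in (X + _)%R]mulrC -mulrDr ler_pM2l ?dvol_gt0//; lra.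
Qed.

Let w0 Q : (0 <= w Q)%R. Proof. exact: mean_ge0. Qed.
Let avg_w Q : avg w Q = w Q. Proof. exact: avg_mean. Qed.

Section tower.
Variables (P0 : dindex n) (K : nat).

Let inc j Q : R :=
  if `[< iter j par Q = P0 >] then increment D p w j Q else 0%R.

Let inc0 j Q : (0 <= inc j Q)%R.
Proof. by rewrite /inc; case: ifP => // _; exact: increment_ge0. Qed.

(** A function whose integral is controlled by the inequality of Doob and
    which dominates [w P ^ p] at each point of the dilate of a cube [P] in
    the first [K] generations below [P0]: the increments of the running
    maximum, restricted to descendants of [P0], are summed over all
    neighbours.  Each increment is a step function of a single generation, so
    that the translation to a neighbour preserves its integral. *)
Definition tower x : R :=
  (\sum_(j < K.+1) \sum_v inc j (nbr (offs v) (locate (P0.1 + j%:Z) x)))%R.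

Lemma measurable_tower : measurable_fun [set: 'rV[R]_n] (EFin \o tower).
Proof.
apply/measurable_EFinP; apply: measurable_sum => j; apply: measurable_sum => v.
exact: (measurable_fun_locate D _ (inc j \o nbr (offs v))).
Qed.

Lemma tower_ge0 x : (0 <= tower x)%R.
Proof. by apply: sumr_ge0 => j _; apply: sumr_ge0 => v _; exact: inc0. Qed.

Lemma integral_tower : \int[leb n]_x (tower x)%:E <=
  (5 ^+ n * (2 `^ p / (p - 1)))%:E * \int[leb n]_x hpow x.
Proof.
have E j : \int[leb n]_x (inc j (locate (P0.1 + j%:Z) x))%:E =
    (dvol R P0 * iter j avg (increment D p w j) P0)%:E.
  rewrite -integral_hcube_locate; last exact: increment_ge0.
  rewrite [RHS]integral_mkcond; apply: eq_integral => x _.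
  rewrite patchE /inc anc_locate addrK /hcube.
  case: asboolP => [H|H]; first by rewrite mem_set.
  by rewrite memNset.
have -> : \int[leb n]_x (tower x)%:E =
    \sum_(j < K.+1) (5 ^+ n * (dvol R P0 * iter j avg (increment D p w j) P0))%:E.
  under eq_integral do rewrite /tower -sumEFin.
  rewrite ge0_integral_sum//; last 2 first.
  - move=> j; apply/measurable_EFinP; apply: measurable_sum => v.
    exact: (measurable_fun_locate D _ (inc j \o nbr (offs v))).
  - by move=> j x _; rewrite lee_fin sumr_ge0.
  apply: eq_bigr => j _.
  under eq_integral do rewrite -sumEFin.
  rewrite ge0_integral_sum//; last 2 first.
  - move=> v; apply/measurable_EFinP.
    exact: (measurable_fun_locate D _ (inc j \o nbr (offs v))).
  - by move=> v x _; rewrite lee_fin.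
  under eq_bigr do rewrite integral_nbr// E.
  rewrite sumEFin; congr EFin.
  by rewrite sumr_const card_ffun !card_ord -[LHS]mulr_natl natrX.
rewrite sumEFin -!mulr_sumr sum_avg_increment.
have H : (dvol R P0 * iter K avg (fun Q => runmax D w K Q `^ p) P0 <=
    2 `^ p / (p - 1) * (dvol R P0 * mean D hpow P0))%R.
  rewrite mulrCA ler_pM2l ?dvol_gt0//.
  apply: (le_trans (doob p1 w0 avg_w _ _)).
  rewrite ler_pM2l ?divr_gt0 ?powR_gt0 ?subr_gt0//.
  rewrite -(iter_avg_martingale (D := D) K (h := mean D hpow)); last first.
    by move=> Q; apply: avg_mean => //; exact: pow_locally_finite.
  by apply: le_iter_avg => Q _; exact: mean_pow.
apply: (@le_trans _ _ ((5 ^+ n * (2 `^ p / (p - 1) * (dvol R P0 * mean D hpow P0)))%:E)).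
  by rewrite lee_fin ler_pM2l ?exprn_gt0.
rewrite mulrA EFinM lee_wpmul2l//.
  by rewrite lee_fin mulr_ge0 ?exprn_ge0// divr_ge0 ?powR_ge0// subr_ge0 ltW.
rewrite -(integral_mean hpow0 pow_locally_finite).
exact: integral_pow_cube.
Qed.

(** Neighbours of cubes have neighbouring ancestors ([near_anc]); hence the
    increments along the ancestors of [P], which add up to a power of the
    running maximum at [P], all occur in the sum over the neighbours of the
    cubes around [x]. *)
Lemma tower_ge k x P : (k <= K)%N -> iter k par P = P0 ->
  near_cube P (locate (P0.1 + k%:Z) x) -> (w P `^ p <= tower x)%R.
Proof.
move=> kK PP0 Px.
apply: (@le_trans _ _ (runmax D w k P `^ p)%R).
  rewrite ge0_ler_powR ?nnegrE ?(ltW p0)//; last exact: runmax_ge.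
  exact: runmax_ge0.
rewrite sum_increment /tower -(subnKC kK) -addSn big_split_ord/=.
rewrite -[leLHS]addr0 lerD//; last first.
  by apply: sumr_ge0 => j _; apply: sumr_ge0 => v _; exact: inc0.
apply: ler_sum => j _; have jk : (j <= k)%N by rewrite -ltnS.
have [v E] := near_anc D (k - j) Px.
rewrite (bigD1 v)//= -[leLHS]addr0 lerD//; last first.
  by apply: sumr_ge0 => v' _; exact: inc0.
have -> : locate (P0.1 + j%:Z) x = iter (k - j) par (locate (P0.1 + k%:Z) x).
  by rewrite anc_locate; congr (locate _ _); lia.
rewrite -E /inc -iterD subnKC// PP0 asboolT//.
Qed.

End tower.

(** The towers of depth [2 * k] under the [k]-th ancestor of a fixed cube
    eventually see every cube, by connectedness of the tree, and Fatou's
    lemma passes to the limit. *)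
Lemma integral_mstar : \int[leb n]_x (mstar h x `^ p) <=
  (5 ^+ n * (2 `^ p / (p - 1)))%:E * \int[leb n]_x hpow x.
Proof.
pose Q0 : dindex n := (0%R, 0%R).
pose G k x := (tower (iter k par Q0) (2 * k) x)%:E.
have G0 k x : 0 <= G k x by rewrite lee_fin tower_ge0.
have mstar0 x : 0 <= mstar h x.
  have := mstar_ge h (near_cube_refl (locate 0%R x)).
  by apply: le_trans; rewrite lee_fin w0.
apply: (@le_trans _ _ (\int[leb n]_x limn_einf (G^~ x))).
  apply: le_integral_ge0 => x _; first exact: poweR_ge0.
  have L0 : 0 <= limn_einf (G^~ x) by apply: limn_einf_ge; exact: nearW.
  apply: (@le_trans _ _ ((limn_einf (G^~ x) `^ p^-1) `^ p)); last first.
    by rewrite -poweRrM mulVf ?gt_eqF// poweRe1.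
  apply: le_poweR => //; first exact: ltW.
  apply: ge_ereal_sup => _ [j [P [Px ->]]].
  have : (w P `^ p)%:E <= limn_einf (G^~ x).
    apply: limn_einf_ge.
    have [k [l E]] := anc_common D hn P Q0.
    (* [P] is a descendant of the [m]-th ancestor of [Q0] as soon as [m >=
       l], at depth [j + m <= 2 * m] when [m >= |j|] *)
    exists (l + `|j|)%N => // m /= lm; rewrite /G lee_fin.
    have mE : ((k + (m - l))%N%:Z = j + m%:Z)%R.
      have := gen_anc D k P; rewrite E gen_anc /=.
      case/near_cubeP : Px => -> _ /=; lia.
    have PP : iter (k + (m - l)) par P = iter m par Q0.
      by rewrite addnC iterD E -iterD subnK//; lia.
    apply: (@tower_ge _ _ (k + (m - l))%N); [lia|exact: PP|].
    by rewrite gen_anc mE /= sub0r [(_ + m%:Z)%R]addrC addKr.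
  move=> /(le_poweR (a := _)) H.
  have := H p^-1%R; rewrite invr_ge0 (ltW p0) lee_fin powR_ge0 => /(_ isT isT).
  by rewrite poweR_EFin -powRrM divff ?gt_eqF// powRr1.
apply: (@le_trans _ _ (limn_einf (fun k => \int[leb n]_x G k x))).
  apply: fatou => //.
  by move=> k; exact: measurable_tower.
by apply: limn_einf_le => k; exact: integral_tower.
Qed.

End fixed_function.

Definition maximal_constant : R := ((5 ^+ n * (2 `^ p / (p - 1))) `^ p^-1)%R.

Lemma maximal_constant_gt0 : (0 < maximal_constant)%R.
Proof.
rewrite powR_gt0// mulr_gt0 ?exprn_gt0// divr_gt0 ?powR_gt0// subr_gt0//.
Qed.

Lemma maximal_Lp (h Z : 'rV[R]_n -> \bar R) :
  measurable_fun [set: 'rV[R]_n] h -> (forall x, 0 <= h x) ->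
  \int[leb n]_x (h x `^ p) < +oo ->
  (forall x, 0 <= Z x) -> (forall x, Z x <= mstar h x) ->
  Lp_norm p Z <= maximal_constant%:E * Lp_norm p h.
Proof.
move=> mh h0 hp Z0 Zh; apply: Lnorm_le => //.
  by rewrite ltW// maximal_constant_gt0.
have -> : \int[leb n]_x (`|h x| `^ p) = \int[leb n]_x (h x `^ p).
  by apply: eq_integral => x _; rewrite gee0_abs.
rewrite /maximal_constant -powRrM mulVf ?gt_eqF// powRr1; last first.
  by rewrite mulr_ge0 ?exprn_ge0// divr_ge0 ?powR_ge0// subr_ge0 ltW.
apply: le_trans (integral_mstar mh h0 hp).
apply: le_integral_ge0 => x _; first exact: poweR_ge0.
by rewrite gee0_abs//; apply: le_poweR => //; exact: ltW.
Qed.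

End maximal.

(** * Images of measures with density, and integration by lines *)

Section weighted_image.
Local Open Scope ereal_scope.
Context d d' (T : measurableType d) (U : measurableType d') (R : realType).
Variables (mu : {measure set T -> \bar R}) (w : T -> R) (f : T -> U).
Hypothesis mw : measurable_fun [set: T] w.
Hypothesis w0 : forall x, (0 <= w x)%R.
Hypothesis mf : measurable_fun [set: T] f.

(** The image under [f] of the measure with density [w].  The measurability
    and positivity proofs are arguments so that the measure structure can be
    attached to the set function. *)
Definition wimage (_ : measurable_fun [set: T] w) (_ : forall x, (0 <= w x)%R)
  (_ : measurable_fun [set: T] f) (A : set U) : \bar R :=
  \int[mu]_(x in f @^-1` A) (w x)%:E.

Local Notation nu := (wimage mw w0 mf).

Let mpre A : measurable A -> measurable (f @^-1` A).
Proof. by move=> mA; rewrite -[X in measurable X]setTI; exact: mf. Qed.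

Let nu0 : nu set0 = 0. Proof. by rewrite /wimage preimage_set0 integral_set0. Qed.

Let nu_ge0 A : 0 <= nu A. Proof. by apply: integral_ge0 => x _; rewrite lee_fin. Qed.

Let nu_sigma_additive : semi_sigma_additive nu.
Proof.
move=> F mF tF mUF; rewrite /wimage preimage_bigcup.
apply: semi_sigma_additive_nng_induced.
- exact/measurable_EFinP.
- by move=> x; rewrite lee_fin.
- by move=> i; exact: mpre.
- apply/trivIsetP => /= i j _ _ ij; rewrite -preimage_setI.
  by move/trivIsetP : tF => /(_ _ _ _ _ ij) ->//; rewrite preimage_set0.
- by rewrite -preimage_bigcup; exact: mpre.
Qed.

HB.instance Definition _ :=
  isMeasure.Build _ _ _ nu nu0 nu_ge0 nu_sigma_additive.

Import HBNNSimple.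

(** The change of variables is the definition for indicators, and extends by
    linearity and monotone convergence. *)
Lemma ge0_integral_wimage (g : U -> \bar R) : measurable_fun [set: U] g ->
  (forall y, 0 <= g y) ->
  \int[nu]_y g y = \int[mu]_x (g (f x) * (w x)%:E).
Proof.
move=> mg g0; pose h := nnsfun_approx measurableT mg.
have hlim y : (h k y)%:E @[k --> \oo] --> g y.
  by apply: (@cvg_nnsfun_approx _ _ _ _ measurableT _ mg) => // z _; exact: g0.
have mhf k : measurable_fun [set: T] (fun x => (h k (f x))%:E).
  by apply/measurable_EFinP; apply: measurableT_comp.
have -> : \int[nu]_y g y = limn (fun k => \int[nu]_y (h k y)%:E).
  rewrite -monotone_convergence//.
  - by apply: eq_integral => y _; apply/esym/cvg_lim => //; exact: hlim.
  - by move=> k; exact/measurable_EFinP.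
  - by move=> k y _; rewrite lee_fin.
  - by move=> y _ a b ab; rewrite lee_fin; exact/lefP/nd_nnsfun_approx.
have -> : \int[mu]_x (g (f x) * (w x)%:E) =
    limn (fun k => \int[mu]_x ((h k (f x))%:E * (w x)%:E)).
  rewrite -monotone_convergence//.
  - apply: eq_integral => x _; apply/esym/cvg_lim => //.
    by apply: cvgeZr => //; exact: hlim.
  - by move=> k; apply: emeasurable_funM => //; exact/measurable_EFinP.
  - by move=> k x _; rewrite mule_ge0// lee_fin.
  - move=> x _ a b ab; rewrite lee_wpmul2r ?lee_fin//.
    exact/lefP/nd_nnsfun_approx.
congr (limn _); apply/funext => k.
rewrite integralT_nnsfun sintegralE.
transitivity (\int[mu]_x \sum_(r \in range (h k))
    ((r * \1_(f @^-1` (h k @^-1` [set r])) x)%:E * (w x)%:E)); last first.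
  apply: eq_integral => x _.
  rewrite -ge0_mule_fsuml; last first.
    by move=> r; exact: (nnfun_muleindic_ge0 (h k) r (f x)).
  by congr (_ * _); rewrite fsumEFin// [in RHS](fimfunE (h k) (f x)).
rewrite ge0_integral_fsum//; last 2 first.
- move=> r; apply: emeasurable_funM; apply/measurable_EFinP => //.
  apply: measurable_funM => //; apply: measurable_indic.
  exact: mpre.
- move=> r x _; apply: mule_ge0; last by rewrite lee_fin.
  exact: (nnfun_muleindic_ge0 (h k) r (f x)).
apply: eq_fsbigr => r /[!inE] -[y _ <-].
rewrite /nu/= /wimage; set E := f @^-1` _.
have mE : measurable E by exact: mpre.
under [RHS]eq_integral do rewrite EFinM -muleA.
rewrite ge0_integralZl//; last 3 first.
- by apply: emeasurable_funM; apply/measurable_EFinP.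
- by move=> x _; rewrite mule_ge0// lee_fin.
- by rewrite lee_fin.
congr (_ * _).
rewrite integral_mkcond; apply: eq_integral => x _.
by rewrite patchE indicE; case: ifPn => xE; rewrite ?mul1e ?mul0e.
Qed.

Lemma integral_wimage (g : U -> R) : measurable_fun [set: U] g ->
  \int[nu]_y (g y)%:E = \int[mu]_x (g (f x) * w x)%:E.
Proof.
move=> mg; rewrite [LHS]integralE [RHS]integralE; congr (_ - _).
- rewrite ge0_integral_wimage//; last exact/measurable_funepos/measurable_EFinP.
  apply: eq_integral => x _; rewrite !funeposE -[0]/(0%:E) -!EFin_max -EFinM.
  by rewrite maxr_pMl// mul0r.
- rewrite ge0_integral_wimage//; last exact/measurable_funeneg/measurable_EFinP.
  apply: eq_integral => x _; rewrite !funenegE -[0]/(0%:E) -!EFinN -!EFin_max -EFinM.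
  by rewrite maxr_pMl// mul0r mulNr.
Qed.

End weighted_image.

Section fubini_coordinate.
Local Open Scope ereal_scope.
Context (R : realType).

Definition ins n (i : 'I_n.+1) (r : R) (v : 'rV[R]_n) : 'rV[R]_n.+1 :=
  (\row_k if unlift i k is Some k' then v ord0 k' else r)%R.

Lemma measurable_ins n (i : 'I_n.+1) :
  measurable_fun [set: R1n R n] (fun z : R1n R n => ins i z.1 z.2).
Proof.
apply: measurable_fun_rV => k; under eq_fun do rewrite mxE.
case: unliftP => [j _|_]; last exact: measurable_fst.
by apply: (measurableT_comp (measurable_coord j)); exact: measurable_snd.
Qed.

Lemma integral_lebS n (h : 'rV[R]_n.+1 -> \bar R) :
  measurable_fun [set: 'rV[R]_n.+1] h -> (forall x, 0 <= h x) ->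
  \int[leb n.+1]_x h x =
  \int[(@lebesgue_measure R \x leb n)]_z h (rVcons z).
Proof.
move=> mh h0.
rewrite -[RHS](@ge0_integral_pushforward _ _ _ _ R _ (@measurable_rVcons R n)
   (@lebesgue_measure R \x leb n) setT h)//.
Qed.

Let measurable_rVcons_comp n (h : 'rV[R]_n.+1 -> \bar R) :
  measurable_fun [set: 'rV[R]_n.+1] h ->
  measurable_fun [set: R1n R n] (fun z => h (rVcons z)).
Proof.
by move=> mh; apply: (measurableT_comp mh); exact: measurable_rVcons.
Qed.

Let tonelli1 n (h : 'rV[R]_n.+1 -> \bar R) :
  measurable_fun [set: 'rV[R]_n.+1] h -> (forall x, 0 <= h x) ->
  \int[leb n.+1]_x h x =
  \int[lebesgue_measure]_r \int[leb n]_v h (rVcons (r, v)).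
Proof.
move=> mh h0; rewrite integral_lebS//.
exact: (@fubini_tonelli1 _ _ _ _ R (@lebesgue_measure R) (leb n)
  (fun z => h (rVcons z)) (measurable_rVcons_comp mh) (fun z => h0 _)).
Qed.

Let tonelli2 n (h : 'rV[R]_n.+1 -> \bar R) :
  measurable_fun [set: 'rV[R]_n.+1] h -> (forall x, 0 <= h x) ->
  \int[leb n.+1]_x h x =
  \int[leb n]_v \int[lebesgue_measure]_r h (rVcons (r, v)).
Proof.
move=> mh h0; rewrite integral_lebS//.
exact: (@fubini_tonelli2 _ _ _ _ R (@lebesgue_measure R) (leb n)
  (fun z => h (rVcons z)) (measurable_rVcons_comp mh) (fun z => h0 _)).
Qed.

(** Lebesgue measure is defined by splitting off the first coordinate; any
    other coordinate is reached by induction, exchanging it with the first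
    one by Tonelli. *)
Lemma ge0_fubini_ins n (i : 'I_n.+1) (h : 'rV[R]_n.+1 -> \bar R) :
  measurable_fun [set: 'rV[R]_n.+1] h -> (forall x, 0 <= h x) ->
  \int[leb n.+1]_x h x =
  \int[leb n]_v \int[lebesgue_measure]_r h (ins i r v).
Proof.
have base n' (h' : 'rV[R]_n'.+1 -> \bar R) :
    measurable_fun [set: 'rV[R]_n'.+1] h' -> (forall x, 0 <= h' x) ->
    \int[leb n'.+1]_x h' x =
    \int[leb n']_v \int[lebesgue_measure]_r h' (ins ord0 r v).
  by move=> mh' h'0; rewrite tonelli2.
elim: n i h => [|n IH] i h mh h0; first by rewrite (ord1 i); exact: base.
have [j ->|->] := unliftP ord0 i; last exact: base.
rewrite tonelli1//.
transitivity (\int[lebesgue_measure]_s \int[leb n]_v \int[lebesgue_measure]_r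
    h (rVcons (s, ins j r v))).
  apply: eq_integral => s _; apply: (IH j (fun w => h (rVcons (s, w)))) => //.
  apply: (measurableT_comp (measurable_rVcons_comp mh)).
  exact: measurable_pair1.
pose F (v : 'rV[R]_n.+1) : \bar R :=
  \int[lebesgue_measure]_r h (ins (lift ord0 j) r v).
have F0 v : 0 <= F v by exact: integral_ge0.
have mF : measurable_fun [set: 'rV[R]_n.+1] F.
  apply: (@measurable_fun_fubini_tonelli_G _ _ _ _ _ (@lebesgue_measure R)
    (fun z : R1n R n.+1 => h (ins (lift ord0 j) z.1 z.2))) => //.
  by apply: measurableT_comp => //; exact: measurable_ins.
rewrite [RHS](tonelli1 mF F0).
apply: eq_integral => s _; apply: eq_integral => v _; apply: eq_integral => r _.
congr h; apply/rowP => k; rewrite /rVcons !mxE /=.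
have [k' ->|->] := unliftP ord0 k; last first.
  have E0 : lift (lift ord0 j) ord0 = ord0 by exact: val_inj.
  by rewrite -[X in unlift _ X]E0 liftK mxE unlift_none.
rewrite mxE; have [k2 E|E] := unliftP j k'; last by rewrite E unlift_none.
have -> : lift ord0 k' = lift (lift ord0 j) (lift ord0 k2).
  by apply: val_inj; rewrite E /= /bump !leq0n !add1n ltnS; case: leq.
by rewrite liftK mxE liftK.
Qed.

(** The positive and negative parts have the same integral over each line in
    the direction [i], hence the same total integral by Tonelli;
    integrability makes the difference meaningful. *)
Lemma fubini_cancel_coord n (i : 'I_n.+1) (H : R1n R n.+1 -> R) :
  measurable_fun [set: R1n R n.+1] H ->
  (leb1 n.+1).-integrable setT (EFin \o H) ->
  (forall t v, lebesgue_measure.-integrable setT (fun r => (H (t, ins i r v))%:E) /\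
    \int[lebesgue_measure]_r (H (t, ins i r v))%:E = 0) ->
  \int[leb1 n.+1]_z (H z)%:E = 0.
Proof.
move=> mH iH H0; rewrite integralE.
have mP : measurable_fun [set: R1n R n.+1] (EFin \o H)^\+.
  exact/measurable_funepos/measurable_EFinP.
have mN : measurable_fun [set: R1n R n.+1] (EFin \o H)^\-.
  exact/measurable_funeneg/measurable_EFinP.
have T g : measurable_fun [set: R1n R n.+1] g -> (forall z, 0 <= g z) ->
   \int[leb1 n.+1]_z g z = \int[lebesgue_measure]_t \int[leb n]_v
      \int[lebesgue_measure]_r g (t, ins i r v).
  move=> mg g0; rewrite /leb1.
  transitivity (\int[lebesgue_measure]_t \int[leb n.+1]_x g (t, x)).
    exact: (@fubini_tonelli1 _ _ _ _ R (@lebesgue_measure R) (leb n.+1) g mg g0).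
  apply: eq_integral => t _; apply: (@ge0_fubini_ins n i (fun x => g (t, x))) => //.
  by apply: (measurableT_comp mg); exact: measurable_pair1.
have -> : \int[leb1 n.+1]_z (EFin \o H)^\+ z = \int[leb1 n.+1]_z (EFin \o H)^\- z.
  rewrite (T _ mP (funepos_ge0 _)) [RHS](T _ mN (funeneg_ge0 _)).
  apply: eq_integral => t _; apply: eq_integral => v _.
  have [H1 H2] := H0 t v.
  pose Hr (r : measurableTypeR R) : \bar R := (H (t, ins i r v))%:E.
  rewrite (eq_integral Hr^\+); last by move=> r _; rewrite !funeposE.
  rewrite [RHS](eq_integral Hr^\-); last by move=> r _; rewrite !funenegE.
  move: H2; rewrite -[X in integral _ _ X = _]/Hr [LHS]integralE.
  move=> /(congr1 (fun a => a + \int[lebesgue_measure]_r Hr^\- r)).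
  rewrite subeK ?add0e//; exact: integrable_neg_fin_num.
rewrite subee//; exact: integrable_neg_fin_num.
Qed.

End fubini_coordinate.

Section fubini_time.
Local Open Scope ereal_scope.
Context (R : realType).

Lemma fubini_cancel_time n (H : R1n R n -> R) :
  measurable_fun [set: R1n R n] H ->
  (leb1 n).-integrable setT (EFin \o H) ->
  (forall x, lebesgue_measure.-integrable setT (fun r => (H (r, x))%:E) /\
    \int[lebesgue_measure]_r (H (r, x))%:E = 0) ->
  \int[leb1 n]_z (H z)%:E = 0.
Proof.
move=> mH iH H0; rewrite integralE.
have mP : measurable_fun [set: R1n R n] (EFin \o H)^\+.
  exact/measurable_funepos/measurable_EFinP.
have mN : measurable_fun [set: R1n R n] (EFin \o H)^\-.
  exact/measurable_funeneg/measurable_EFinP.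
have T g : measurable_fun [set: R1n R n] g -> (forall z, 0 <= g z) ->
   \int[leb1 n]_z g z = \int[leb n]_x \int[lebesgue_measure]_r g (r, x).
  move=> mg g0; rewrite /leb1.
  exact: (@fubini_tonelli2 _ _ _ _ R (@lebesgue_measure R) (leb n) g mg g0).
have -> : \int[leb1 n]_z (EFin \o H)^\+ z = \int[leb1 n]_z (EFin \o H)^\- z.
  rewrite (T _ mP (funepos_ge0 _)) [RHS](T _ mN (funeneg_ge0 _)).
  apply: eq_integral => x _.
  have [H1 H2] := H0 x.
  pose Hr (r : measurableTypeR R) : \bar R := (H (r, x))%:E.
  rewrite (eq_integral Hr^\+); last by move=> r _; rewrite !funeposE.
  rewrite [RHS](eq_integral Hr^\-); last by move=> r _; rewrite !funenegE.
  move: H2; rewrite -[X in integral _ _ X = _]/Hr [LHS]integralE.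
  move=> /(congr1 (fun a => a + \int[lebesgue_measure]_r Hr^\- r)).
  rewrite subeK ?add0e//; exact: integrable_neg_fin_num.
rewrite subee//; exact: integrable_neg_fin_num.
Qed.

End fubini_time.

(** * Integration by parts along a line *)

Section telescoping_integral.
Context (R : realType).
Local Notation mu := (@lebesgue_measure R).
Implicit Types (H psi : R -> R).

(** The fundamental theorem of calculus for [al * psi r + c * r]; the end
    points of the cell, where nothing is known of [H], are negligible. *)
Lemma integral_affine_derivative H psi (al c a b : R) : a < b ->
  measurable_fun setT H ->
  (forall r, derivable psi r 1) -> continuous (derive1 psi) ->
  (forall r, a < r < b -> H r = al * derive1 psi r + c) ->
  mu.-integrable `]a, b] (EFin \o H) /\
  (\int[mu]_(r in `]a, b]) (H r)%:E =
    (al * (psi b - psi a) + c * (b - a))%:E)%E.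
Proof.
move=> ab mH dpsi cpsi Hab.
pose g r := al * derive1 psi r + c; pose G r := al * psi r + c * r.
have cg : continuous g.
  by move=> r; apply: cvgD; [apply: cvgM; [exact: cvg_cst|exact: cpsi]|exact: cvg_cst].
have dG (r : R) : is_derive r 1 G (g r).
  rewrite /G /g derive1E.
  have h1 : is_derive r 1 psi ('D_1 psi r) by apply: derivableP; exact: dpsi.
  have h2 : is_derive r (1 : R) (fun s : R => al * psi s + c * s) (al *: 'D_1 psi r + c *: 1).
    exact: is_deriveD.
  by apply: is_derive_eq; rewrite /GRing.scale /= mulr1.
have cG : continuous G.
  by move=> r; apply: differentiable_continuous; apply/derivable1_diffP; exact: ex_derive.
have mg : measurable_fun setT g by exact: continuous_measurable_fun.
have E : (\int[mu]_(r in `[a, b]) (g r)%:E = (G b)%:E - (G a)%:E)%E.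
  apply: continuous_FTC2 => //.
  - exact: continuous_subspaceT.
  - split; first by move=> r _; exact: ex_derive.
      exact/cvg_at_right_filter/cG.
    exact/cvg_at_left_filter/cG.
  - by move=> r _; rewrite derive1E; apply: derive_val.
have ig : mu.-integrable `[a, b] (EFin \o g).
  apply: continuous_compact_integrable; first exact: segment_compact.
  exact: continuous_subspaceT.
have HG : {in `]a, b[%classic, (EFin \o H) =1 (EFin \o g)}.
  by move=> r; rewrite inE/= in_itv/= => ab'; rewrite /= Hab.
have io : mu.-integrable `]a, b[ (EFin \o H).
  have mI : measurable (`]a, b[%classic : set R) by exact: measurable_itv.
  apply: (@eq_integrable _ _ _ mu _ mI (EFin \o g)).
    by move=> r rab; rewrite HG.
  by apply: integrableS ig => //; exact: subset_itv_oo_cc.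
have mE (I : set R) : measurable_fun I (EFin \o H).
  by apply/measurable_EFinP; exact: measurable_funTS.
have IE : (\int[mu]_(r in `]a, b]) (H r)%:E = \int[mu]_(r in `]a, b[) (H r)%:E)%E.
  by rewrite -integral_itv_bndo_bndc.
split.
  apply/integrableP; split; first exact: mE.
  rewrite -(@integral_itv_bndo_bndc _ _ _ (fun r => `|(EFin \o H) r|%E)).
    by case/integrableP : io.
  by apply: measurableT_comp => //; exact: mE.
rewrite IE; transitivity (\int[mu]_(r in `]a, b[) (g r)%:E)%E.
  by apply: eq_integral => r rab; exact: HG.
rewrite integral_itv_bndo_bndc; last exact/measurable_EFinP/measurable_funTS.
rewrite integral_itv_obnd_cbnd; last exact/measurable_EFinP/measurable_funTS.
by rewrite E -EFinB /G; congr EFin; ring.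
Qed.

(** The integrals over consecutive cells telescope, and the boundary terms [b
    0] and [b N] agree (they vanish in the application, where [H] has compact
    support). *)
Lemma integral_telescope H (q : nat -> R) (b : nat -> R) (N : nat) :
  (forall j, q j < q j.+1) -> measurable_fun setT H ->
  (forall j, (j < N)%N -> mu.-integrable `]q j, q j.+1] (EFin \o H) /\
    (\int[mu]_(r in `]q j, q j.+1]) (H r)%:E = (b j.+1 - b j)%:E)%E) ->
  b 0%N = b N -> (forall r, H r != 0 -> q 0%N < r <= q N) ->
  mu.-integrable setT (EFin \o H) /\ (\int[mu]_r (H r)%:E = 0)%E.
Proof.
move=> q1 mH HI b0N supp.
have qle j : q 0%N <= q j.
  by elim: j => // j IH; rewrite (le_trans IH)// ltW.
have mE (I : set R) : measurable_fun I (EFin \o H).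
  by apply/measurable_EFinP; exact: measurable_funTS.
have key M : (M <= N)%N -> mu.-integrable `]q 0%N, q M] (EFin \o H) /\
    (\int[mu]_(r in `]q 0%N, q M]) (H r)%:E = (b M - b 0%N)%:E)%E.
  elim: M => [_|M IH MN].
    by rewrite set_itvoc0 integral_set0 subrr; split => //; exact: integrable_set0.
  have [iM EM] := IH (ltnW MN); have [iS ES] := HI M MN.
  have U : `]q 0%N, q M.+1]%classic = `]q 0%N, q M]%classic `|` `]q M, q M.+1]%classic.
    apply/seteqP; split => r /=; rewrite !in_itv/=.
      move=> /andP[r0 r1]; have [rM|rM] := leP r (q M); [left|right];
        by rewrite ?r0 ?r1.
    move=> [/andP[-> rM]|/andP[rM ->]]; rewrite ?andbT.
      by rewrite (le_trans rM)// ltW.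
    by rewrite (le_lt_trans (qle M)).
  have dis : [disjoint `]q 0%N, q M]%classic & `]q M, q M.+1]%classic].
    apply/disj_setPS => r [] /=; rewrite !in_itv/= => /andP[_ h1] /andP[h2 _].
    by move: (le_lt_trans h1 h2); rewrite ltxx.
  rewrite U; split.
    apply/integrableP; split; first exact: mE.
    rewrite ge0_integral_setU//; last by apply: measurableT_comp => //; exact: mE.
    by rewrite lte_add_pinfty//; [case/integrableP : iM|case/integrableP : iS].
  rewrite integral_setU//=; last exact: mE.
  by rewrite EM ES -EFinD; congr EFin; lra.
have [iN EN] := key N (leqnn N).
have HE : (EFin \o H) = (EFin \o H) \_ `]q 0%N, q N].
  apply/funext => r; rewrite patchE; case: ifPn => //.
  rewrite notin_setE/= in_itv/= => nr; rewrite /=; congr EFin; apply/eqP.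
  by apply: contrapT => /negP /supp.
split; first by rewrite HE; apply/(integrable_mkcond _ _).1.
by rewrite -[LHS]/(integral mu setT (EFin \o H)) HE -integral_mkcond EN b0N subrr.
Qed.

End telescoping_integral.

Section derivative_along_line.
Context (R : realType) (V : normedModType R) (phi : V -> R) (v a : V).

Lemma derivable_line r : derivable phi (a + r *: v) v ->
  derivable (fun s : R => phi (a + s *: v)) r 1.
Proof.
rewrite /derivable; set f := (X in cvg (X @ _)) => cf.
set g := (X in cvg (X @ _)); have -> // : g = f.
apply/funext => h; rewrite /f /g /=.
by rewrite [h *: 1]mulr1 scalerDl addrCA.
Qed.

Lemma derive1_line r :
  derive1 (fun s : R => phi (a + s *: v)) r = 'D_v phi (a + r *: v).
Proof.
rewrite derive1E /derive; set g := (X in lim (X @ _)).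
set f := (X in _ = lim (X @ _)); have -> // : g = f.
apply/funext => h; rewrite /f /g /=.
by rewrite [h *: 1]mulr1 scalerDl addrCA.
Qed.

Lemma continuous_line : continuous (fun s : R => a + s *: v).
Proof.
move=> r; apply: cvgD; first exact: cvg_cst.
by apply: cvgZr_tmp; exact: cvg_id.
Qed.

End derivative_along_line.

(** * Borel sets of the half-space *)

Section borel.
Context (R : realType) (n : nat).

Let cell (k : nat) (z : R1n R n) : int * 'rV[int]_n :=
  (Num.floor (z.1 * 2 ^+ k), \row_i Num.floor (z.2 0 i * 2 ^+ k)).

Let measurable_floor_fiber d (T : measurableType d) (g : T -> R) (m : int) :
  measurable_fun [set: T] g -> measurable [set x | Num.floor (g x) = m].
Proof.
move=> mg; have -> : [set x | Num.floor (g x) = m] =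
    g @^-1` `[m%:~R, (m%:~R + 1)[%classic.
  apply/seteqP; split => x /=; rewrite in_itv/=.
    by move=> <-; exact: floor_bounds.
  by rewrite -floor_itv => /eqP.
by rewrite -[X in measurable X]setTI; apply: mg => //; exact: measurable_itv.
Qed.

Let measurable_cell k c : measurable (cell k @^-1` [set c]).
Proof.
have -> : cell k @^-1` [set c] =
   [set z : R1n R n | Num.floor (z.1 * 2 ^+ k) = c.1] `&`
   \big[setI/setT]_(i <- enum 'I_n)
     [set z : R1n R n | Num.floor (z.2 0 i * 2 ^+ k) = c.2 0 i].
  rewrite -bigcap_seq; apply/seteqP; split => [z <-|z [h1 h2]] /=.
    by split => // i _; rewrite /= mxE.
  rewrite /cell [RHS]surjective_pairing -h1; congr pair; apply/rowP => i.
  by rewrite mxE; apply: h2 => /=; rewrite mem_enum.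
apply: measurableI.
  apply: measurable_floor_fiber; apply: measurable_funM => //.
apply: bigsetI_measurable => i _.
apply: measurable_floor_fiber; apply: measurable_funM => //.
by apply: (measurableT_comp (measurable_coord i)); exact: measurable_snd.
Qed.

Let floor_dist (x y c : R) : 0 < c -> Num.floor (x * c) = Num.floor (y * c) ->
  `|x - y| < c^-1.
Proof.
move=> c0 E; have := floor_bounds (x * c); have := floor_bounds (y * c).
rewrite E => h1 h2; rewrite -[ltRHS]mul1r ltr_pdivlMr// -{1}(gtr0_norm c0).
by rewrite -normrM mulrBl ltr_norml; lra.
Qed.

(** The sigma-algebra of the product is generated by coordinates; an open set
    is a countable union of dyadic cells of side [2 ^- k]. *)
Lemma open_measurable_R1n (U : set (R1n R n)) : open U -> measurable U.
Proof.
move=> oU; have -> : U = \bigcup_k (cell k @^-1` [set c | forall z, cell k z = c -> U z]).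
  apply/seteqP; split => [z Uz|z [k _] /=]; last exact.
  have : nbhs z U by exact: open_nbhs_nbhs.
  move=> /nbhs_ballP[e /= e0 eU].
  have [k ke] : exists k, (2 ^+ k)^-1 < e.
    have ei : 0 <= e^-1 by rewrite invr_ge0 ltW.
    have := archi_boundP ei; set k := Num.bound _ => ke; exists k.
    rewrite invf_plt ?posrE ?exprn_gt0// (lt_trans ke)// -natrX ltr_nat.
    exact: ltn_expl.
  exists k => // z' zz'; apply: eU.
  have p0 : 0 < (2 : R) ^+ k by rewrite exprn_gt0.
  move: zz' => [h1 h2]; split.
    rewrite /ball /= /ball_ /=; apply: lt_trans ke; exact: floor_dist.
  split=> // i j; rewrite (ord1 i) /ball /= /ball_ /=; apply: lt_trans ke.
  apply: floor_dist => //; move/rowP : h2 => /(_ j); rewrite !mxE.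
  by [].
apply: bigcup_measurable => k _; apply: measurable_fibers; exact: measurable_cell.
Qed.

Lemma closed_measurable_R1n (A : set (R1n R n)) : closed A -> measurable A.
Proof.
move=> cA; rewrite -[A]setCK; apply: measurableC; apply: open_measurable_R1n.
exact: closed_openC.
Qed.

Lemma continuous_measurable_R1n (phi : R1n R n -> R) : continuous phi ->
  measurable_fun [set: R1n R n] phi.
Proof.
move=> cphi; apply: (measurability _ (RGenOInfty.measurableE R)) => //.
move=> /= _ [_ [a ->] <-]; apply: measurableI => //.
apply: open_measurable_R1n; apply: open_comp; first by move=> z _; exact: cphi.
exact: interval_open.
Qed.

End borel.

(** * Whitney regions and their faces *)

Section generation.
Context (R : realType) (n : nat) (D : dyadic_system R n).
Implicit Types (Q P : dindex n) (z : R1n R n).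

(** The generation of the Whitney region at height [t], with the half-open
    convention [2^-j / 2 < t <= 2^-j] (see [genP]). *)
Definition gen (t : R) : int := Num.floor (- (ln t / ln 2)).

Let ln2_gt0 : 0 < ln 2 :> R. Proof. by rewrite ln_gt0// ltr1n. Qed.

Let ln_pow2 j : ln ((2 : R) ^ j) = j%:~R * ln 2.
Proof. by rewrite -powR_intmul// ln_powR. Qed.

Lemma genP (t : R) j : 0 < t -> (gen t == j) = (2 ^ (- j) / 2 < t <= 2 ^ (- j)).
Proof.
move=> t0; rewrite /gen floor_itv -mulNr ler_pdivlMr// ltr_pdivrMr// mulrDl mul1r.
have -> : (2 : R) ^ (- j) / 2 = 2 ^ (- (j + 1)) by rewrite opprD pow2P.
rewrite -[t in RHS]lnK ?posrE//.
have E k : (2 : R) ^ (- k) = expR (- (k%:~R * ln 2)).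
  by rewrite -mulNr -intrN -ln_pow2 lnK// posrE pow2_gt0.
rewrite !E ltr_expR ler_expR intrD mulrDl mul1r andbC; lra.
Qed.

Lemma gen_bounds (t : R) : 0 < t -> 2 ^ (- gen t) / 2 < t <= 2 ^ (- gen t).
Proof. by move=> t0; rewrite -genP. Qed.

(** The half-open Whitney regions partition the half-space, and the regions
    of [dwhitney] are their interiors. *)
Definition widx z : dindex n := locate D (gen z.1) z.2.

Lemma widx_side z : 0 < z.1 -> dside R (widx z) / 2 < z.1 <= dside R (widx z).
Proof. exact: gen_bounds. Qed.

Lemma widx_hcube z : hcube D (widx z) z.2.
Proof. by []. Qed.

Lemma dwhitney_widx Q z : dwhitney D Q z -> 0 < z.1 /\ widx z = Q.
Proof.
move=> [/andP[h1 h2] h3]; have t0 : 0 < z.1.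
  by apply: lt_trans h1; rewrite divr_gt0// side_gt0.
split=> //; rewrite /widx (_ : gen z.1 = Q.1); first exact: dcube_locate.
by apply/eqP; rewrite genP// h1 (ltW h2).
Qed.

Lemma measurable_gen j : measurable [set t : measurableTypeR R | gen t = j].
Proof.
have -> : [set t : measurableTypeR R | gen t = j] =
    (fun t : R => - (ln t / ln 2)) @^-1` `[j%:~R, (j%:~R + 1)[%classic.
  apply/seteqP; split => x /=; rewrite in_itv/= -floor_itv => /eqP //.
rewrite -[X in measurable X]setTI.
have m : measurable_fun [set: R] (fun t : R => - (ln t / ln 2)).
  apply: measurable_funN; apply: measurable_funM => //.
by apply: m => //; exact: measurable_itv.
Qed.

Lemma measurable_widx Q : measurable (widx @^-1` [set Q]).
Proof.
have -> : widx @^-1` [set Q] = [set t | gen t = Q.1] `*` hcube D Q.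
  apply/seteqP; split => [z /= zQ|z [/= h1 h2]].
    by split; rewrite /hcube/= -zQ.
  by rewrite /widx h1.
by apply: measurableX; [exact: measurable_gen|exact: measurable_hcube].
Qed.

Lemma measurable_fun_widx d (T : measurableType d) (F : dindex n -> T) :
  measurable_fun [set: R1n R n] (F \o widx).
Proof. by apply: measurable_fun_fibers; exact: measurable_widx. Qed.

Lemma measurable_halfspace : measurable (@halfspace R n).
Proof.
have -> : @halfspace R n = `]0, +oo[%classic `*` setT.
  by apply/seteqP; split => [z /= z0|z [/=]]; rewrite in_itv/= andbT.
by apply: measurableX => //; exact: measurable_itv.
Qed.

(** The projection of a point to the face of its Whitney region through which
    the derivative in the given direction charges: the top one for [t], the
    lower one for [x_i]. *)
Definition face (o : option 'I_n) z : R1n R n :=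
  if o is Some i then
    (z.1, \row_k (if k == i then corner D (widx z) k else z.2 0 k))
  else (dside R (widx z), z.2).

Lemma measurable_face o : measurable_fun [set: R1n R n] (face o).
Proof.
case: o => [i|]; apply: measurable_fun_pair => //=.
- apply: measurable_fun_rV => k; under eq_fun do rewrite mxE.
  case: (k == i); first exact: (measurable_fun_widx (fun Q => corner D Q k)).
  by apply: (measurableT_comp (measurable_coord k)); exact: measurable_snd.
- exact: (measurable_fun_widx (fun Q => dside R Q)).
Qed.

(** Boxes serve as explicit compact sets of the half-space. *)
Definition in_box (dl T rad : R) z := dl <= z.1 <= T /\ forall i, `|z.2 0 i| <= rad.

Lemma compact_in_box (K : set (R1n R n)) : compact K -> K `<=` @halfspace R n ->
  exists dl T rad, [/\ 0 < dl, 0 < T, 0 < rad & forall z, K z -> in_box dl T rad z].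
Proof.
move=> cK Kh.
have cfst : continuous (fun z : R1n R n => z.1 : R) by move=> z; exact: cvg_fst.
have csnd i : continuous (fun z : R1n R n => z.2 0 i : R).
  move=> z; apply: (@continuous_comp _ _ _ (snd : R1n R n -> 'rV[R]_n) (fun x : 'rV[R]_n => x 0 i)).
    exact: cvg_snd.
  exact: coord_continuous.
have bnd (g : R1n R n -> R) : continuous g -> exists2 M : R, 0 < M & forall z, K z -> `|g z| <= M.
  move=> cg; have cgK : compact (g @` K).
    by apply: continuous_compact => //; exact: continuous_subspaceT.
  have := compact_bounded cgK => -[M [_ HM]].
  exists (`|M| + 1); first by rewrite ltr_pwDr.
  move=> z Kz; apply: (HM (`|M| + 1)); last by exists z.
  by rewrite (le_lt_trans (ler_norm M))// ltrDl.
have [T T0 HT] := bnd _ cfst.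
have [dl dl0 Hdl] : exists2 dl, 0 < dl & forall z, K z -> dl <= z.1.
  have cfK : compact ((fun z : R1n R n => z.1 : R) @` K).
    by apply: continuous_compact => //; exact: continuous_subspaceT.
  have clK : closed ((fun z : R1n R n => z.1 : R) @` K).
    by apply: compact_closed => //; exact: Rhausdorff.
  have : open (~` ((fun z : R1n R n => z.1 : R) @` K)) by exact: closed_openC.
  rewrite openE => /(_ 0).
  have : (~` ((fun z : R1n R n => z.1 : R) @` K)) 0.
    by move=> [z /Kh /= z0 E]; move: z0; rewrite /halfspace/= E ltxx.
  move=> h /(_ h) /nbhs_ballP[e /= e0 He]; exists e => // z Kz.
  rewrite leNgt; apply/negP => ze; apply: (He z.1); last by exists z.
  rewrite /ball /= sub0r normrN gtr0_norm//; exact: Kh.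
have [rad rad0 Hrad] : exists2 rad : R, 0 < rad & forall z, K z -> forall i, `|z.2 0 i| <= rad.
  have B i := cid2 (bnd _ (csnd i)).
  exists (1 + \sum_i s2val (B i)).
    by rewrite ltr_pwDl// sumr_ge0// => i _; exact/ltW/(s2valP (B i)).
  move=> z Kz i; rewrite (bigD1 i)//= addrA addrAC.
  rewrite (le_trans (s2valP' (B i) z Kz))// lerDr addr_ge0// sumr_ge0// => k _.
  exact/ltW/(s2valP (B k)).
exists dl, T, rad; split => // z Kz; split; last exact: Hrad.
by rewrite Hdl//= (le_trans (ler_norm _))// HT.
Qed.

(** A point is at distance at most one side from its faces, and the side is
    at most [2 * T]. *)
Lemma face_in_box o dl T rad z : 0 < z.1 -> in_box dl T rad (face o z) ->
  in_box (dl / 2) T (rad + 2 * T) z.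
Proof.
move=> z0; have /andP[s1 s2] := widx_side z0; have s0 := side_gt0 R (widx z).
case: o => [i|] /= [/andP[/= h1 /= h2] /= h3]; split=> [|k].
- by apply/andP; split => //; lra.
- have := h3 k; rewrite mxE; case: eqP => [-> {k}|_]; last by lra.
  have := widx_hcube z; rewrite hcubeE => /(_ i); rewrite /= in_itv/=.
  by rewrite !ler_norml; lra.
- by apply/andP; split; lra.
- by have := h3 k; lra.
Qed.

Lemma measurable_in_box dl T rad : measurable [set z | in_box dl T rad z].
Proof.
have -> : [set z | in_box dl T rad z] =
   `[dl, T]%classic `*` box (fun i : 'I_n => `[- rad, rad]%classic).
  apply/seteqP; split => z [/= h1 h2].
    by split; rewrite /= ?in_itv//= => i /=; rewrite in_itv/= -ler_norml.
  by split; [move: h1; rewrite in_itv|move=> i; have := h2 i; rewrite /= in_itv/= -ler_norml].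
apply: measurableX; first exact: measurable_itv.
by apply: measurable_box => i; exact: measurable_itv.
Qed.

Lemma leb1_in_box dl T rad : (leb1 n [set z | in_box dl T rad z] < +oo)%E.
Proof.
have -> : [set z | in_box dl T rad z] =
   `[dl, T]%classic `*` box (fun i : 'I_n => `[- rad, rad]%classic).
  apply/seteqP; split => z [/= h1 h2].
    by split; rewrite /= ?in_itv//= => i /=; rewrite in_itv/= -ler_norml.
  by split; [move: h1; rewrite in_itv|move=> i; have := h2 i; rewrite /= in_itv/= -ler_norml].
rewrite /leb1 [X in (X < _)%E]product_measure1E; last 2 first.
- exact: measurable_itv.
- by apply: measurable_box => i; exact: measurable_itv.
pose l := fine (@lebesgue_measure R `[- rad, rad]%classic).
rewrite (@leb_box _ _ _ (fun=> l)); last 2 first.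
- by move=> i; exact: measurable_itv.
- move=> i; rewrite /l fineK// lebesgue_measure_itv/=.
  by case: ifP.
rewrite [X in (X * _)%E](_ : _ = (fine (@lebesgue_measure R `[dl, T]%classic))%:E).
  by rewrite -EFinM ltry.
by rewrite fineK// lebesgue_measure_itv/=; case: ifP.
Qed.

End generation.

(** * The gradient as a measure on the faces of Whitney regions *)

Section gradient_measure.
Context (R : realType) (n : nat) (D : dyadic_system R n).
Implicit Types (Q P : dindex n) (z : R1n R n) (o : option 'I_n).

Local Notation par := (par D).
Local Notation widx := (widx D).
Local Notation face := (face D).

Lemma gen_le (s t : R) : 0 < s -> s <= t -> gen t <= gen s.
Proof.
move=> s0 st; rewrite /gen le_floor// lerN2 ler_wpM2r ?invr_ge0 ?ln_ge0 ?ler1n//.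
by rewrite ler_ln ?posrE// (lt_le_trans s0).
Qed.

(** Boxes have finite measure. *)
Lemma box_integrable (h : R1n R n -> R) dl T rad (B : R) :
  measurable_fun [set: R1n R n] h ->
  (forall z, h z != 0 -> in_box dl T rad z) -> (forall z, `|h z| <= B) ->
  (leb1 n).-integrable setT (EFin \o h).
Proof.
move=> mh hbox hB; apply/integrableP; split; first exact/measurable_EFinP.
have mb := measurable_in_box dl T rad.
apply: (@le_lt_trans _ _ (\int[leb1 n]_(z in [set z | in_box dl T rad z]) B%:E)%E).
  rewrite [leRHS]integral_mkcond; apply: le_integral_ge0 => // z _.
  rewrite patchE /=; case: ifPn => [_|]; first by rewrite lee_fin.
  rewrite notin_setE/= => nb; rewrite lee_fin; have [->|/hbox //] := eqVneq (h z) 0.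
  by rewrite normr0.
rewrite integral_cst; last exact: mb.
rewrite lte_mul_pinfty ?lee_fin//; last exact: leb1_in_box.
exact: le_trans (normr_ge0 _) (hB 0).
Qed.

(** Functions on the tree as functions on the half-space, extended by [0]. *)
Definition upper (G : dindex n -> R) z : R := (0 < z.1)%R%:R * G (widx z).

Lemma measurable_upper G : measurable_fun [set: R1n R n] (upper G).
Proof.
apply: measurable_funM; last exact: measurable_fun_widx.
have -> : (fun z : R1n R n => (0 < z.1)%R%:R : R) = \1_(@halfspace R n).
  apply/funext => z; rewrite indicE; congr (nat_of_bool _)%:R.
  by apply/idP/idP => [h|]; [exact: mem_set|rewrite inE].
by apply: measurable_indic; exact: measurable_halfspace.
Qed.

Lemma upper_ge0 G : (forall Q, 0 <= G Q) -> forall z, 0 <= upper G z.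
Proof. by move=> G0 z; rewrite mulr_ge0. Qed.

Variable F : dindex n -> R.

Definition jump o Q : R :=
  if o is Some i then F Q - F (nbr (step false i) Q) else F (par Q) - F Q.

(** The inverse of the thickness of a Whitney region in the given direction:
    [side / 2] along [t] and [side] along [x_i]. *)
Definition weight o Q : R := (if o is Some _ then 1 else 2) / dside R Q.

Lemma weight_ge0 o Q : 0 <= weight o Q.
Proof. by rewrite divr_ge0// ?ltW ?side_gt0//; case: o. Qed.

(** The surface measure of a face is the image under [face] of the Lebesgue
    measure of the region divided by its thickness.  The sign [s] selects the
    positive or the negative part of the jump. *)
Definition density (s : R) o : R1n R n -> R :=
  upper (fun Q => Num.max (s * jump o Q) 0 * weight o Q).

Lemma measurable_density s o : measurable_fun [set: R1n R n] (density s o).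
Proof. exact: measurable_upper. Qed.

Lemma density_ge0 s o z : 0 <= density s o z.
Proof.
by apply: upper_ge0 => Q; rewrite mulr_ge0// ?weight_ge0// le_max lexx orbT.
Qed.

Definition jump_measure s o : {measure set (R1n R n) -> \bar R} :=
  [the {measure set _ -> \bar R} of
    wimage (leb1 n) (measurable_density s o) (density_ge0 s o)
      (measurable_face D o)].

(* This bound, uniform over the cubes that are not too small, is what local
   finiteness requires. *)
Hypothesis Fbd : forall j : int, exists M : R, forall Q, Q.1 <= j -> `|F Q| <= M.

Lemma widx_bounded (dl : R) o : 0 < dl -> exists B : R, [/\ 0 <= B,
  (forall z, dl <= z.1 -> `|F (widx z)| <= B) &
  (forall z, dl <= z.1 -> `|jump o (widx z)| * weight o (widx z) <= B)].
Proof.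
move=> dl0; have [M HM] := Fbd (gen dl).
have M0 : 0 <= M by apply: le_trans (HM (gen dl, 0) _).
exists (M + (M + M) * (2 / dl)); split.
- by rewrite addr_ge0// mulr_ge0// ?addr_ge0// divr_ge0// ltW.
- move=> z dz; rewrite (le_trans (HM _ _))//=; first exact: gen_le.
  by rewrite lerDl mulr_ge0// ?addr_ge0// divr_ge0// ltW.
move=> z dz; rewrite -[leLHS]add0r lerD// ler_pM ?weight_ge0//.
  have G : gen z.1 <= gen dl by exact: gen_le.
  rewrite /jump; case: o => [i|].
    by rewrite (le_trans (ler_normB _ _))// lerD// HM.
  by rewrite (le_trans (ler_normB _ _))// lerD// HM//= lerBlDr (le_trans G)// lerDl.
have z0 : 0 < z.1 by exact: lt_le_trans dz.
have /andP[_ sz] := widx_side D z0.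
rewrite /weight ler_pM//; last 2 first.
- by case: o => [_|]; rewrite ?ler1n.
- by rewrite lef_pV2 ?posrE ?side_gt0// (le_trans dz).
- by case: o.
- by rewrite invr_ge0 ltW ?side_gt0.
Qed.

Lemma density_le s o z : `|s| = 1 ->
  density s o z <= `|jump o (widx z)| * weight o (widx z).
Proof.
move=> s1; rewrite /density /upper; have W := weight_ge0 o (widx z).
have J : Num.max (s * jump o (widx z)) 0 <= `|jump o (widx z)|.
  by rewrite ge_max normr_ge0 andbT (le_trans (ler_norm _))// normrM s1 mul1r.
have X : Num.max (s * jump o (widx z)) 0 * weight o (widx z) <=
   `|jump o (widx z)| * weight o (widx z) by rewrite ler_wpM2r.
case: (0 < z.1); rewrite ?mul1r// mul0r; exact: mulr_ge0.
Qed.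

Lemma face_integrable o (psi : R1n R n -> R) (G : dindex n -> R) dl T rad (A B : R) :
  0 < dl -> measurable_fun [set: R1n R n] psi ->
  (forall z, `|psi z| <= A) -> (forall z, psi z != 0 -> in_box dl T rad z) ->
  (forall z, dl / 2 <= z.1 -> `|G (widx z)| <= B) ->
  (leb1 n).-integrable setT (EFin \o (fun z => psi (face o z) * upper G z)).
Proof.
move=> dl0 mpsi psiA psibox GB.
have S z : psi (face o z) * upper G z != 0 -> in_box (dl / 2) T (rad + 2 * T) z.
  rewrite mulf_eq0 negb_or => /andP[h1 h2]; apply: (@face_in_box _ _ D o).
    by move: h2; rewrite /upper; case: (0 < z.1) => //; rewrite mul0r eqxx.
  exact: psibox.
have A0 : 0 <= A by apply: le_trans (psiA 0).
apply: (@box_integrable _ (dl / 2) T (rad + 2 * T) (A * `|B|)) => //.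
  apply: measurable_funM; last exact: measurable_upper.
  by apply: (measurableT_comp mpsi); exact: measurable_face.
move=> z; have [->|/[dup] /S [/andP[h1 _] _]] := eqVneq (psi (face o z) * upper G z) 0.
  by rewrite normr0 mulr_ge0.
move=> _; rewrite normrM ler_pM// /upper normrM normr_nat.
have := GB z h1; have := ler_norm B.
by case: (0 < z.1); rewrite ?mul1r ?mul0r//; lra.
Qed.

Lemma compact_measurable_R1n (K : set (R1n R n)) : compact K -> measurable K.
Proof.
by move=> cK; apply: closed_measurable_R1n; apply: compact_closed.
Qed.

(** A compact set only receives mass from the regions above a slightly larger
    box, where the jumps and weights are bounded. *)
Lemma jump_measure_locally_finite s o (K : set (R1n R n)) : `|s| = 1 ->
  compact K -> K `<=` @halfspace R n -> (jump_measure s o K < +oo)%E.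
Proof.
move=> s1 cK Kh; have [dl [T [rad [dl0 _ _ Kbox]]]] := compact_in_box cK Kh.
have [B [B0 _ HB]] := widx_bounded o (divr_gt0 dl0 (ltr0n R 2)).
have mK := compact_measurable_R1n cK.
have := @face_integrable o \1_K
  (fun Q => Num.max (s * jump o Q) 0 * weight o Q) dl T rad 1 B dl0.
case/(_ _ _ _ _)/integrableP.
- exact: measurable_indic.
- by move=> z; rewrite indicE; case: (z \in K); rewrite ?normr1 ?normr0.
- move=> z; rewrite indicE; case: (boolP (z \in K)); last by rewrite eqxx.
  by rewrite inE => /Kbox.
- move=> z dz; have z0 : 0 < z.1 by apply: lt_le_trans dz; rewrite divr_gt0.
  have := density_le o z s1; rewrite /density /upper z0 mul1r => h.
  rewrite ger0_norm; last by rewrite mulr_ge0 ?weight_ge0// le_max lexx orbT.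
  exact: le_trans h (HB _ dz).
move=> _; apply: le_lt_trans; rewrite /jump_measure/= /wimage integral_mkcond.
apply: le_integral_ge0 => z _; rewrite patchE; case: ifPn => //.
- by move=> _; rewrite lee_fin density_ge0.
- rewrite inE/= => Kz; rewrite lee_fin indicE mem_set// mul1r.
  exact: ler_norm.
- by move=> _; rewrite -[point]/(0%E : \bar R) lee_fin.
Qed.

Definition jump_vmeasure : vmeasure R n :=
  @VMeasure R n (jump_measure 1) (jump_measure (-1))
    (fun o K cK Kh => conj
      (jump_measure_locally_finite o (normr1 R) cK Kh)
      (jump_measure_locally_finite o (normrN1 R) cK Kh)).

End gradient_measure.

(** * The distributional gradient *)

Section test_functions.
Context (R : realType) (n : nat).
Implicit Types (phi : R1n R n -> R) (z : R1n R n).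

Lemma test_function_smooth phi o : test_function phi ->
  [/\ continuous phi, (forall z, derivable phi z (dir R o)) &
      continuous ('D_(dir R o) phi)].
Proof.
move=> [/(_ 1%N) [cphi /(_ (dir R o)) [dphi [cD _]]] _]; split => //.
Qed.

Lemma test_function_box phi o : test_function phi -> exists dl T rad (B : R),
  [/\ 0 < dl, 0 < T, 0 < rad,
     (forall z, phi z != 0 \/ 'D_(dir R o) phi z != 0 -> in_box dl T rad z) &
     (forall z, `|phi z| <= B /\ `|'D_(dir R o) phi z| <= B)].
Proof.
move=> tphi; have [cphi dphi cD] := test_function_smooth o tphi.
case: tphi => _ [K [cK Kh K0]].
have DK z : ~ K z -> 'D_(dir R o) phi z = 0.
  move=> Kz; have oK : open (~` K) by apply: closed_openC; exact: compact_closed.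
  rewrite (@near_eq_derive _ _ _ phi (cst 0)) ?derive_cst//.
  by apply: filterS (open_nbhs_nbhs (conj oK Kz)) => y /K0.
have [dl [T [rad [dl0 T0 rad0 Kbox]]]] := compact_in_box cK Kh.
have bnd (g : R1n R n -> R) : continuous g -> (forall z, ~ K z -> g z = 0) ->
    exists2 M : R, 0 <= M & forall z, `|g z| <= M.
  move=> cg g0; have cgK : compact (g @` K).
    by apply: continuous_compact => //; exact: continuous_subspaceT.
  have := compact_bounded cgK => -[M [_ HM]].
  exists (`|M| + 1); first by rewrite addr_ge0.
  move=> z; have [Kz|/g0 ->] := pselect (K z); last by rewrite normr0 addr_ge0.
  by apply: (HM (`|M| + 1)); [rewrite (le_lt_trans (ler_norm M))// ltrDl|exists z].
have [A A0 HA] := bnd _ cphi K0; have [B B0 HB] := bnd _ cD DK.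
exists dl, T, rad, (A + B); split => // z.
  move=> h; apply: Kbox; apply: contrapT => Kz; move: h.
  by rewrite K0// DK// eqxx => -[].
by split; [rewrite (le_trans (HA z))// lerDl|rewrite (le_trans (HB z))// lerDr].
Qed.

End test_functions.

Lemma fubini_cancel_line (R : realType) n (i : 'I_n) (H : R1n R n -> R) :
  measurable_fun [set: R1n R n] H ->
  (leb1 n).-integrable setT (EFin \o H) ->
  (forall t x,
    lebesgue_measure.-integrable setT
      (fun r => (H (t, x + r *: delta_mx 0 i))%:E) /\
    (\int[lebesgue_measure]_r (H (t, x + r *: delta_mx 0 i))%:E = 0)%E) ->
  (\int[leb1 n]_z (H z)%:E = 0)%E.
Proof.
case: n i H => [[]//|n] i H mH iH H0; apply: (fubini_cancel_coord (i := i)) => // t v.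
have E r : ins i r v = ins i 0 v + r *: delta_mx 0 i.
  apply/rowP => k; rewrite !mxE eqxx/=.
  have [j ->|->] := unliftP i k; last by rewrite eqxx mulr1 add0r.
  by rewrite [_ == i]eq_sym (negbTE (neq_lift _ _)) mulr0 addr0.
have -> : (fun r : measurableTypeR R => (H (t, ins i r v))%:E) =
    (fun r : measurableTypeR R => (H (t, ins i 0 v + r *: delta_mx 0 i))%:E).
  by apply/funext => r; rewrite E.
exact: H0.
Qed.

Lemma maxr_sub (R : realType) (a : R) : Num.max a 0 - Num.max (- a) 0 = a.
Proof. by case: (leP a 0); case: (leP (- a) 0); lra. Qed.

Lemma pow2_unbounded (R : realType) (x : R) : exists k : nat, x < 2 ^ k%:Z.
Proof.
have h : 0 <= `|x| by [].
have := archi_boundP h; set k := Num.bound _ => ke; exists k.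
rewrite (le_lt_trans (ler_norm x))// (lt_trans ke)// -exprnP -natrX ltr_nat.
exact: ltn_expl.
Qed.

Section gradient.
Context (R : realType) (n : nat) (D : dyadic_system R n).
Implicit Types (Q P : dindex n) (z : R1n R n) (o : option 'I_n).
Variable F : dindex n -> R.
Hypothesis Fbd : forall j : int, exists M : R, forall Q, Q.1 <= j -> `|F Q| <= M.

Local Notation par := (par D).
Local Notation widx := (widx D).
Local Notation face := (face D).
Local Notation locate := (locate D).

Section line.
Variables (phi : R1n R n -> R) (o : option 'I_n).
Hypothesis tphi : test_function phi.

(** The integrand that has to vanish in the definition of the gradient, after
    the jump measure has been pulled back by [face].  Its integral over every
    line in the direction [o] is a telescoping sum. *)
Definition line_term z : R :=
  upper D F z * 'D_(dir R o) phi z +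
  phi (face o z) * upper D (fun Q => jump D F o Q * weight R o Q) z.

Lemma measurable_line_term : measurable_fun [set: R1n R n] line_term.
Proof.
have [cphi _ cD] := test_function_smooth o tphi.
apply: measurable_funD; apply: measurable_funM.
- exact: measurable_upper.
- exact: continuous_measurable_R1n.
- apply: (measurableT_comp (continuous_measurable_R1n cphi)).
  exact: measurable_face.
- exact: measurable_upper.
Qed.

Lemma line_integrable : [/\
  (leb1 n).-integrable setT (EFin \o (fun z => upper D F z * 'D_(dir R o) phi z)),
  (forall G : dindex n -> R, (forall dl, 0 < dl -> exists B : R, forall z : R1n R n, dl <= z.1 -> `|G (widx z)| <= B) ->
  (leb1 n).-integrable setT (EFin \o (fun z => phi (face o z) * upper D G z))) &
  exists dl T rad : R, [/\ 0 < dl, 0 < T, 0 < rad,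
     (forall z, line_term z != 0 -> in_box dl T rad z) &
     (forall z, phi z != 0 -> in_box dl T rad z)]].
Proof.
have [cphi _ cD] := test_function_smooth o tphi.
have [dl [T [rad [A [dl0 T0 rad0 box bnd]]]]] := test_function_box o tphi.
split.
- have [B [B0 HB _]] := widx_bounded D Fbd o dl0.
  apply: (@box_integrable _ _ _ dl T rad (B * A)).
  + apply: measurable_funM; first exact: measurable_upper.
    exact: continuous_measurable_R1n.
  + by move=> z; rewrite mulf_eq0 negb_or => /andP[_ h]; apply: box; right.
  + move=> z; have [h|h] := eqVneq ('D_(dir R o) phi z) 0.
      by rewrite h mulr0 normr0 mulr_ge0// (le_trans _ (bnd 0).1).
    rewrite normrM ler_pM ?(bnd z).2// /upper normrM normr_nat.
    have [/andP[d1 _] _] : in_box dl T rad z by apply: box; right.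
    by rewrite (lt_le_trans dl0 d1) mul1r HB.
- move=> G HG; have [B HB] := HG _ (divr_gt0 dl0 (ltr0n R 2)).
  apply: (@face_integrable _ _ _ o _ _ dl T rad A B dl0) => //.
  + exact: continuous_measurable_R1n.
  + by move=> z; have [] := bnd z.
  + by move=> z h; apply: box; left.
- have W (z : R1n R n) : in_box dl T rad z -> in_box (dl / 2) T (rad + 2 * T) z.
    move=> [/andP[h1 h2] h3]; split=> [|i]; first by apply/andP; split => //; lra.
    by rewrite (le_trans (h3 i))// lerDl; lra.
  exists (dl / 2), T, (rad + 2 * T); split => //; first by lra.
  + by lra.
  + move=> z nz; have z0 : 0 < z.1.
      move: nz; rewrite /line_term /upper; case: (0 < z.1) => //.
      by rewrite !mul0r mulr0 addr0 eqxx.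
    have [h|h] := eqVneq ('D_(dir R o) phi z) 0; last by apply: W; apply: box; right.
    apply: (face_in_box (D := D) (o := o)) => //; apply: box; left.
    by move: nz; rewrite /line_term h mulr0 add0r mulf_eq0 negb_or => /andP[].
  + by move=> z h; apply: W; apply: box; left.
Qed.

Variable a : R1n R n.
Let psi (r : R) := phi (a + r *: dir R o).

Lemma derivable_psi r : derivable psi r 1.
Proof.
by have [_ dphi _] := test_function_smooth o tphi; apply: derivable_line.
Qed.

Lemma derive1_psi r : derive1 psi r = 'D_(dir R o) phi (a + r *: dir R o).
Proof. exact: derive1_line. Qed.

Lemma continuous_derive1_psi : continuous (derive1 psi).
Proof.
have [_ _ cD] := test_function_smooth o tphi.
have -> : derive1 psi = 'D_(dir R o) phi \o (fun r : R => a + r *: dir R o).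
  by apply/funext => r; rewrite derive1_psi.
by move=> r; apply: continuous_comp; [exact: continuous_line|exact: cD].
Qed.

Lemma measurable_line_psi :
  measurable_fun [set: measurableTypeR R]
    (fun r : measurableTypeR R => line_term (a + r *: dir R o)).
Proof.
have ml : measurable_fun [set: measurableTypeR R]
    (fun r : measurableTypeR R => (a + r *: dir R o : R1n R n)).
  apply: measurable_fun_pair => /=.
    by apply: measurable_funD => //; apply: measurable_funM.
  apply: measurable_fun_rV => k; under eq_fun do rewrite !mxE.
  by apply: measurable_funD => //; apply: measurable_funM.
exact: (measurableT_comp measurable_line_term ml).
Qed.

End line.

(** The cells are the dyadic intervals of heights.  On the cell from [r] to
    [s] the function is [F Q] and the jump [F (par Q) - F Q] sits at the top
    [s]; the integral telescopes because [F Q * (psi s - psi r) + (F (par Q)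
    - F Q) * psi s = F (par Q) * psi s - F Q * psi r]. *)
Lemma line_term_time (phi : R1n R n -> R) x : test_function phi ->
  lebesgue_measure.-integrable setT (fun r => (line_term phi None (r, x))%:E) /\
  (\int[lebesgue_measure]_r (line_term phi None (r, x))%:E = 0)%E.
Proof.
move=> tphi; have [_ _ [dl [T [rad [dl0 T0 rad0 Hbox phibox]]]]] := line_integrable None tphi.
have [N0 HN0] := pow2_unbounded dl^-1.
have [N1 HN1] := pow2_unbounded T.
have E r : ((r, x) : R1n R n) = (0, x) + r *: dir R None.
  by rewrite [RHS]surjective_pairing /= scaler0 addr0 add0r [r *: 1]mulr1.
pose psi r := phi ((0, x) + r *: dir R None).
pose H r := line_term phi None (r, x).
have mH : measurable_fun [set: R] H.
  have := @measurable_line_psi _ None tphi (0, x).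
  by under eq_fun do rewrite -E.
pose q (j : nat) : R := 2 ^ (j%:Z - N0%:Z).
pose b (j : nat) : R := F (locate (N0%:Z - j%:Z - 1) x) * psi (q j).
have qS j : q j.+1 = q j * 2.
  by rewrite /q -pow2S; congr (_ ^ _); lia.
have q0 j : 0 < q j by rewrite pow2_gt0.
have psi0 r : ~~ (dl <= r <= T) -> psi r = 0.
  move=> h; apply/eqP; apply: contraNT h; rewrite /psi -E => /phibox [h _].
  exact: h.
have qdl : q 0%N < dl.
  by rewrite /q sub0r pow2N invf_plt ?posrE ?pow2_gt0.
have qT : T < q (N0 + N1)%N by rewrite /q PoszD addrAC subrr add0r.
apply: (@integral_telescope R H q b (N0 + N1)) => //.
- by move=> j; rewrite qS; have := q0 j; lra.
- move=> j _.
  pose Q := locate (N0%:Z - j%:Z - 1) x.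
  have sQ : dside R Q = q j.+1.
    by rewrite /dside /q /=; congr (_ ^ _); lia.
  have := @integral_affine_derivative R H psi (F Q)
     (psi (q j.+1) * (jump D F None Q * weight R None Q)) (q j) (q j.+1).
  case.
  + by rewrite qS; have := q0 j; lra.
  + exact: mH.
  + by move=> r; exact: derivable_psi.
  + exact: continuous_derive1_psi.
  + move=> r /andP[r1 r2]; have r0 : 0 < r by exact: lt_trans r1.
    have gr : gen r = Q.1.
      apply/eqP; rewrite genP// -/(dside R Q) sQ qS mulfK// r1.
      by rewrite -qS ltW.
    rewrite derive1_psi -E /psi -E /H /line_term /upper r0 !mul1r.
    by rewrite /face /widx /= gr -/Q sQ.
  move=> h1 h2; split => //; rewrite h2; congr EFin.
  have -> : b j.+1 = F (par Q) * psi (q j.+1).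
    by rewrite /b par_locate; congr (F (locate _ _) * _); lia.
  rewrite /b -/Q /jump /weight sQ qS.
  by field; rewrite gt_eqF.
- rewrite /b !psi0 ?mulr0//.
    by rewrite negb_and -!ltNge qT orbT.
  by rewrite negb_and -ltNge qdl.
- move=> r /Hbox [/andP[/= h1 h2] _]; rewrite (lt_le_trans qdl)//=.
  by rewrite (le_trans h2)// ltW.
Qed.

(** The cells are the intervals cut by the lattice of generation [gen t] on
    the line.  The jump now sits at the lower end of a cell, so that [b m]
    pairs the value of the preceding cell with [psi (q m)]. *)
Lemma line_term_space (phi : R1n R n -> R) (i : 'I_n) t x : test_function phi ->
  lebesgue_measure.-integrable setT
    (fun r => (line_term phi (Some i) (t, x + r *: delta_mx 0 i))%:E) /\
  (\int[lebesgue_measure]_r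
     (line_term phi (Some i) (t, x + r *: delta_mx 0 i))%:E = 0)%E.
Proof.
move=> tphi; have [_ _ [dl [T [rad [dl0 T0 rad0 Hbox phibox]]]]] := line_integrable (Some i) tphi.
have [t0|t0] := ltP 0 t; last first.
  have Z : (fun r : measurableTypeR R =>
      (line_term phi (Some i) (t, x + r *: delta_mx 0 i))%:E) = cst 0%E.
    by apply/funext => r; rewrite /line_term /upper /= ltNge t0 !mul0r mulr0 addr0.
  by rewrite Z; split; [exact: integrable0|rewrite integral0].
pose y r : 'rV[R]_n := x + r *: delta_mx 0 i.
have yi r : y r 0 i = x 0 i + r by rewrite /y !mxE !eqxx mulr1.
have yk r k : k != i -> y r 0 k = x 0 k.
  by move=> ki; rewrite /y !mxE eqxx (negbTE ki) mulr0 addr0.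
have E r : ((t, y r) : R1n R n) = (t, x) + r *: dir R (Some i).
  by rewrite [RHS]surjective_pairing /= scaler0 addr0.
pose psi r := phi ((t, x) + r *: dir R (Some i)).
pose H r := line_term phi (Some i) (t, y r).
have mH : measurable_fun [set: R] H.
  have := @measurable_line_psi _ (Some i) tphi (t, x).
  by under eq_fun do rewrite -E.
pose j := gen t; pose l : R := 2 ^ (- j).
have l0 : 0 < l by rewrite pow2_gt0.
have jl : 2 ^ j = l^-1 by rewrite /l pow2N invrK.
pose or := dorigin D j 0 i; pose a0 := or - x 0 i.
have := archi_boundP (normr_ge0 ((or + rad) / l)).
have := archi_boundP (normr_ge0 ((rad - or) / l)).
set N1 := Num.bound _ => HN1; set N0 := Num.bound _ => HN0.
have {}HN1 : rad - or < N1%:R * l.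
  by rewrite -ltr_pdivrMr// (le_lt_trans (ler_norm _)).
have {}HN0 : or + rad < N0%:R * l.
  by rewrite -ltr_pdivrMr// (le_lt_trans (ler_norm _)).
pose q (m : nat) : R := a0 + (m%:R - N0%:R) * l.
pose kap (m : int) : dindex n := (j, \row_k (if k == i then m else
   Num.floor ((x 0 k - dorigin D j 0 k) * 2 ^ j))).
pose b (m : nat) : R := F (kap (m%:Z - N0%:Z - 1)) * psi (q m).
have qS m : q m.+1 = q m + l by rewrite /q -natr1; ring.
have psi0 r : ~~ (- rad <= x 0 i + r <= rad) -> psi r = 0.
  move=> h; apply/eqP; apply: contraNT h; rewrite /psi -E => /phibox [_ /(_ i)].
  by rewrite /= yi ler_norml.
have q0rad : q 0%N + x 0 i < - rad by rewrite /q /a0; move: HN0; clear; lra.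
have qNrad : rad < q (N0 + N1)%N + x 0 i by rewrite /q /a0 natrD; move: HN1; clear; lra.
apply: (@integral_telescope R H q b (N0 + N1)) => //.
- by move=> m; rewrite qS ltrDl.
- move=> m _; pose Q := kap (m%:Z - N0%:Z).
  have sQ : dside R Q = l by [].
  have cQ : corner D Q i = x 0 i + q m.
    rewrite /corner sQ /Q /= [(\row__ _) _ _]mxE eqxx intrB -!pmulrn /q /a0 -/or.
    by ring.
  have nQ : nbr (step false i) Q = kap (m%:Z - N0%:Z - 1).
    rewrite /nbr /Q /kap /=; congr pair; apply/rowP => k; rewrite !mxE eqxx /=.
    by case: eqP => [_|_]; rewrite ?subr0.
  have := @integral_affine_derivative R H psi (F Q)
     (psi (q m) * (jump D F (Some i) Q * weight R (Some i) Q)) (q m) (q m.+1).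
  case.
  + by rewrite qS ltrDl.
  + exact: mH.
  + by move=> r; exact: derivable_psi.
  + exact: continuous_derive1_psi.
  + move=> r /andP[r1 r2].
    have LQ : locate j (y r) = Q.
      rewrite -[j]/(Q.1); apply/locateP => k; rewrite /Q /= [(\row__ _) _ _]mxE.
      case: eqP => [->|/eqP ki]; last by rewrite yk// floor_bounds.
      rewrite yi jl -/or intrB -!pmulrn ler_pdivlMr// ltr_pdivrMr//.
      by move: r1 r2; rewrite qS /q /a0; clear; lra.
    have fE : face (Some i) (t, y r) = (t, y (q m)).
      rewrite /face /widx /= -/j LQ; congr pair; apply/rowP => k; rewrite mxE.
      by case: eqP => [->|/eqP ki]; rewrite ?cQ ?yi// !yk.
    rewrite derive1_psi -E /psi -E /H /line_term /upper fE /= t0 !mul1r.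
    by rewrite /widx /= -/j LQ.
  move=> h1 h2; split => //; rewrite h2; congr EFin.
  have -> : b m.+1 = F Q * psi (q m.+1).
    by rewrite /b; congr (F (kap _) * _); clear; lia.
  rewrite /b /jump nQ /weight sQ qS.
  by field; rewrite gt_eqF.
- rewrite /b !psi0 ?mulr0//.
    by rewrite negb_and -!ltNge [x 0 i + _]addrC qNrad orbT.
  by rewrite negb_and -!ltNge [x 0 i + _]addrC q0rad.
- move=> r /Hbox [_ /(_ i)]; rewrite /= yi ler_norml => /andP[h1 h2].
  by apply/andP; move: h1 h2 q0rad qNrad; clear; split; lra.
Qed.

Lemma integral_jump_measure (phi : R1n R n -> R) s o : test_function phi ->
  \int[jump_measure D F s o]_(z in @halfspace R n) phi z =
  \int[leb1 n]_z (phi (face o z) * density D F s o z).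
Proof.
move=> tphi; have [cphi _ _] := test_function_smooth o tphi.
have [_ _ [dl [T [rad [dl0 _ _ _ phibox]]]]] := line_integrable o tphi.
rewrite /Rintegral; congr fine; rewrite integral_mkcond.
rewrite -(integral_wimage (leb1 n) (measurable_density D F s o)
  (density_ge0 D F s o) (measurable_face D o)); last first.
  exact: continuous_measurable_R1n.
apply: eq_integral => z _; rewrite patchE; case: ifPn => //.
rewrite notin_setE /halfspace /= => z0; have [-> //|/phibox] := eqVneq (phi z) 0.
by move=> [/andP[h _] _]; case: z0; exact: lt_le_trans h.
Qed.

(** The difference of the two jump measures has the jump as density, hence
    both sides of the integration by parts formula differ by the integral of
    [line_term], which vanishes by Fubini. *)
Lemma is_gradient_jump : is_gradient (F \o widx) (jump_vmeasure D Fbd).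
Proof.
split.
  move=> K cK Kh; have [dl [T [rad [dl0 _ _ Kbox]]]] := compact_in_box cK Kh.
  have mK := compact_measurable_R1n cK.
  have [B [B0 HB _]] := widx_bounded D Fbd None dl0.
  have mF : measurable_fun [set: R1n R n] (F \o widx) by exact: measurable_fun_widx.
  apply/(integrable_mkcond _ mK).
  have -> : (EFin \o (F \o widx)) \_ K = EFin \o (fun z => \1_K z * F (widx z)).
    apply/funext => z; rewrite patchE /= indicE; case: (z \in K); by rewrite ?mul1r ?mul0r.
  apply: (@box_integrable _ _ _ dl T rad B).
  - by apply: measurable_funM; [exact: measurable_indic|exact: mF].
  - move=> z; rewrite mulf_eq0 negb_or indicE => /andP[+ _].
    by case: (boolP (z \in K)); rewrite ?eqxx// inE => /Kbox.
  - move=> z; rewrite indicE; case: (boolP (z \in K)); last by rewrite mul0r normr0.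
    by rewrite inE mul1r => /Kbox [/andP[h _] _]; exact: HB.
move=> o phi tphi; rewrite !integral_jump_measure//.
have [I1 I2 [dl [T [rad [dl0 _ _ Hbox phibox]]]]] := line_integrable o tphi.
have -> : \int[leb1 n]_(z in @halfspace R n) ((F \o widx) z * 'D_(dir R o) phi z) =
    \int[leb1 n]_z (upper D F z * 'D_(dir R o) phi z).
  rewrite /Rintegral; congr fine; rewrite integral_mkcond; apply: eq_integral => z _.
  rewrite patchE /upper; case: ifPn; first by rewrite inE/= => ->; rewrite mul1r.
  by rewrite notin_setE/= => /negP/negbTE ->; rewrite !mul0r.
have ID s : `|s| = 1 -> (leb1 n).-integrable setT
    (EFin \o (fun z => phi (face o z) * density D F s o z)).
  move=> s1; apply: I2 => d d0; have [B [B0 _ HB]] := widx_bounded D Fbd o d0.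
  exists B => z dz; have z0 : 0 < z.1 by exact: lt_le_trans dz.
  have := density_le D F o z s1; rewrite /density /upper z0 mul1r => h.
  rewrite ger0_norm; first exact: le_trans h (HB _ dz).
  by rewrite mulr_ge0 ?weight_ge0// le_max lexx orbT.
apply/eqP; rewrite -addr_eq0 -RintegralB//; last 2 first.
- by apply: ID; rewrite normr1.
- by apply: ID; rewrite normrN1.
apply/eqP.
rewrite -RintegralD//; last first.
  exact: (integrableB measurableT (ID _ (normr1 R)) (ID _ (normrN1 R))).
set H := (X in Rintegral _ _ X); have HE : H = line_term phi o.
  apply/funext => z; rewrite /H /line_term -mulrBr /density /upper -mulrBr -mulrBl.
  congr (_ + _ * (_ * (_ * _))); rewrite mul1r mulN1r.
  exact: maxr_sub.
rewrite HE /Rintegral.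
suff -> : (\int[leb1 n]_z (line_term phi o z)%:E = 0)%E by [].
have mH := measurable_line_term o tphi.
have iH : (leb1 n).-integrable setT (EFin \o line_term phi o).
  rewrite -HE; exact: (integrableD measurableT I1
    (integrableB measurableT (ID _ (normr1 R)) (ID _ (normrN1 R)))).
case: o {H HE I1 I2 ID Hbox phibox} mH iH => [i|] mH iH.
- apply: (@fubini_cancel_line _ _ i) => // t x; exact: line_term_space.
- by apply: fubini_cancel_time => // x; exact: line_term_time.
Qed.

End gradient.

(** * The mass of the gradient over tents *)

Section total_variation_bound.
Context (R : realType) (n : nat) (D : dyadic_system R n).
Variable F : dindex n -> R.
Hypothesis Fbd : forall j : int, exists M : R, forall Q, Q.1 <= j -> `|F Q| <= M.

Lemma sqrt_sum_le (I : finType) (c : I -> R) :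
  Num.sqrt (\sum_i c i ^+ 2) <= \sum_i `|c i|.
Proof.
have S0 : 0 <= \sum_i `|c i| by exact: sumr_ge0.
rewrite -[leRHS]ger0_norm// -sqrtr_sqr ler_sqrt ?sqr_ge0//.
rewrite expr2 mulr_suml; apply: ler_sum => i _.
rewrite -real_normK ?num_real// expr2 ler_wpM2l// (bigD1 i)//= lerDl.
exact: sumr_ge0.
Qed.

(** The total variation of the component [o] of the gradient. *)
Definition mass o : set (R1n R n) -> \bar R := fun E =>
  (\int[leb1 n]_(z in face D o @^-1` E)
     (upper D (fun Q => `|jump D F o Q| * weight R o Q) z)%:E)%E.

Let mass_split o E : measurable E -> mass o E =
  (jump_measure D F 1 o E + jump_measure D F (-1) o E)%E.
Proof.
move=> mE; rewrite /jump_measure /= /wimage -ge0_integralD; last first.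
- by apply: measurable_funTS; apply/measurable_EFinP; exact: measurable_density.
- by move=> z _; rewrite lee_fin density_ge0.
- by apply: measurable_funTS; apply/measurable_EFinP; exact: measurable_density.
- by move=> z _; rewrite lee_fin density_ge0.
- by rewrite -[X in measurable X]setTI; exact: measurable_face.
apply: eq_integral => z _; rewrite -EFinD; congr EFin.
rewrite /density /upper -mulrDr -mulrDl; congr (_ * (_ * _)).
rewrite mul1r mulN1r; case: (leP (jump D F o (widx D z)) 0);
  case: (leP (- jump D F o (widx D z)) 0); case: ger0P; lra.
Qed.

(** The Euclidean norm is at most the sum of the absolute values of the
    components, and each component is at most the sum of its positive and
    negative parts, which is additive. *)
Lemma total_variation_jump E : measurable E ->
  (Defs.total_variation (jump_vmeasure D Fbd) E <= \sum_o mass o E)%E.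
Proof.
move=> mE; apply: ge_ereal_sup => _ [N [A [mA KA tA ->]]].
pose nu s o := jump_measure D F s o.
have fin s o k : `|s| = 1 -> nu s o (A k) \is a fin_num.
  move=> s1; rewrite ge0_fin_numE//; have [K cK [AK Kh]] := KA k.
  apply: (@le_lt_trans _ _ (nu s o K)).
    by apply: le_measure => //; rewrite inE; [exact: (mA k).1|exact: compact_measurable_R1n].
  exact: jump_measure_locally_finite.
have step k : ((vnorm (jump_vmeasure D Fbd) (A k))%:E <=
    \sum_o (nu 1%R o (A k) + nu (-1)%R o (A k)))%E.
  have -> : (\sum_o (nu 1%R o (A k) + nu (-1)%R o (A k)) =
      (\sum_o (fine (nu 1 o (A k)) + fine (nu (-1) o (A k)))%R)%:E)%E.
    rewrite -sumEFin; apply: eq_bigr => o _.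
    by rewrite EFinD !fineK// fin// ?normr1 ?normrN1.
  rewrite lee_fin (le_trans (sqrt_sum_le _))// ler_sum// => o _.
  by rewrite (le_trans (ler_normB _ _))// !ger0_norm ?fine_ge0.
apply: (@le_trans _ _
    (\sum_(k < N) \sum_o (nu 1%R o (A k) + nu (-1)%R o (A k)))%E).
  by rewrite -sumEFin; apply: lee_sum => k _; exact: step.
rewrite exchange_big /=; apply: lee_sum => o _.
rewrite mass_split// big_split /=.
have tU s : (\sum_(k < N) nu s o (A k) <= nu s o E)%E.
  rewrite -(@measure_bigsetU _ _ _ (nu s o) A (fun k => (mA k).1) tA N).
  apply: le_measure; rewrite ?inE//.
    by apply: bigsetU_measurable => k _; exact: (mA k).1.
  by rewrite -bigcup_mkord => z [k _ /(mA k).2].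
by apply: leeD; exact: tU.
Qed.

End total_variation_bound.

Section slab.
Context (R : realType) (n : nat) (D : dyadic_system R n).
Implicit Types (Q P : dindex n) (h : dindex n -> R).
Local Notation avg := (avg D).

Definition strip (j : int) : set R := `]2 ^ (- j) / 2, 2 ^ (- j)]%classic.

(** The part of the tent over [P] made of the Whitney regions [m] generations
    below [P]. *)
Definition slab (m : nat) P : set (R1n R n) := strip (P.1 + m%:Z) `*` hcube D P.

Definition tent P : set (R1n R n) := `]0, dside R P]%classic `*` hcube D P.

Lemma measurable_slab m P : measurable (slab m P).
Proof. by apply: measurableX; [exact: measurable_itv|exact: measurable_hcube]. Qed.

Lemma measurable_tent P : measurable (tent P).
Proof. by apply: measurableX; [exact: measurable_itv|exact: measurable_hcube]. Qed.

Lemma stripP j (t : R) : strip j t <-> 0 < t /\ gen t = j.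
Proof.
rewrite /strip /= in_itv/=; split=> [tj|[t0 /eqP]]; last by rewrite genP.
have t0 : 0 < t.
  by case/andP : tj => + _; apply: lt_trans; rewrite divr_gt0// pow2_gt0.
by split => //; apply/eqP; rewrite genP.
Qed.

Lemma gen_ge (t : R) j : 0 < t -> t <= 2 ^ (- j) -> j <= gen t.
Proof.
move=> t0 tj; rewrite leNgt; apply/negP => h.
have /andP[h1 _] := gen_bounds t0.
have := lt_le_trans h1 tj; apply/negP; rewrite -leNgt.
rewrite ler_pdivlMr// -pow2S ler_weXz2l ?ler1n//; lia.
Qed.

Lemma tent_slab P : tent P = \bigcup_m slab m P.
Proof.
apply/seteqP; split => [[t x] [/=]|[t x] /= [m _ [/= /stripP[t0 gt] Px]]].
  rewrite in_itv/= => /andP[t0 tP] Px.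
  have h := gen_ge t0 tP; exists `|gen t - P.1|%N => //; split => //=.
  by apply/stripP; split => //; lia.
split => //=; rewrite in_itv/= t0/=.
have /andP[_ h] := gen_bounds t0; rewrite (le_trans h)//.
by rewrite gt /dside ler_weXz2l ?ler1n//; lia.
Qed.

Lemma leb1_slab Q : leb1 n (slab 0 Q) = (dside R Q / 2 * dvol R Q)%:E.
Proof.
rewrite /slab /leb1 [LHS]product_measure1E; last 2 first.
- exact: measurable_itv.
- exact: measurable_hcube.
have s0 := side_gt0 R Q.
have SE : lebesgue_measure (strip (Q.1 + 0%Z)) = (dside R Q / 2)%:E.
  rewrite addr0 /strip lebesgue_measure_itv /= -/(dside R Q) lte_fin.
  by rewrite ifT -?EFinB; [congr EFin|]; lra.
by rewrite [X in (X * _)%E]SE leb_hcube -EFinM.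
Qed.

(** The factor [1/2] is the ratio of the height of a Whitney region to its
    side. *)
Lemma integral_slab h m P : (forall Q, 0 <= h Q) ->
  (\int[leb1 n]_(z in slab m P) (upper D (fun Q => h Q / dside R Q) z)%:E =
   (dvol R P * iter m avg (fun Q => h Q / 2) P)%:E)%E.
Proof.
move=> h0; have hs Q : 0 <= h Q / dside R Q by rewrite divr_ge0// ltW// side_gt0.
apply: (@integral_tree _ _ D _ _ (leb1 n) slab _ (fun Q => h Q / 2)).
- exact: measurable_slab.
- move=> k S; apply/seteqP; split => [[t x] /= [/= tS]|[t x]].
    rewrite hcube_child -bigcup_seq => -[b _ bx].
    rewrite -bigcup_seq; exists b; rewrite /= ?mem_index_enum//; split => //=.
    by rewrite addrAC -addrA -PoszD addn1.
  rewrite -bigcup_seq => -[b _ [/= tb bx]]; split => /=.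
    by move: tb; rewrite addrAC -addrA -PoszD addn1.
  by rewrite hcube_child -bigcup_seq; exists b; rewrite /= ?mem_index_enum.
- move=> k S b b' bb'; apply/seteqP; split => // -[t x] [[_ /= bx] [_ /= b'x]].
  by apply: bb'; apply: (@child_inj _ _ D S); apply: hcube_inj bx b'x.
- by apply/measurable_EFinP; exact: measurable_upper.
- by move=> z; rewrite lee_fin upper_ge0.
move=> Q _.
have mS := measurable_slab 0 Q.
rewrite (_ : \int[_]_(z in _) _ = \int[leb1 n]_(z in slab 0 Q) (h Q / dside R Q)%:E)%E.
  rewrite integral_cst; last exact: mS.
  rewrite [X in (_ * X)%E]leb1_slab -EFinM; congr EFin; field.
  exact/lt0r_neq0/side_gt0.
apply: eq_integral => -[t x]; rewrite inE => -[/= /stripP[t0 gt] Qx].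
rewrite /upper /= t0 mul1r /widx /= gt addr0.
by move: Qx; rewrite /hcube /= => ->.
Qed.

(** The constant [2] is the largest numerator of [weight]; it is compensated
    by the height [side / 2] of Whitney regions. *)
Lemma integral_tent h P (B : R) : (forall Q, 0 <= h Q) ->
  (forall M, \sum_(k < M) iter k avg h P <= B) ->
  (\int[leb1 n]_(z in tent P) (upper D (fun Q => 2 * h Q / dside R Q) z)%:E <=
   (dvol R P * B)%:E)%E.
Proof.
move=> h0 hB; have h2 Q : 0 <= 2 * h Q by rewrite mulr_ge0.
rewrite tent_slab ge0_integral_bigcup//; last 4 first.
- by move=> m; exact: measurable_slab.
- by apply: measurable_funTS; apply/measurable_EFinP; exact: measurable_upper.
- by move=> z _; rewrite lee_fin upper_ge0// => Q; rewrite divr_ge0// ltW// side_gt0.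
- apply/trivIsetP => i j _ _ ij; apply/seteqP; split => // -[t x].
  move=> [[/= /stripP[_ h1] _] [/= /stripP[_ h3] _]].
  by move: ij; apply/negP; rewrite negbK; apply/eqP; lia.
apply: lime_le; first (apply: is_cvg_nneseries => k _ _; apply: integral_ge0 => z _;
  by rewrite lee_fin upper_ge0// => Q; rewrite divr_ge0// ltW// side_gt0).
near=> M; rewrite (eq_bigr _ (fun k _ => integral_slab k P h2)) sumEFin lee_fin.
rewrite -mulr_sumr ler_pM2l ?dvol_gt0// big_mkord (le_trans _ (hB M))//.
apply: ler_sum => k _; apply: le_iter_avg => Q _.
by rewrite mulrAC divff ?mul1r// pnatr_eq0.
Unshelve. all: by end_near. Qed.

End slab.

Section mass.
Context (R : realType) (n : nat) (D : dyadic_system R n).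
Implicit Types (Q P : dindex n) (h : dindex n -> R).
Variable F : dindex n -> R.
Local Notation avg := (avg D).

(** The mass of [E] is carried by the points whose face lies in [E].  If
    these are covered by finitely many tents on which the jump is dominated
    by [h v], the mass is at most the sum of the integrals over the tents. *)
Lemma mass_le o (E : set (R1n R n)) (I : finType) (P : I -> dindex n)
    (h : I -> dindex n -> R) (B : R) :
  (forall v Q, 0 <= h v Q) ->
  (forall z, 0 < z.1 -> E (face D o z) -> exists v, tent D (P v) z /\
     `|jump D F o (widx D z)| <= h v (widx D z)) ->
  (forall v M, \sum_(k < M) iter k avg (h v) (P v) <= B) ->
  (mass D F o E <= (\sum_v dvol R (P v) * B)%:E)%E.
Proof.
move=> h0 cov hB.
pose H v z : \bar R := (upper D (fun Q => 2 * h v Q / dside R Q) z)%:E.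
have H0 v z : (0 <= H v z)%E.
  rewrite lee_fin upper_ge0// => Q.
  by rewrite mulr_ge0 ?mulr_ge0// invr_ge0 ltW// side_gt0.
rewrite -sumEFin; apply: (@le_trans _ _
    (\sum_v \int[leb1 n]_z (H v \_ (tent D (P v))) z)%E); last first.
  apply: lee_sum => v _; rewrite -integral_mkcond; exact: integral_tent.
rewrite -ge0_integral_sum//; last 2 first.
- move=> v; apply/(measurable_restrictT _ (measurable_tent _ _)).
  by apply: measurable_funTS; apply/measurable_EFinP; exact: measurable_upper.
- by move=> v z _; rewrite patchE; case: ifP.
rewrite /mass [leLHS]integral_mkcond; apply: le_integral_ge0 => z _.
  rewrite patchE; case: ifP => // _; rewrite lee_fin upper_ge0// => Q.
  by rewrite mulr_ge0// weight_ge0.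
have S0 : (0 <= \sum_v (H v \_ (tent D (P v))) z)%E.
  by apply: sume_ge0 => v _; rewrite patchE; case: ifP.
rewrite patchE; case: ifPn => //; rewrite inE/= => Ez.
have [z0|z0] := boolP (0 < z.1); last by rewrite /upper (negbTE z0) mul0r.
have [v [tv jv]] := cov z z0 Ez.
rewrite (bigD1 v)//= patchE mem_set// -[leLHS]adde0 leeD//; last first.
  by apply: sume_ge0 => w _; rewrite patchE; case: ifP.
rewrite lee_fin /upper z0 !mul1r /weight mulrA ler_wpM2r ?invr_ge0 ?(ltW (side_gt0 _ _))//.
rewrite mulrC ler_pM//; case: (o) => // _; by rewrite ler1n.
Qed.

End mass.

(** * The dyadic maximal function *)

Section dyadic_maximal.
Context (R : realType) (n : nat) (D : dyadic_system R n).
Implicit Types (P Q : dindex n) (x : 'rV[R]_n).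
Local Open Scope ereal_scope.

(** An open cube lies in some cube of the previous generation by nestedness,
    and a common point shows that this cube is the parent. *)
Lemma dcube_par Q : dcube D Q `<=` dcube D (par D Q).
Proof.
have [k' sub] := dyadic_nested D (Q.1 - 1) Q.2.
have EQ : Q = (Q.1 - 1 + 1, Q.2)%R by rewrite subrK -surjective_pairing.
have [x xQ] := dcube_center D Q.
suff -> : par D Q = (Q.1 - 1, k')%R by move: sub; rewrite -EQ.
rewrite -{1}(dcube_locate xQ) par_locate.
apply: (@dcube_locate _ _ D (Q.1 - 1, k')%R x).
by apply: sub; rewrite -EQ.
Qed.

Lemma dcube_anc k Q : dcube D Q `<=` dcube D (iter k (par D) Q).
Proof. by elim: k => [|k IH] //= x /IH; exact: dcube_par. Qed.

Lemma MD_ge0 h x : 0 <= MD D h x.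
Proof. by apply: ereal_sup_ubound; right. Qed.

Section locally_finite.
Variable h : 'rV[R]_n -> \bar R.
Hypothesis mh : measurable_fun [set: 'rV[R]_n] h.
Hypothesis hfin : locally_finite_integral D (fun x => `|h x|).
Local Notation w := (mean D (fun x => `|h x|)).

Let ma : measurable_fun [set: 'rV[R]_n] (fun x => `|h x|).
Proof. exact: measurableT_comp. Qed.

Lemma dcube_mean Q :
  (vol (dcube D Q))^-1%:E * \int[leb n]_(y in dcube D Q) `|h y| = (w Q)%:E.
Proof.
rewrite vol_dcube integral_dcube// integral_mean// -EFinM mulrA mulVf ?mul1r//.
by rewrite gt_eqF// dvol_gt0.
Qed.

Lemma le_MD Q x : dcube D Q x -> (w Q)%:E <= MD D h x.
Proof. by move=> Qx; apply: ereal_sup_ubound; left; exists Q; rewrite ?dcube_mean. Qed.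

Lemma MD_le x (y : \bar R) : 0 <= y ->
  (forall Q, dcube D Q x -> (w Q)%:E <= y) -> MD D h x <= y.
Proof.
move=> y0 H; apply: ge_ereal_sup => _ [[Q Qx ->]|->//].
by rewrite dcube_mean; exact: H.
Qed.

(** The supremum is over countably many functions [w Q * 1_Q]. *)
Lemma measurable_MD : measurable_fun [set: 'rV[R]_n] (MD D h).
Proof.
pose phi (k : nat) x := if unpickle k is Some Q then (w Q * \1_(dcube D Q) x)%:E else 0.
have phi0 k x : 0 <= phi k x.
  rewrite /phi; case: unpickle => // Q; rewrite lee_fin mulr_ge0 ?mean_ge0//.
have -> : MD D h = (fun x => esups (phi ^~ x) 0%N).
  apply/funext => x; apply/eqP; rewrite eq_le; apply/andP; split.
    apply: MD_le => [|Q Qx].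
      by apply: le_trans (phi0 0%N x) _; apply: ereal_sup_ubound; exists 0%N.
    apply: ereal_sup_ubound; exists (pickle Q) => //.
    by rewrite /phi pickleK indicE mem_set// mulr1.
  apply: ge_ereal_sup => _ [k _ <-]; rewrite /phi; case: unpickle; last exact: MD_ge0.
  move=> Q; rewrite indicE; case: (boolP (x \in dcube D Q)).
    by rewrite inE mulr1; exact: le_MD.
  by rewrite mulr0 => _; exact: MD_ge0.
apply: measurable_fun_esups => k; rewrite /phi; case: unpickle => [Q|//].
apply/measurable_EFinP; apply: measurable_funM => //.
by apply: measurable_indic; exact: measurable_dcube.
Qed.

Lemma MD_le_mstar x : MD D h x <= mstar D (fun x => `|h x|) x.
Proof.
apply: MD_le => [|Q Qx].
  apply: le_trans (mstar_ge (D := D) _ (near_cube_refl (locate D 0 x))).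
  by rewrite lee_fin mean_ge0.
apply: (@mstar_ge _ _ _ _ Q.1); rewrite (dcube_locate Qx); exact: near_cube_refl.
Qed.

End locally_finite.

End dyadic_maximal.

Section maximal_scaled.
Context (R : realType) (n : nat) (D : dyadic_system R n) (hn : (0 < n)%N).
Variables (p : R) (p1 : 1 < p).
Local Open Scope ereal_scope.

(** The constant [c] is absorbed into [h], because [Z] need not be measurable
    and cannot be divided by [c] under the integral. *)
Lemma maximal_Lp_scaled (h Z : 'rV[R]_n -> \bar R) (c : R) : (0 < c)%R ->
  measurable_fun [set: 'rV[R]_n] h -> (forall x, 0 <= h x) ->
  \int[leb n]_x (h x `^ p) < +oo ->
  (forall x, 0 <= Z x) -> (forall x, Z x <= c%:E * mstar D h x) ->
  Lp_norm p Z <= (c * maximal_constant n p)%:E * Lp_norm p h.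
Proof.
move=> c0 mh h0 hp Z0 Zh.
have p0 : (0 < p)%R by exact: lt_trans p1.
pose ch x := c%:E * h x.
have mch : measurable_fun [set: 'rV[R]_n] ch by exact: measurable_funeM.
have ch0 x : 0 <= ch x by rewrite mule_ge0// lee_fin ltW.
have chp x : ch x `^ p = (c `^ p)%:E * (h x `^ p).
  by rewrite /ch poweRM ?lee_fin ?(ltW c0)// poweR_EFin.
have Ich : \int[leb n]_x (ch x `^ p) = (c `^ p)%:E * \int[leb n]_x (h x `^ p).
  under eq_integral do rewrite chp.
  rewrite ge0_integralZl//; first exact: (measurableT_comp (measurable_poweR _)).
  - by move=> x _; exact: poweR_ge0.
  - by rewrite lee_fin powR_ge0.
have hfin := Lp_locally_finite D p1 mh h0 hp.
have mch_mean P : (mean D ch P = c * mean D h P)%R.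
  rewrite /mean ge0_integralZl//; last 3 first.
  - exact: measurable_hcube.
  - exact: measurable_funTS.
  - by rewrite lee_fin ltW.
  rewrite fineM//= ?mulrA// ge0_fin_numE; first exact: hfin.
  exact: integral_ge0.
have := @maximal_Lp R n D hn p p1 ch Z mch ch0.
rewrite Ich => /(_ _ Z0) H; apply: le_trans (H _ _) _.
- by rewrite lte_mul_pinfty// lee_fin powR_ge0.
- move=> x; apply: le_trans (Zh x) _.
  rewrite -lee_pdivlMl//; apply: ge_ereal_sup => _ [j [P [xP ->]]].
  rewrite lee_pdivlMl// -EFinM -mch_mean; exact: mstar_ge xP.
rewrite [(c * _)%R]mulrC EFinM -muleA lee_wpmul2l//.
  by rewrite lee_fin ltW// maximal_constant_gt0.
apply: Lnorm_le => //; first exact: ltW.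
under eq_integral do rewrite gee0_abs//.
by rewrite Ich; under [in leRHS]eq_integral do rewrite gee0_abs//.
Qed.

End maximal_scaled.

(** * Averages of the function and of its maximal function *)

Section averages.
Context (R : realType) (n : nat) (D : dyadic_system R n) (hn : (0 < n)%N).
Variables (p : R) (p1 : 1 < p) (g : 'rV[R]_n -> R).
Implicit Types (P Q : dindex n) (x : 'rV[R]_n).
Hypothesis gLp : g \in Lfun (leb n) p%:E.
Local Notation par := (par D).

Definition absg x : \bar R := `|(g x)%:E|%E.

Lemma Lp_measurable : measurable_fun [set: 'rV[R]_n] g.
Proof. by have := sub_Lfun_mfun gLp; rewrite inE. Qed.

Let mg := Lp_measurable.

Lemma measurable_absg : measurable_fun [set: 'rV[R]_n] absg.
Proof. by apply: measurableT_comp => //; exact/measurable_EFinP. Qed.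

Lemma absg_ge0 x : (0 <= absg x)%E. Proof. exact: abse_ge0. Qed.

Lemma integral_absg : (\int[leb n]_x (absg x `^ p) < +oo)%E.
Proof.
have /integrableP[_] := Lfun_integrable (ltW p1) gLp.
apply: le_lt_trans; apply: le_integral_ge0 => x _; first exact: poweR_ge0.
by rewrite /absg !abse_EFin poweR_EFin lee_fin ler_norm.
Qed.

Let mG := measurable_absg.
Let G0 := absg_ge0.
Let Gp := integral_absg.

Lemma absg_locally_finite : locally_finite_integral D absg.
Proof. exact: (Lp_locally_finite D p1). Qed.

Let Gfin := absg_locally_finite.

Definition wavg P : R := mean D absg P.

Lemma wavg_ge0 P : 0 <= wavg P. Proof. exact: mean_ge0. Qed.

Lemma avg_wavg P : avg D wavg P = wavg P.
Proof. exact: avg_mean. Qed.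

(** The average of [g], written with positive and negative parts so that the
    martingale property is that of nonnegative functions; see [uavgE]. *)
Definition uavg P : R :=
  mean D (fun x => maxe (g x)%:E 0%E) P - mean D (fun x => maxe (- (g x)%:E)%E 0%E) P.

Let part_finite (h : 'rV[R]_n -> \bar R) : (forall x, 0 <= h x <= absg x)%E ->
  locally_finite_integral D h.
Proof.
move=> hG P; apply: le_lt_trans (Gfin P).
by apply: le_integral_ge0 => x _; case/andP: (hG x).
Qed.

Let pos_le x : (0 <= maxe (g x)%:E 0 <= absg x)%E.
Proof. by rewrite le_max lexx orbT ge_max G0 andbT lee_abs. Qed.

Let neg_le x : (0 <= maxe (- (g x)%:E) 0 <= absg x)%E.
Proof. by rewrite le_max lexx orbT ge_max G0 andbT /absg -abseN lee_abs. Qed.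

Let mpos : measurable_fun [set: 'rV[R]_n] (fun x => maxe (g x)%:E 0%E).
Proof. by apply: measurable_maxe => //; exact/measurable_EFinP. Qed.

Let mneg : measurable_fun [set: 'rV[R]_n] (fun x => maxe (- (g x)%:E)%E 0%E).
Proof.
by apply: measurable_maxe => //; apply: measurableT_comp => //; exact/measurable_EFinP.
Qed.

Let pos0 x : (0 <= maxe (g x)%:E 0)%E. Proof. by case/andP: (pos_le x). Qed.
Let neg0 x : (0 <= maxe (- (g x)%:E) 0)%E. Proof. by case/andP: (neg_le x). Qed.
Let posfin := part_finite pos_le.
Let negfin := part_finite neg_le.

Lemma avg_uavg P : avg D uavg P = uavg P.
Proof.
rewrite /uavg; apply: etrans (avgB _ _ _ _) _.
have E1 := avg_mean mpos pos0 posfin P; have E2 := avg_mean mneg neg0 negfin P.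
by rewrite E1 E2.
Qed.

Lemma uavg_le P : `|uavg P| <= wavg P.
Proof.
suff -> : wavg P = mean D (fun x => maxe (g x)%:E 0%E) P +
    mean D (fun x => maxe (- (g x)%:E)%E 0%E) P.
  apply: le_trans (ler_normB _ _) _; apply: lerD.
    by have := mean_ge0 D pos0 P; move: (mean _ _ _) => a a0; rewrite ger0_norm.
  by have := mean_ge0 D neg0 P; move: (mean _ _ _) => a a0; rewrite ger0_norm.
have v0 := dvol_gt0 R P; apply: (mulfI (lt0r_neq0 v0)); apply: EFin_inj.
have := integral_mean neg0 negfin P; have := integral_mean pos0 posfin P.
have := integral_mean G0 Gfin P; rewrite -/(wavg P).
move: (wavg P) (mean D _ P) (mean D _ P) => a b c Ea Eb Ec.
rewrite mulrDr EFinD -Ea -Eb -Ec -ge0_integralD; last first.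
- exact: measurable_funTS.
- by move=> x _; exact: neg0.
- exact: measurable_funTS.
- by move=> x _; exact: pos0.
- exact: measurable_hcube.
apply: eq_integral => x _; rewrite /absg -EFinN -!EFin_max -EFinD abse_EFin.
by congr EFin; case: ger0P => h; case: (leP (g x) 0); case: (leP (- g x) 0); lra.
Qed.

Lemma uavgE P :
  (vol (dcube D P))^-1 * \int[leb n]_(y in dcube D P) g y = uavg P.
Proof.
rewrite vol_dcube /Rintegral integral_dcube; last exact/measurable_EFinP.
rewrite integralE (eq_integral (fun x => maxe (g x)%:E 0%E)); last first.
  by move=> x _; rewrite funeposE.
rewrite [X in (_ - X)%E](eq_integral (fun x => maxe (- (g x)%:E)%E 0%E)); last first.
  by move=> x _; rewrite funenegE.
rewrite (integral_mean pos0 posfin) (integral_mean neg0 negfin) -EFinB /= /uavg -mulrBr mulKf// gt_eqF//.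
exact: dvol_gt0.
Qed.

(** By Jensen's inequality the average of [|g|] to the power [p] is at most
    the total integral of [|g|^p] over the volume; when the average exceeds
    [1] it is smaller than its power.  Large cubes therefore have bounded
    averages, and the supremum over the ancestors is finite. *)
Lemma wavg_bound : exists A : R, 0 <= A /\ forall P, wavg P <= 1 + A / dvol R P.
Proof.
exists (fine (\int[leb n]_x (absg x `^ p))%E); split.
  by apply: fine_ge0; apply: integral_ge0 => x _; exact: poweR_ge0.
move=> P; have v0 := dvol_gt0 R P.
have [w1|w1] := leP (wavg P) 1.
  rewrite (le_trans w1)// lerDl divr_ge0// ?(ltW v0)//.
  by apply: fine_ge0; apply: integral_ge0 => x _; exact: poweR_ge0.
rewrite (@le_trans _ _ (wavg P `^ p))//.
  by rewrite -[leLHS]powRr1 ?wavg_ge0// ler_powR// ltW.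
rewrite (le_trans (mean_pow D p1 mG G0 Gp P))// -[leLHS]add0r lerD//.
rewrite /mean ler_wpM2r ?invr_ge0 ?(ltW v0)//.
have fin : (\int[leb n]_x (absg x `^ p))%E \is a fin_num.
  by rewrite ge0_fin_numE//; apply: integral_ge0 => x _; exact: poweR_ge0.
apply: fine_le => //.
  rewrite ge0_fin_numE; first exact: (pow_locally_finite D mG Gp P).
  by apply: integral_ge0 => x _; exact: poweR_ge0.
exact: integral_pow_cube.
Qed.

Lemma dvol_anc k P : dvol R P <= dvol R (iter k par P).
Proof.
elim: k => //= k IH; rewrite (le_trans IH)// /dvol side_par exprMn.
by rewrite ler_peMr// ?exprn_ge0 ?(ltW (side_gt0 _ _))// exprn_ege1// ler1n.
Qed.

(** The value on [P] of the dyadic maximal function restricted to cubes that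
    contain [P].  Unlike the maximal function itself it is a function on the
    tree; it is nondecreasing from parent to child and changes only at the
    cubes that realize it. *)
Definition maxavg P : R := sup [set wavg (iter k par P) | k in [set: nat]].

Let has_sup_anc P : has_sup [set wavg (iter k par P) | k in [set: nat]].
Proof.
split; first by exists (wavg P); exists 0%N.
have [A [A0 HA]] := wavg_bound; exists (1 + A / dvol R P) => _ [k _ <-].
rewrite (le_trans (HA _))// lerD2l ler_wpM2l// lef_pV2 ?posrE ?dvol_gt0//.
exact: dvol_anc.
Qed.

Lemma wavg_anc_le k P : wavg (iter k par P) <= maxavg P.
Proof. by apply: ub_le_sup; [exact: (has_sup_anc P).2|exists k]. Qed.

Lemma maxavg_le P (a : R) : (forall k, wavg (iter k par P) <= a) -> maxavg P <= a.
Proof.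
move=> H; apply: ge_sup; first exact: (has_sup_anc P).1.
by move=> _ [k _ <-].
Qed.

Lemma wavg_le_maxavg P : wavg P <= maxavg P. Proof. exact: (wavg_anc_le 0). Qed.

Lemma maxavg_ge0 P : 0 <= maxavg P.
Proof. exact: le_trans (wavg_ge0 P) (wavg_le_maxavg P). Qed.

Lemma maxavg_par P : maxavg (par P) <= maxavg P.
Proof. by apply: maxavg_le => k; rewrite -iterSr; exact: wavg_anc_le. Qed.

Lemma maxavg_step P : maxavg P <= Num.max (maxavg (par P)) (wavg P).
Proof.
apply: maxavg_le => -[|k]; first by rewrite le_max lexx orbT.
by rewrite iterSr le_max wavg_anc_le.
Qed.

Lemma maxavg_bounded (j : int) : exists M : R, forall P, P.1 <= j -> maxavg P <= M.
Proof.
have [A [A0 HA]] := wavg_bound.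
exists (1 + A / (2 ^ (- j)) ^+ n) => P Pj; apply: maxavg_le => k.
rewrite (le_trans (HA _))// lerD2l ler_wpM2l//.
rewrite lef_pV2 ?posrE ?dvol_gt0 ?exprn_gt0 ?pow2_gt0//.
rewrite (le_trans _ (dvol_anc k P))// /dvol.
apply: lerXn2r; rewrite ?nnegrE ?(ltW (pow2_gt0 _ _))//.
by rewrite /dside ler_weXz2l ?ler1n// lerN2.
Qed.

Lemma maxavg_MD P x : dcube D P x -> ((maxavg P)%:E <= MD D (EFin \o g) x)%E.
Proof.
move=> Px.
have mGE : measurable_fun [set: 'rV[R]_n] (EFin \o g) by exact/measurable_EFinP.
have [M|fin] := eqVneq (MD D (EFin \o g) x) +oo%E; first by rewrite M leey.
have E : MD D (EFin \o g) x = (fine (MD D (EFin \o g) x))%:E.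
  by rewrite fineK// ge0_fin_numE ?MD_ge0// lt_neqAle fin leey.
rewrite E lee_fin; apply: maxavg_le => k; rewrite -lee_fin -E.
by apply: (le_MD mGE Gfin); exact: dcube_anc.
Qed.

Lemma maxavg_mstar j P x : near_cube P (locate D j x) ->
  ((maxavg P)%:E <= mstar D absg x)%E.
Proof.
move=> Px; have S k : ((wavg (iter k par P))%:E <= mstar D absg x)%E.
  by apply: (@mstar_ge _ _ _ _ (j - k%:Z)); rewrite -anc_locate; exact: near_anc.
have [M|fin] := eqVneq (mstar D absg x) +oo%E; first by rewrite M leey.
have E : mstar D absg x = (fine (mstar D absg x))%:E.
  rewrite fineK// ge0_fin_numE; first by rewrite lt_neqAle fin leey.
  by apply: le_trans (S 0%N); rewrite lee_fin wavg_ge0.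
rewrite E lee_fin; apply: maxavg_le => k; rewrite -lee_fin -E; exact: S.
Qed.

Local Notation Mg := (MD D (EFin \o g)).

Lemma measurable_Mg : measurable_fun [set: 'rV[R]_n] Mg.
Proof. by apply: measurable_MD; [exact/measurable_EFinP|exact: Gfin]. Qed.

Lemma Mg_ge0 x : (0 <= Mg x)%E. Proof. exact: MD_ge0. Qed.

Lemma Mg_mstar x : (Mg x <= mstar D absg x)%E.
Proof. by apply: MD_le_mstar; [exact/measurable_EFinP|exact: Gfin]. Qed.

Lemma integral_Mg : (\int[leb n]_x (Mg x `^ p) < +oo)%E.
Proof.
have p0 : 0 <= p by rewrite ltW// (lt_trans _ p1).
apply: (@le_lt_trans _ _ (\int[leb n]_x (mstar D absg x `^ p))%E).
  apply: le_integral_ge0 => x _; first exact: poweR_ge0.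
  by apply: le_poweR => //; [exact: Mg_ge0|exact: Mg_mstar].
apply: le_lt_trans (integral_mstar D hn p1 mG G0 Gp) _.
rewrite lte_mul_pinfty// lee_fin mulr_ge0// ?exprn_ge0//.
by rewrite divr_ge0 ?powR_ge0// subr_ge0 ltW.
Qed.

Lemma Mg_locally_finite : locally_finite_integral D Mg.
Proof.
exact: (Lp_locally_finite D p1 measurable_Mg Mg_ge0 integral_Mg).
Qed.

(** Averages of the maximal function: they dominate the averages of [maxavg]
    over all generations below [P], which is how the iterated maximal
    function appears in the Carleson estimate. *)
Definition Mavg P : R := mean D Mg P.

Lemma maxavg_Mavg P : maxavg P <= Mavg P.
Proof.
apply: le_mean; [exact: measurable_Mg|exact: Mg_ge0|exact: Mg_locally_finite|].
by move=> x; exact: maxavg_MD.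
Qed.

Lemma Mavg_ge0 P : 0 <= Mavg P.
Proof. exact: le_trans (maxavg_ge0 P) (maxavg_Mavg P). Qed.

Lemma iter_maxavg_le k P : iter k (avg D) maxavg P <= Mavg P.
Proof.
have h : forall Q, avg D Mavg Q = Mavg Q.
  move=> Q; apply: avg_mean; [exact: measurable_Mg|exact: Mg_ge0|exact: Mg_locally_finite].
rewrite -(iter_avg_martingale k P h); apply: le_iter_avg => Q _.
exact: maxavg_Mavg.
Qed.

Lemma Mavg_MD P x : dcube D P x -> ((Mavg P)%:E <= MD D Mg x)%E.
Proof.
move=> Px; have E : Mg = (fun y => `|Mg y|%E).
  by apply/funext => y; rewrite gee0_abs// Mg_ge0.
rewrite /Mavg {1}E; apply: le_MD => //; first exact: measurable_Mg.
by rewrite -E; exact: Mg_locally_finite.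
Qed.

Lemma Lp_norm_Mg :
  (Lp_norm p Mg <= (maximal_constant n p)%:E * Lp_norm p (EFin \o g))%E.
Proof.
have E : Lp_norm p (EFin \o g) = Lp_norm p absg.
  exact/esym/Lnorm_abse.
rewrite E; apply: maximal_Lp => //; [exact: Mg_ge0|exact: Mg_mstar].
Qed.

End averages.

(** * Faces, neighbours and Carleson boxes *)

Section geometry.
Context (R : realType) (n : nat) (D : dyadic_system R n).
Implicit Types (P Q : dindex n) (x : 'rV[R]_n) (z : R1n R n).
Local Notation locate := (locate D).
Local Notation face := (face D).
Local Notation widx := (widx D).

Lemma below_locate j Q x : j <= Q.1 -> locate Q.1 x = Q -> below D (locate j x) Q.
Proof.
move=> jQ Qx; exists `|Q.1 - j|%N; rewrite -{2}Qx anc_locate; congr locate; lia.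
Qed.

Lemma locate_face o z : locate (widx z).1 (face o z).2 = widx z.
Proof.
case: o => [i|] //; have : hcube D (widx z) z.2 by exact: widx_hcube.
rewrite -[LHS]/(locate (widx z).1 _) => h.
suff : hcube D (widx z) (face (Some i) z).2 by [].
move: h; rewrite hcubeE => h k; rewrite /face [(\row__ _) _ _]mxE.
by case: eqP => [->|_]; [rewrite /= in_itv/= lexx ltrDl side_gt0|exact: h].
Qed.

Lemma hcube_below P Q x : below D P Q -> hcube D Q x -> hcube D P x.
Proof. by move=> [k <-]; exact: hcube_anc. Qed.

Lemma corner_left Q i k : corner D (nbr (step false i) Q) k =
  corner D Q k - (k == i)%:R * dside R Q.
Proof.
rewrite /corner -[dside R (nbr _ Q)]/(dside R Q) /=.
have -> : (Q.2 - delta_mx 0 i) 0 k = Q.2 0 k - (k == i)%:Z by rewrite !mxE eqxx; case: (k == i).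
by rewrite intrB mulrBr addrA [_%:R * _]mulrC; case: eqP.
Qed.

(** A lower face inside an open cube has points of this cube on both sides: a
    point slightly to the left of the face still lies in [P] and belongs to
    the left neighbour of the region. *)
Lemma below_left_face P z i : P.1 <= (widx z).1 -> dcube D P (face (Some i) z).2 ->
  below D P (nbr (step false i) (widx z)).
Proof.
set Q := widx z; set y := (face (Some i) z).2 => PQ Py.
have yQ : locate Q.1 y = Q by exact: locate_face.
have yi : y 0 i = corner D Q i by rewrite /y /face [(\row__ _) _ _]mxE eqxx.
have s0 := side_gt0 R Q.
have Pi : corner D P i < y 0 i.
  by have := Py; rewrite dcube_box => /(_ i); rewrite /= in_itv/= => /andP[].
(* the displacement stays within the left neighbour and to the right of the
   lower face of [P] *)
pose d := Num.min (dside R Q) ((y 0 i - corner D P i) / 2).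
have d0 : 0 < d by rewrite lt_min s0 divr_gt0// subr_gt0.
have dQ : d <= dside R Q by rewrite ge_min lexx.
have dP : d <= (y 0 i - corner D P i) / 2 by rewrite ge_min lexx orbT.
pose y' : 'rV[R]_n := y - d *: delta_mx 0 i.
have y'i : y' 0 i = y 0 i - d by rewrite /y' !mxE !eqxx mulr1.
have y'k k : k != i -> y' 0 k = y 0 k.
  by move=> ki; rewrite /y' !mxE eqxx (negbTE ki) mulr0 subr0.
have Py' : dcube D P y'.
  move: Py; rewrite !dcube_box => Py k; have := Py k; rewrite /= !in_itv/=.
  have [-> /andP[h1 h2]|ki] := eqVneq k i; last by rewrite y'k.
  by rewrite y'i; move: Pi h2 d0 dP; clear; lra.
have Q'y' : hcube D (nbr (step false i) Q) y'.
  have : hcube D Q y by exact: yQ.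
  rewrite !hcubeE => h k; have := h k; rewrite /= !in_itv/=.
  have ck := corner_left Q i k.
  rewrite ck -[dside R (nbr _ Q)]/(dside R Q).
  have [->|ki] := eqVneq k i; last by rewrite mul0r subr0 y'k.
  by rewrite y'i yi mul1r; move: d0 dQ; clear; lra.
rewrite -(dcube_locate Py'); apply: below_locate; [exact: PQ|exact: Q'y'].
Qed.

Definition adj (v : {ffun 'I_n -> 'I_3}) : 'rV[int]_n := \row_i ((v i : nat)%:Z - 1).

(** Points less than one side apart in each coordinate have positions
    differing by at most one. *)
Lemma adjP j x (y : 'rV[R]_n) : (forall k, `|y 0 k - x 0 k| < 2 ^ (- j)) ->
  exists v, locate j y = nbr (adj v) (locate j x).
Proof.
move=> xy; exists [ffun k => inord `|((locate j y).2 0 k - (locate j x).2 0 k + 1)%R|%N].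
rewrite /nbr; congr pair; apply/rowP => k.
rewrite [in RHS]mxE [X in _ + X]mxE ffunE.
set b := (locate j y).2 0 k; set a := (locate j x).2 0 k.
have [h1 h2] : -1 <= b - a /\ b - a <= 1.
  have /andP[a1 a2] : a%:~R <= (x 0 k - dorigin D j 0 k) * 2 ^ j < a%:~R + 1.
    by rewrite /a /= mxE; exact: floor_bounds.
  have /andP[b1 b2] : b%:~R <= (y 0 k - dorigin D j 0 k) * 2 ^ j < b%:~R + 1.
    by rewrite /b /= mxE; exact: floor_bounds.
  have := xy k; rewrite pow2N -[X in _ < X]mul1r ltr_pdivlMr ?pow2_gt0//.
  rewrite -{1}(gtr0_norm (pow2_gt0 R j)) -normrM mulrBl ltr_norml => /andP[d1 d2].
  have e1 : (b - a)%:~R < 2%:~R :> R by rewrite intrB; move: a1 b1 a2 b2 d1 d2; rewrite !mulrBl; clear; lra.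
  have e2 : (-2)%:~R < (b - a)%:~R :> R by rewrite intrB; move: a1 b1 a2 b2 d1 d2; rewrite !mulrBl; clear; lra.
  by move: e1 e2; rewrite !ltr_int; clear; lia.
by rewrite inordK; move: h1 h2; clear; lia.
Qed.

Lemma adj_near v Q : near_cube (nbr (adj v) Q) Q.
Proof.
apply/near_cubeP; split => // k; rewrite /= !mxE addrAC subrr add0r.
by have := ltn_ord (v k); lia.
Qed.

Lemma adj_left_near v i Q : near_cube (nbr (step false i) (nbr (adj v) Q)) Q.
Proof.
apply/near_cubeP; split => // k; rewrite /= !mxE eqxx /=.
have := ltn_ord (v k); case: (k == i); rewrite /=; lia.
Qed.

End geometry.

Section carleson_boxes.
Context (R : realType) (n : nat).

Lemma measurable_carleson l (A : set 'rV[R]_n) : measurable A ->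
  measurable (carleson l A).
Proof.
move=> mA; have -> : carleson l A = `]0, l[%classic `*` A.
  by apply/seteqP; split => -[t x] [/= h Ax]; split => //; move: h; rewrite /= in_itv.
by apply: measurableX => //; exact: measurable_itv.
Qed.

Lemma leb_cube (a : 'rV[R]_n) l : 0 < l ->
  measurable (cube a l) /\ vol (cube a l) = l ^+ n.
Proof.
move=> l0; have -> : cube a l = box (fun i => `]a 0 i, a 0 i + l[%classic).
  by apply/seteqP; split => x h i; have := h i; rewrite /= in_itv.
split; first by apply: measurable_box => i; exact: measurable_itv.
rewrite /vol (@leb_box _ _ _ (fun=> l)) /= ?prodr_const ?card_ord//.
by move=> i; rewrite lebesgue_measure_itv/= lte_fin ltrDl l0 -EFinB addrAC subrr add0r.
Qed.

Lemma cube_dist a l (x y : 'rV[R]_n) L k : cube a l x -> cube a l y -> l <= L ->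
  `|y 0 k - x 0 k| < L.
Proof. by move=> xa ya lL; have := xa k; have := ya k; rewrite ltr_norml; lra. Qed.

End carleson_boxes.

(** * The approximation and its Carleson estimates *)

Section approximation.
Context (R : realType) (n : nat) (D : dyadic_system R n) (hn : (0 < n)%N).
Variables (p : R) (p1 : 1 < p) (g : 'rV[R]_n -> R).
Hypothesis gLp : g \in Lfun (leb n) p%:E.
Variables (Q0 : dindex n) (e : R).
Hypothesis e01 : 0 < e < 1.
Implicit Types (P Q : dindex n) (x : 'rV[R]_n) (z : R1n R n).

Local Notation par := (par D).
Local Notation avg := (avg D).
Local Notation u := (uavg D g).
Local Notation m := (maxavg D g).
Local Notation Mg := (MD D (EFin \o g)).
Local Notation Z := (Mavg D g).

Definition approx : dindex n -> R := stop D hn Q0 u m e.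
Local Notation F := approx.

Let e0 : 0 < e. Proof. by case/andP: e01. Qed.
Let N := (2 : R) ^+ n.
Let N0 : 0 < N. Proof. exact: exprn_gt0. Qed.

Lemma approx_close Q : `|F Q - u Q| <= e * m Q.
Proof.
apply: (@stop_close _ _ _ _ _ _ _ _ (wavg D g)) => //.
- by move=> P; exact: (uavg_le D p1 gLp).
- by move=> P; exact: (wavg_le_maxavg D p1 gLp).
Qed.

Lemma approx_le Q : `|F Q| <= 2 * m Q.
Proof.
apply: (@stop_le _ _ _ _ _ _ _ _ (wavg D g)) => //.
- by move=> P; exact: (uavg_le D p1 gLp).
- by move=> P; exact: (wavg_le_maxavg D p1 gLp).
Qed.

Lemma sum_vjump_approx P M :
  \sum_(k < M) iter k.+1 avg (vjump D F) P <= (8 + N) / e * Z P.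
Proof.
rewrite mulrAC ler_pdivlMr// mulrC.
apply: le_trans (_ : (8 + N) * iter M avg m P <= _); last first.
  by rewrite ler_wpM2l ?addr_ge0 ?(ltW N0)//; exact: (iter_maxavg_le D hn p1 gLp).
apply: (@sum_vjump_stop _ _ _ _ _ _ _ _ (wavg D g)) => //.
- by move=> Q; exact: (avg_uavg D p1 gLp).
- by move=> Q; exact: (avg_wavg D p1 gLp).
- by move=> Q; exact: (uavg_le D p1 gLp).
- by move=> Q; exact: (wavg_le_maxavg D p1 gLp).
- by move=> Q; exact: (maxavg_par D p1 gLp).
- by move=> Q; exact: (maxavg_step D p1 gLp).
Qed.

Lemma approx_bounded (j : int) : exists M : R, forall Q, Q.1 <= j -> `|F Q| <= M.
Proof.
have [M HM] := maxavg_bounded D p1 gLp j; exists (2 * M) => Q Qj.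
by rewrite (le_trans (approx_le Q))// ler_wpM2l// HM.
Qed.

Lemma approx_le_Z Q : `|F Q| <= 2 * Z Q.
Proof.
rewrite (le_trans (approx_le Q))// ler_wpM2l//.
exact: (maxavg_Mavg D hn p1 gLp).
Qed.

Let T0 : 0 <= (8 + N) / e.
Proof. by rewrite divr_ge0 ?(ltW e0)// addr_ge0// ltW. Qed.

Let Z0 Q : 0 <= Z Q. Proof. exact: (Mavg_ge0 D hn p1 gLp). Qed.

Definition gradient_measure : vmeasure R n := jump_vmeasure D approx_bounded.

(** The top face of [P] itself lies on the boundary of the Carleson box,
    which does not contain it. *)
Definition inner_vjump P Q : R := if Q == P then 0 else vjump D F Q.

Lemma sum_inner_vjump P M :
  \sum_(k < M) iter k avg (inner_vjump P) P <= (8 + N) / e * Z P.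
Proof.
case: M => [|M]; first by rewrite big_ord0 mulr_ge0.
rewrite big_ord_recl /= {1}/inner_vjump eqxx add0r.
apply: le_trans (sum_vjump_approx P M); apply: ler_sum => k _.
apply: (@le_iter_avg _ _ _ k.+1) => Q _; rewrite /inner_vjump.
by case: ifP => // _; exact: vjump_ge0.
Qed.

(** Only faces in the interior of the open box count: for lateral faces both
    adjacent regions lie below [P], and for horizontal ones the region lies
    strictly below [P]. *)
Lemma mass_dcarleson P o :
  (mass D F o (dcarleson D P) <= (dvol R P * (4 * ((8 + N) / e * Z P)))%:E)%E.
Proof.
set B := 4 * _.
have S0 : 0 <= (8 + N) / e * Z P by rewrite mulr_ge0.
have gen_le_widx z : 0 < z.1 -> z.1 < dside R P -> P.1 <= (widx D z).1.
  by move=> z0 zP; apply: gen_ge => //; exact: ltW.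
have -> : dvol R P * B = \sum_(v : unit) dvol R P * B by rewrite big_const card_unit /= addr0.
case: o => [i|].
- apply: (@mass_le _ _ _ _ _ _ _ (fun=> P) (fun=> hjump_inside D F i P)).
  + by move=> _ Q; rewrite /hjump_inside; case: ifP => // _; exact: hjump_ge0.
  + move=> z z0 [/= /andP[_ zP] Pz]; exists tt.
    have PQ := gen_le_widx z z0 zP.
    have b1 : below D P (widx D z).
      have := below_locate PQ (locate_face D (Some i) z).
      by rewrite (dcube_locate Pz).
    have b2 := below_left_face PQ Pz.
    split; last by rewrite /hjump_inside asboolT.
    split; first by rewrite /= in_itv/= z0 ltW.
    by apply: hcube_below b1 _; exact: widx_hcube.
  + move=> _ [|M]; first by rewrite big_ord0 mulr_ge0.
    apply: le_trans (sum_hjump_inside D F i P M) _.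
    by rewrite ler_wpM2l// sum_vjump_approx.
- apply: (@mass_le _ _ _ _ _ _ _ (fun=> P) (fun=> inner_vjump P)).
  + by move=> _ Q; rewrite /inner_vjump; case: ifP => // _; exact: vjump_ge0.
  + move=> z z0 [/= /andP[_ zP] Pz]; exists tt.
    have /andP[_ zQ] := widx_side D z0.
    split; first by split; [rewrite /= in_itv/= z0 (le_trans zQ)// ltW|exact: dcube_sub_hcube].
    rewrite /inner_vjump /vjump distrC; case: eqP => // E.
    by move: zP; rewrite E ltxx.
  + move=> _ M; apply: le_trans (sum_inner_vjump P M) _.
    by rewrite /B ler_peMl// ler1n.
Qed.

Lemma CD_approx x : (CD D gradient_measure x <=
  (n.+1%:R * (4 * ((8 + N) / e)))%:E * MD D Mg x)%E.
Proof.
have c0 : 0 <= n.+1%:R * (4 * ((8 + N) / e)) :> R.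
  by rewrite mulr_ge0// mulr_ge0.
apply: ge_ereal_sup => _ [[P Px ->]|->]; last first.
  by rewrite mule_ge0 ?lee_fin// MD_ge0.
apply: (@le_trans _ _ (n.+1%:R * (4 * ((8 + N) / e)) * Z P)%:E); last first.
  rewrite EFinM lee_wpmul2l ?lee_fin//; exact: (Mavg_MD hn p1 gLp).
have v0 := dvol_gt0 R P.
rewrite vol_dcube lee_pdivrMl//.
apply: le_trans (total_variation_jump _ _ _) _.
  by apply: measurable_carleson; exact: measurable_dcube.
apply: le_trans (lee_sum _ (fun o _ => mass_dcarleson P o)) _.
rewrite sumEFin lee_fin sumr_const card_option card_ord -mulr_natl.
by rewrite le_eqVlt; apply/orP; left; apply/eqP; ring.
Qed.

(** A cube of side [l] is contained in the union of the [3 ^ n] dyadic cubes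
    adjacent to that of [x] at the scale [2^-j / 2 < l <= 2^-j], each of
    which has [x] in its dilate by [5].  The faces on the boundary of the
    tents count: the lateral ones are controlled by the vertical jumps in the
    neighbouring tents, which remain near [x], and by the jumps of the
    largest cubes, which are at most [4 * z0]. *)
Lemma mass_carleson a l x o (z0 : R) : 0 < l -> cube a l x ->
  mstar D Mg x = z0%:E ->
  (mass D F o (carleson l (cube a l)) <=
    (3 ^+ n * 2 ^+ n * l ^+ n * (7 * ((8 + N) / e * z0)))%:E)%E.
Proof.
move=> l0 xa Ez; pose j := gen l.
have /andP[jl lj] := gen_bounds l0; rewrite -/j in jl lj.
set L := 2 ^ (- j) in jl lj.
have Zx P : near_cube P (locate D j x) -> Z P <= z0.
  by move=> Px; rewrite -lee_fin -Ez; exact: mstar_ge Px.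
have z00 : 0 <= z0 by apply: le_trans (Zx _ (near_cube_refl _)).
set T := (8 + N) / e; have T0' : 0 <= T by exact: T0.
have T8 : 8 <= T.
  have /andP[_ e1] := e01; rewrite /T ler_pdivlMr//.
  apply: (@le_trans _ _ 8); last by rewrite lerDl ltW.
  by rewrite ger_pMr// ltW.
pose P v := nbr (adj v) (locate D j x).
pose B := 7 * (T * z0).
have B0 : 0 <= B by rewrite mulr_ge0// mulr_ge0.
have Tz : 8 * z0 <= T * z0 by rewrite ler_wpM2r.
have TZ Q : Z Q <= z0 -> T * Z Q <= T * z0 by move=> h; rewrite ler_wpM2l.
have cov z : 0 < z.1 -> carleson l (cube a l) (face D o z) -> z.1 < l ->
    exists v, tent D (P v) z.
  move=> z0' [_ za] zl.
  have [|v Ev] := @adjP _ _ D j x (face D o z).2.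
    by move=> k; exact: (cube_dist k xa za lj).
  exists v; rewrite /P -Ev.
  have jQ : j <= (widx D z).1 by apply: gen_ge => //; rewrite ltW// (lt_le_trans zl).
  split; first by rewrite /= in_itv/= z0' /= (le_trans (ltW zl)).
  apply: hcube_below (widx_hcube D z).
  exact: below_locate jQ (locate_face D o z).
have sumP : (\sum_v dvol R (P v) * B <= 3 ^+ n * 2 ^+ n * l ^+ n * B).
  rewrite (eq_bigr (fun=> L ^+ n * B))// sumr_const card_ffun !card_ord -mulrnAl ler_wpM2r//.
  rewrite -mulr_natl natrX -mulrA ler_wpM2l ?exprn_ge0// -exprMn.
  have l2 : L <= 2 * l by move: jl; lra.
  by apply: lerXn2r l2; rewrite nnegrE ?mulr_ge0 ?ltW ?pow2_gt0.
apply: le_trans (_ : (\sum_v dvol R (P v) * B)%:E <= _)%E; last by rewrite lee_fin.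
have vj v M : \sum_(k < M) iter k.+1 avg (vjump D F) (P v) <= T * z0.
  by apply: le_trans (sum_vjump_approx _ _) _; apply: TZ; apply: Zx; exact: adj_near.
case: o cov => [i|] cov.
- apply: (@mass_le _ _ _ _ _ _ _ P (fun=> hjump F i)).
  + by move=> _ Q; exact: hjump_ge0.
  + move=> z z0' Ez'; have zl : z.1 < l by case: Ez' => /= /andP[].
    by have [v tv] := cov z z0' Ez' zl; exists v.
  + move=> v [|M]; first by rewrite big_ord0.
    apply: le_trans (sum_hjump D F i (P v) M) _.
    have vj' : \sum_(k < M) iter k.+1 avg (vjump D F) (nbr (step false i) (P v)) <= T * z0.
      apply: le_trans (sum_vjump_approx _ _) _.
      by apply: TZ; apply: Zx; exact: adj_left_near.
    have hj : hjump F i (P v) <= 4 * z0.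
      apply: le_trans (ler_normB _ _) _.
      have := approx_le_Z (P v); have := approx_le_Z (nbr (step false i) (P v)).
      have := Zx _ (adj_near v (locate D j x)).
      have := Zx _ (adj_left_near v i (locate D j x)); rewrite -/(P v).
      by lra.
    by have := vj v M; rewrite /B; move: vj' hj Tz; lra.
- apply: (@mass_le _ _ _ _ _ _ _ P (fun=> vjump D F)).
  + by move=> _ Q; exact: vjump_ge0.
  + move=> z z0' Ez'; have /andP[_ zQ] := widx_side D z0'.
    have zl : z.1 < l by case: Ez' => /= /andP[_ h] _; exact: le_lt_trans h.
    by have [v tv] := cov z z0' Ez' zl; exists v; split => //; rewrite /vjump distrC.
  + move=> v [|M]; first by rewrite big_ord0.
    rewrite big_ord_recl /=.
    have hj : vjump D F (P v) <= 4 * z0.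
      apply: le_trans (ler_normB _ _) _.
      have := approx_le (P v); have := approx_le (par (P v)).
      have := maxavg_par D p1 gLp (P v); have := maxavg_Mavg D hn p1 gLp (P v).
      have := Zx _ (adj_near v (locate D j x)); rewrite -/(P v).
      by lra.
    by have := vj v M; rewrite /B /=; move: hj Tz; lra.
Qed.

Lemma CT_approx x : (CT gradient_measure x <=
  (n.+1%:R * (3 ^+ n * 2 ^+ n) * (7 * ((8 + N) / e)))%:E * mstar D Mg x)%E.
Proof.
set c := n.+1%:R * _ * _.
have c0 : 0 < c.
  by rewrite /c !mulr_gt0// ?exprn_gt0// ?invr_gt0 ?addr_gt0.
have S0 : (0 <= mstar D Mg x)%E.
  apply: le_trans (mstar_ge (D := D) _ (near_cube_refl (locate D 0 x))).
  by rewrite lee_fin; exact: Z0.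
apply: ge_ereal_sup => _ [[a [l [l0 xa ->]]]|->]; last by rewrite mule_ge0// lee_fin ltW.
have [E|fin] := eqVneq (mstar D Mg x) +oo%E; first by rewrite E gt0_muley ?lte_fin// leey.
have Ez : mstar D Mg x = (fine (mstar D Mg x))%:E.
  by rewrite fineK// ge0_fin_numE// lt_neqAle fin leey.
set z0 := fine _ in Ez; rewrite Ez.
have [mc ->] := leb_cube (n := n) a l0.
rewrite lee_pdivrMl ?exprn_gt0//.
apply: le_trans (total_variation_jump _ _ _) _; first exact: measurable_carleson.
apply: le_trans (lee_sum _ (fun o _ => mass_carleson o l0 xa Ez)) _.
rewrite sumEFin -!EFinM lee_fin sumr_const card_option card_ord -[X in X <= _]mulr_natl.
by rewrite le_eqVlt /c; apply/orP; left; apply/eqP; ring.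
Qed.

End approximation.

(** * Pointwise and norm estimates *)

Lemma negligible_bigcup_count d (T : measurableType d) (R : realType)
    (mu : {measure set T -> \bar R}) (I : countType) (E : I -> set T) :
  (forall i, mu.-negligible (E i)) -> mu.-negligible (\bigcup_i E i).
Proof.
move=> hE; apply: (@negligibleS _ _ _ _
    (\bigcup_k (if unpickle k is Some i then E i else set0))).
  by move=> x [i _ Ex]; exists (pickle i) => //; rewrite pickleK.
apply: negligible_bigcup => k; case: unpickle => [i|]; first exact: hE.
exact: negligible_set0.
Qed.

Section almost_everywhere.
Context (R : realType) (n : nat) (D : dyadic_system R n).
Implicit Types (P Q : dindex n) (x : 'rV[R]_n) (z : R1n R n).

(** The open Whitney regions have full measure in the half-open ones. *)
Lemma whitney_ae :
  {ae leb1 n, forall z, 0 < z.1 -> dwhitney D (widx D z) z}.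
Proof.
have wE Q : dwhitney D Q = `]dside R Q / 2, dside R Q[%classic `*` dcube D Q.
  by apply/seteqP; split => -[t x] [/= h Qx]; split => //; move: h; rewrite /= in_itv.
have mW Q : measurable (dwhitney D Q).
  rewrite wE; apply: measurableX; first exact: measurable_itv.
  exact: measurable_dcube.
have WE Q : leb1 n (dwhitney D Q) = (dside R Q / 2 * dvol R Q)%:E.
  rewrite wE /leb1 [LHS]product_measure1E; last 2 first.
  - exact: measurable_itv.
  - exact: measurable_dcube.
  have s0 := side_gt0 R Q.
  have SE : lebesgue_measure `]dside R Q / 2, dside R Q[%classic = (dside R Q / 2)%:E.
    rewrite lebesgue_measure_itv /= lte_fin.
    by rewrite ifT -?EFinB; [congr EFin|]; lra.
  by rewrite [X in (X * _)%E]SE leb_dcube -EFinM.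
have Wsub Q : dwhitney D Q `<=` slab D 0 Q.
  move=> [t x] [/andP[h1 h2] Qx]; split; last exact: dcube_sub_hcube.
  by rewrite /= addr0 /strip /= in_itv/= h1 ltW.
apply: (@negligibleS _ _ _ _ (\bigcup_Q (slab D 0 Q `\` dwhitney D Q))).
  move=> [t x] /not_implyP[t0 nW]; exists (widx D (t, x)) => //; split => //.
  by split; [rewrite addr0; apply/stripP|exact: widx_hcube].
apply: negligible_bigcup_count => Q; apply/negligibleP.
  by apply: measurableD; [exact: measurable_slab|exact: mW].
rewrite measureD//; [|exact: measurable_slab|].
  rewrite setIidr; last exact: Wsub.
  by rewrite [X in (X - _)%E]leb1_slab [X in (_ - X)%E]WE subee.
by rewrite [X in (X < _)%E]leb1_slab ltry.
Qed.

Lemma dcube_ae : {ae leb n, forall x, forall j, dcube D (locate D j x) x}.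
Proof.
apply: (@negligibleS _ _ _ _ (\bigcup_Q (hcube D Q `\` dcube D Q))).
  by move=> x /existsNP[j nQ]; exists (locate D j x) => //; split => //; exact: hcube_locate.
apply: negligible_bigcup_count => Q; apply/negligibleP; last exact: leb_boundary.
by apply: measurableD; [exact: measurable_hcube|exact: measurable_dcube].
Qed.

Lemma leb1_gt0 : (0 < leb1 n [set: R1n R n])%E.
Proof.
pose Q : dindex n := (0, 0).
apply: (@lt_le_trans _ _ (leb1 n (slab D 0 Q))).
  rewrite [ltRHS]leb1_slab lte_fin mulr_gt0 ?dvol_gt0// divr_gt0 ?side_gt0//.
by apply: le_measure => //; rewrite inE; [exact: measurable_slab|exact: measurableT].
Qed.

Lemma enorm_ge x k : `|x 0 k| <= enorm x.
Proof.
rewrite /enorm -sqrtr_sqr.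
have s0 : 0 <= \sum_i x 0 i ^+ 2 by apply: sumr_ge0 => i _; exact: sqr_ge0.
by rewrite ler_sqrt// (bigD1 k)//= lerDl sumr_ge0// => i _; exact: sqr_ge0.
Qed.

Lemma NT_ge0 f x : (0 <= NT f x :> \bar R)%E.
Proof.
by apply: ess_sup_gee; [exact: leb1_gt0|apply: aeW => z; rewrite lee_fin mulr_ge0].
Qed.

Lemma CT_ge0 (mu : vmeasure R n) x : (0 <= CT mu x)%E.
Proof. by apply: ereal_sup_ubound; right. Qed.

End almost_everywhere.

Section closeness.
Context (R : realType) (n : nat) (D : dyadic_system R n) (hn : (0 < n)%N).
Variables (p : R) (p1 : 1 < p) (g : 'rV[R]_n -> R).
Hypothesis gLp : g \in Lfun (leb n) p%:E.
Variables (Q0 : dindex n) (e : R).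
Hypothesis e01 : 0 < e < 1.
Implicit Types (P Q : dindex n) (x : 'rV[R]_n) (z : R1n R n).

Local Notation m := (maxavg D g).
Local Notation Mg := (MD D (EFin \o g)).
Local Notation F := (approx D hn g Q0 e).
Local Notation C := (maximal_constant n p).

Let e0 : 0 < e. Proof. by case/andP: e01. Qed.

Section extension.
Variable u : R1n R n -> R.
Hypothesis uext : is_dyadic_extension D g u.

Let fu z : dwhitney D (widx D z) z -> `|F (widx D z) - u z| <= e * m (widx D z).
Proof.
move=> Wz; rewrite (uext Wz) (uavgE D p1 gLp).
exact: (approx_close D hn p1 gLp Q0 e01).
Qed.

Lemma ND_approx x :
  (ND D (fun z => (F (widx D z) - u z)%R) x <= e%:E * Mg x)%E.
Proof.
apply: ge_ereal_sup => _ [[Q [z [Qx Wz ->]]]|->]; last first.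
  by rewrite mule_ge0 ?MD_ge0// lee_fin ltW.
have [_ zQ] := dwhitney_widx Wz; rewrite -zQ in Wz Qx.
apply: (@le_trans _ _ (e * m (widx D z))%:E); first by rewrite lee_fin fu.
by rewrite EFinM lee_wpmul2l ?lee_fin ?(ltW e0)//; exact: (maxavg_MD p1 gLp).
Qed.

(** A point of the cone at height [t] is less than [t] away from [x], hence
    its cube is adjacent to that of [x] at the same scale. *)
Lemma NT_approx x :
  (NT (fun z => (F (widx D z) - u z)%R) x <= e%:E * mstar D (absg g) x)%E.
Proof.
have S0 : (0 <= mstar D (absg g) x)%E.
  apply: le_trans (maxavg_mstar p1 gLp (near_cube_refl (locate D 0 x))).
  by rewrite lee_fin (maxavg_ge0 D p1 gLp).
apply/ess_supP; apply: filterS (@whitney_ae R n D) => z Wz.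
rewrite indicE; case: (boolP (z \in cone 1 x)); last first.
  by move=> _; rewrite mulr0 mule_ge0// lee_fin ltW.
rewrite inE mulr1 => -[z0 zx]; have {}Wz := Wz z0.
apply: (@le_trans _ _ (e * m (widx D z))%:E); first by rewrite lee_fin fu.
rewrite EFinM lee_wpmul2l ?lee_fin ?(ltW e0)//.
have /andP[_ zs] := widx_side D z0.
have [|v Ev] := @adjP _ _ D (gen z.1) x z.2.
  move=> k; apply: (@lt_le_trans _ _ z.1); last exact: zs.
  rewrite mul1r in zx; apply: le_lt_trans zx.
  by have := enorm_ge (z.2 - x) k; rewrite !mxE.
rewrite /widx Ev; apply: (maxavg_mstar p1 gLp); exact: adj_near.
Qed.

Lemma Lp_norm_absg : Lp_norm p (absg g) = Lp_norm p (EFin \o g).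
Proof. exact: Lnorm_abse. Qed.

Lemma norm_NT_approx :
  (Lp_norm p (NT (fun z => (F (widx D z) - u z)%R)) <=
   (e * C)%:E * Lp_norm p (EFin \o g))%E.
Proof.
rewrite -Lp_norm_absg.
apply: (maximal_Lp_scaled (D := D)) => //.
- exact: (measurable_absg gLp).
- by move=> x; exact: abse_ge0.
- exact: (integral_absg p1 gLp).
- by move=> x; exact: NT_ge0.
- by move=> x; exact: NT_approx.
Qed.

End extension.

Lemma norm_CT_approx :
  (Lp_norm p (CT (gradient_measure D hn p1 gLp Q0 e01)) <=
   (n.+1%:R * (3 ^+ n * 2 ^+ n) * (7 * ((8 + 2 ^+ n) / e)) * C * C)%:E *
   Lp_norm p (EFin \o g))%E.
Proof.
set c := n.+1%:R * _ * _.
have c0 : 0 < c by rewrite /c !mulr_gt0// ?exprn_gt0// ?invr_gt0 ?addr_gt0 ?exprn_gt0.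
have C0 : 0 < C := maximal_constant_gt0 n p1.
apply: (@le_trans _ _ ((c * C)%:E * Lp_norm p Mg)%E).
  apply: (maximal_Lp_scaled (D := D)) => //.
  - exact: (measurable_Mg D p1 gLp).
  - by move=> x; exact: MD_ge0.
  - exact: (integral_Mg D hn p1 gLp).
  - by move=> x; exact: CT_ge0.
  - by move=> x; exact: CT_approx.
rewrite [(c * C * C)%:E]EFinM -muleA lee_wpmul2l//.
  by rewrite lee_fin ltW// mulr_gt0.
exact: (Lp_norm_Mg D hn p1 gLp).
Qed.

Lemma whitney_constant_approx : whitney_constant D (F \o widx D).
Proof.
move=> Q z z' Wz Wz' /=.
by have [_ ->] := dwhitney_widx Wz; have [_ ->] := dwhitney_widx Wz'.
Qed.

End closeness.

(** * Boundary limits of functions of bounded variation *)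

Section summable_ae.
Context (R : realType) (n : nat) (D : dyadic_system R n).
Implicit Types (P Q : dindex n) (x : 'rV[R]_n) (v w : 'rV[int]_n).
Implicit Types (F h : dindex n -> R).
Local Notation locate := (locate D).
Local Notation avg := (avg D).

(** The integral over a cube of generation [0] of the sum of [h] over the
    smaller cubes around a point is the sum of the iterated averages, which
    is finite. *)
Lemma summable_ae h : (forall Q, 0 <= h Q) -> summable_below D h ->
  {ae leb n, forall x,
    cvgn [series h (locate k%:Z x)]_k}.
Proof.
move=> h0 hs.
have mh k : measurable_fun [set: 'rV[R]_n] (fun x => (h (locate k%:Z x))%:E).
  by apply/measurable_EFinP; exact: (@measurable_fun_locate _ _ D k%:Z).
pose S x : \bar R := (\sum_(k <oo) (h (locate k%:Z x))%:E)%E.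
have S0 x : (0 <= S x)%E by apply: nneseries_ge0 => k _ _; rewrite lee_fin.
have mS : measurable_fun [set: 'rV[R]_n] S.
  by apply: ge0_emeasurable_sum => // k x _ _; rewrite lee_fin.
pose Q (P : 'rV[int]_n) : dindex n := (0%R, P).
have Sfin (P : 'rV[int]_n) : (leb n).-integrable (hcube D (Q P)) S.
  have mP : measurable (hcube D (Q P)) by exact: measurable_hcube.
  apply/integrableP; split; first exact: measurable_funTS.
  under eq_integral do rewrite gee0_abs//.
  have [B HB] := hs (Q P).
  apply: (@le_lt_trans _ _ (dvol R (Q P) * B)%:E); last exact: ltry.
  rewrite integral_nneseries//; last 2 first.
  - by move=> k; exact: measurable_funTS.
  - by move=> k x _; rewrite lee_fin.
  apply: lime_le.
    by apply: is_cvg_nneseries => k _ _; apply: integral_ge0 => x _; rewrite lee_fin.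
  near=> M.
  have E k : (\int[leb n]_(x in hcube D (Q P)) (h (locate k%:Z x))%:E =
      (dvol R (Q P) * iter k avg h (Q P))%:E)%E.
    by rewrite -integral_hcube_locate//= add0r.
  rewrite (eq_bigr _ (fun k _ => E k)) sumEFin lee_fin -mulr_sumr.
  by rewrite ler_pM2l ?dvol_gt0// big_mkord.
apply: (@negligibleS _ _ _ _ (\bigcup_P (hcube D (Q P) `&` [set x | ~ S x \is a fin_num]))).
  move=> x ncv; exists ((locate 0 x).2) => //; split; first exact: hcube_locate.
  move=> /= Sx; apply: ncv; apply: nondecreasing_is_cvgn.
    by apply/nondecreasing_seqP => k; rewrite /series /= big_nat_recr//= lerDl.
  exists (fine (S x)) => _ [k _ <-]; rewrite -lee_fin fineK// seriesEnat /= -sumEFin.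
  by apply: nneseries_lim_ge => j _ _; rewrite lee_fin.
apply: negligible_bigcup_count => P; have := integrable_ae (measurable_hcube D (Q P)) (Sfin P).
by apply: negligibleS => x [Px nS] /(_ Px).
Unshelve. all: by end_near. Qed.

Lemma cvg0_ae h : (forall Q, 0 <= h Q) -> summable_below D h ->
  {ae leb n, forall x, h (locate k%:Z x) @[k --> \oo] --> 0}.
Proof.
move=> h0 hs; apply: filterS (summable_ae h0 hs) => x.
exact: cvg_series_cvg_0.
Qed.

(** Along almost every branch the vertical jumps are summable. *)
Lemma limit_ae F : summable_below D (vjump D F) ->
  {ae leb n, forall x, cvgn (fun k => F (locate k%:Z x))}.
Proof.
move=> hs; apply: filterS (summable_ae (vjump_ge0 D F) hs) => x cx.
pose c (k : nat) := F (locate (k%:Z - 1) x).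
have cE k : c k.+1 = F (locate k%:Z x).
  by rewrite /c; congr (F (locate _ _)); lia.
have tc : cvgn (series (telescope c)).
  have E : [normed series (telescope c)] = [series vjump D F (locate k%:Z x)]_k.
    congr series; apply/funext => k.
    rewrite -[LHS]/(`|c k.+1 - c k|) -[RHS]/(vjump D F (locate k%:Z x)).
    by rewrite /vjump par_locate cE.
  by apply: normed_cvg; rewrite E.
move: tc; rewrite telescopeK => /cvg_ex[/= l cl]; apply/cvg_ex; exists (l + c 0%N).
have -> : (fun k : nat => F (locate k%:Z x)) = (fun k => c k.+1).
  by apply/funext => k; rewrite cE.
suff : c k @[k --> \oo] --> l + c 0%N by rewrite -(cvg_shiftS c).
have : c k - c 0%N + c 0%N @[k --> \oo] --> l + c 0%N.
  by apply: cvgD; [exact: cl|exact: cvg_cst].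
by under eq_fun do rewrite subrK.
Qed.

Definition shift_diff F v Q : R := `|F (nbr v Q) - F Q|.

Lemma summable_shift_diff F : (forall i, summable_below D (hjump F i)) ->
  forall v, summable_below D (shift_diff F v).
Proof.
move=> hs.
have le_sb h h' : (forall Q, h Q <= h' Q) -> summable_below D h' -> summable_below D h.
  move=> hh' H P; have [B HB] := H P; exists B => M; apply: le_trans (HB M).
  by apply: ler_sum => k _; apply: le_iter_avg => Q _.
have st s i : summable_below D (shift_diff F (step s i)).
  case: s; last by apply: (le_sb _ (hjump F i)) => // Q; rewrite /shift_diff distrC.
  apply: (le_sb _ (hjump F i \o nbr (step true i))).
    move=> Q; rewrite /shift_diff /hjump /= le_eqVlt; apply/orP; left; apply/eqP.
    by congr (`|_ - F _|); case: Q => j k; rewrite /nbr /= addrK.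
  by apply: summable_below_nbr => // Q; exact: hjump_ge0.
have sD h h' : summable_below D h -> summable_below D h' ->
    summable_below D (fun Q => h Q + h' Q).
  move=> H H' P; have [B HB] := H P; have [B' HB'] := H' P; exists (B + B') => M.
  under eq_bigr do rewrite iter_avgD; rewrite big_split /=.
  exact: lerD (HB M) (HB' M).
have sum v w : summable_below D (shift_diff F v) -> summable_below D (shift_diff F w) ->
    summable_below D (shift_diff F (v + w)).
  move=> Hv Hw.
  apply: (le_sb _ (fun Q => (shift_diff F w \o nbr v) Q + shift_diff F v Q)).
    move=> Q; rewrite /shift_diff /=.
    have -> : nbr (v + w) Q = nbr w (nbr v Q) by rewrite /nbr /= addrA.
    by apply: le_trans (ler_normD _ _); rewrite subrKA.
  apply: (sD (shift_diff F w \o nbr v)) => //; apply: summable_below_nbr => // Q.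
  exact: normr_ge0.
have z0 : summable_below D (shift_diff F 0).
  apply: (le_sb _ (fun=> 0)).
    by move=> -[j k]; rewrite /shift_diff /nbr /= addr0 subrr normr0.
  move=> P; exists 0 => M; rewrite big1// => k _.
  by apply: iter_avg_martingale => Q; exact: avg_cst.
have stn s i m : summable_below D (shift_diff F (step s i *+ m)).
  by elim: m => [|m IH]; rewrite ?mulr0n// mulrS; exact: sum.
move=> v; rewrite (row_sum_delta v).
elim/big_ind : _ => [//|v1 v2 H1 H2|i _]; first exact: sum.
case: (v 0 i) => m.
  have -> : m%:Z *: delta_mx 0 i = step true i *+ m.
    by rewrite /step -scaler_nat natz.
  exact: stn.
have -> : Negz m *: delta_mx 0 i = step false i *+ m.+1.
  by rewrite /step NegzE scaleNr -scaler_nat natz scalerN.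
exact: stn.
Qed.

(** A translation is a succession of unit ones, hence the differences are
    sums of translated lateral jumps; a summable sequence tends to [0]. *)
Lemma all_shifts_ae F : (forall i, summable_below D (hjump F i)) ->
  {ae leb n, forall x, forall v,
    F (nbr v (locate k%:Z x)) - F (locate k%:Z x) @[k --> \oo] --> 0}.
Proof.
move=> hs; apply: (@negligibleS _ _ _ _ (\bigcup_v
   [set x | ~ (shift_diff F v (locate k%:Z x) @[k --> \oo] --> 0)])).
  move=> x /existsNP[v nv]; exists v => // cv; apply: nv; apply: norm_cvg0.
  exact: cv.
apply: negligible_bigcup_count => v; apply: cvg0_ae; last exact: summable_shift_diff.
by move=> Q; exact: normr_ge0.
Qed.

End summable_ae.

Section nontangential.
Context (R : realType) (n : nat) (D : dyadic_system R n).
Implicit Types (P Q : dindex n) (x : 'rV[R]_n) (v : 'rV[int]_n).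
Local Notation locate := (locate D).

(** In a cone of aperture [alpha] the cube of a point at a given height is a
    translate of the cube of [x] by a vector with entries bounded in terms of
    [alpha]; there are finitely many of these, so that the convergence is
    uniform over them. *)
Lemma nontangential F x (l alpha : R) : 0 < alpha ->
  F (locate k%:Z x) @[k --> \oo] --> l ->
  (forall v, F (nbr v (locate k%:Z x)) - F (locate k%:Z x) @[k --> \oo] --> 0) ->
  nontangential_limit alpha (F \o widx D) x l.
Proof.
move=> a0 Fl Fv; apply/cvgrPdist_lt => eps eps0.
have e2 : 0 < eps / 2 by rewrite divr_gt0.
(* the extra unit accounts for the positions of the two points in their cubes *)
pose A := (Num.bound alpha).+1.
pose sh (w : {ffun 'I_n -> 'I_(A.*2.+1)}) : 'rV[int]_n :=
  \row_i ((w i : nat)%:Z - A%:Z).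
have [K1 _ HK1] : \forall k \near \oo, `|l - F (locate k%:Z x)| < eps / 2.
  by move/cvgrPdist_lt : Fl; exact.
have HK w : {K | forall k, (K <= k)%N ->
    `|F (nbr (sh w) (locate k%:Z x)) - F (locate k%:Z x)| < eps / 2}.
  apply: cid; have : \forall k \near \oo,
     `|0 - (F (nbr (sh w) (locate k%:Z x)) - F (locate k%:Z x))| < eps / 2.
    by move/cvgrPdist_lt : (Fv (sh w)); exact.
  by move=> [K _ HK]; exists K => k Kk; rewrite -normrN -sub0r; exact: HK.
pose K := maxn K1 (\max_w sval (HK w)).
have near0 : \forall z \near nbhs ((0, x) : R1n R n), z.1 < 2 ^ (- K%:Z).
  have : (fun z : R1n R n => z.1 : R) z @[z --> nbhs ((0, x) : R1n R n)] --> (0 : R).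
    exact: cvg_fst.
  move/cvgrPdist_lt => /(_ (2 ^ (- K%:Z)) (pow2_gt0 R _)); apply: filterS => z.
  by rewrite sub0r normrN => /(le_lt_trans (ler_norm _)).
rewrite /within /=; apply: filterS near0 => z zK [z0 zx].
have Kz : K%:Z <= gen z.1 by apply: gen_ge => //; exact: ltW.
have /andP[_ zs] := gen_bounds z0.
have [k kE] : exists k : nat, gen z.1 = k%:Z.
  by exists `|gen z.1|%N; move: Kz; clear; lia.
rewrite kE in Kz zs; have {}Kz : (K <= k)%N by move: Kz; clear; lia.
have [w Ew] : exists w, locate k%:Z z.2 = nbr (sh w) (locate k%:Z x).
  exists [ffun i => inord `|((locate k%:Z z.2).2 0 i - (locate k%:Z x).2 0 i + A%:Z)%R|%N].
  rewrite /nbr; congr pair; apply/rowP => i.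
  rewrite [in RHS]mxE [X in _ + X]mxE ffunE.
  set b := (locate k%:Z z.2).2 0 i; set a := (locate k%:Z x).2 0 i.
  have [h1 h2] : - A%:Z <= b - a /\ b - a <= A%:Z.
    have /andP[a1 a2] : a%:~R <= (x 0 i - dorigin D k%:Z 0 i) * 2 ^ k%:Z < a%:~R + 1.
      by rewrite /a /= mxE; exact: floor_bounds.
    have /andP[b1 b2] : b%:~R <= (z.2 0 i - dorigin D k%:Z 0 i) * 2 ^ k%:Z < b%:~R + 1.
      by rewrite /b /= mxE; exact: floor_bounds.
    have : `|(z.2 0 i - x 0 i) * 2 ^ k%:Z| < (Num.bound alpha)%:R.
      apply: lt_trans (archi_boundP (ltW a0)).
      rewrite normrM (gtr0_norm (pow2_gt0 R k)) -ltr_pdivlMr ?pow2_gt0// -pow2N.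
      have := enorm_ge (z.2 - x) i; rewrite !mxE => /le_lt_trans; apply.
      by rewrite (lt_le_trans zx)// ler_pM2l.
    rewrite mulrBl ltr_norml => /andP[d1 d2].
    have e1 : (b - a)%:~R < (A%:Z + 1)%:~R :> R.
      rewrite intrB intrD /A -pmulrn -natr1; move: a1 b1 a2 b2 d1 d2; rewrite !mulrBl; clear; lra.
    have e3 : (- (A%:Z + 1))%:~R < (b - a)%:~R :> R.
      rewrite intrN intrB intrD /A -pmulrn -natr1; move: a1 b1 a2 b2 d1 d2; rewrite !mulrBl; clear; lra.
    by move: e1 e3; rewrite !ltr_int; clear; lia.
  by rewrite inordK; move: h1 h2; clear; lia.
rewrite /= /widx kE Ew.
have k1 : `|l - F (locate k%:Z x)| < eps / 2.
  by apply: HK1; rewrite /= (leq_trans _ Kz)// leq_maxl.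
have k2 : `|F (nbr (sh w) (locate k%:Z x)) - F (locate k%:Z x)| < eps / 2.
  apply: (svalP (HK w)); rewrite (leq_trans _ Kz)// leq_max; apply/orP; right.
  exact: (leq_bigmax w).
rewrite [eps]splitr; apply: le_lt_trans (ltrD k1 k2).
rewrite -(subrKA (F (locate k%:Z x))); apply: le_trans (ler_normD _ _) _.
by rewrite lerD2l distrC.
Qed.

End nontangential.

(** * Lebesgue differentiation *)

Section limit_function.
Context (R : realType) (n : nat) (D : dyadic_system R n).
Implicit Types (P Q : dindex n) (x : 'rV[R]_n) (F : dindex n -> R).
Local Notation locate := (locate D).

(** The upper limit makes this function measurable everywhere, and it is the
    limit wherever the sequence converges. *)
Definition lim_locate F x : R := fine (limn_esup (fun k => (F (locate k%:Z x))%:E)).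

Lemma measurable_lim_locate F : measurable_fun [set: 'rV[R]_n] (lim_locate F).
Proof.
apply: (measurableT_comp (@fine_measurable R setT measurableT)).
apply: (@measurable_fun_limn_esup _ _ _ _ (fun (k : nat) x => (F (locate k%:Z x))%:E)).
by move=> k; apply/measurable_EFinP; exact: (@measurable_fun_locate _ _ D k%:Z).
Qed.

Lemma cvg_lim_locate F x : cvgn (fun k => F (locate k%:Z x)) ->
  F (locate k%:Z x) @[k --> \oo] --> lim_locate F x.
Proof.
move=> /cvg_ex[/= l Fl].
have El : (F (locate k%:Z x))%:E @[k --> \oo] --> l%:E by apply: cvg_EFin => //; exact: nearW.
suff -> : lim_locate F x = l by [].
rewrite /lim_locate is_cvg_limn_esupE; last by apply/cvg_ex; exists l%:E.
by rewrite (cvg_lim _ El).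
Qed.

Lemma finite_ae (h : 'rV[R]_n -> \bar R) : measurable_fun [set: 'rV[R]_n] h ->
  (forall x, 0 <= h x)%E -> locally_finite_integral D h ->
  {ae leb n, forall x, h x \is a fin_num}.
Proof.
move=> mh h0 hfin.
apply: (@negligibleS _ _ _ _ (\bigcup_P (hcube D P `&` [set x | ~ h x \is a fin_num]))).
  by move=> x hx; exists (locate 0 x) => //; split => //; exact: hcube_locate.
apply: negligible_bigcup_count => P.
have iP : (leb n).-integrable (hcube D P) h.
  apply/integrableP; split; first exact: measurable_funTS.
  by under eq_integral do rewrite gee0_abs//; exact: hfin.
have := integrable_ae (measurable_hcube D P) iP.
by apply: negligibleS => x [Px nS] /(_ Px).
Qed.

(** A uniform limit of convergent sequences converges. *)
Lemma cvg_of_approximants (a : nat -> R) :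
  (forall eps, 0 < eps -> exists2 b : nat -> R, cvgn b &
     forall k, `|a k - b k| <= eps) -> cvgn a.
Proof.
move=> H; apply/cauchy_cvgP; apply: cauchy_exP => eps eps0.
have e2 : 0 < eps / 2 by rewrite divr_gt0.
have [b /cvg_ex[/= l bl] ab] := H _ e2; exists l.
move/cvgrPdist_lt : bl => /(_ _ e2); apply: filterS => k lb.
rewrite /ball /= -(subrKA (b k)); apply: le_lt_trans (ler_normD _ _) _.
by rewrite [eps]splitr ltr_leD// distrC.
Qed.

Section sigma_algebra.

Let G : set (set 'rV[R]_n) := [set A | A = set0 \/ exists Q, A = hcube D Q].
Let T := g_sigma_algebraType G.

Let mG Q : measurable (hcube D Q : set T).
Proof. by apply: sub_sigma_algebra; right; exists Q. Qed.

Let measurable_coord_G i : measurable_fun [set: T] (fun x : T => x 0 i : R).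
Proof.
apply: (measurability _ (RGenInftyO.measurableE R)) => _ [_ [c ->] <-].
rewrite setTI.
have -> : (fun x : T => x 0 i : R) @^-1` `]-oo, c[%classic =
    \bigcup_k \bigcup_(Q in [set Q | Q.1 = k%:Z /\ forall y, hcube D Q y -> y 0 i < c])
      hcube D Q.
  apply/seteqP; split => [x /=|x [k _ [Q [_ H] Qx]]]; last first.
    by rewrite /= in_itv/=; exact: H.
  rewrite in_itv/= => xc; have d0 : 0 < c - x 0 i by rewrite subr_gt0.
  have [k ke] := pow2_unbounded (c - x 0 i)^-1.
  exists k => //; exists (locate k%:Z x); last exact: hcube_locate.
  split => // y; rewrite hcubeE => /(_ i); rewrite /= in_itv/= => /andP[_ y2].
  have : hcube D (locate k%:Z x) x by exact: hcube_locate.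
  rewrite hcubeE => /(_ i); rewrite /= in_itv/= => /andP[x1 _].
  have : dside R (locate k%:Z x) < c - x 0 i.
    by rewrite /dside /= pow2N invf_plt ?posrE ?pow2_gt0.
  by move: y2 x1; clear; lra.
apply: bigcup_measurable => k _.
have -> : \bigcup_(Q in [set Q | Q.1 = k%:Z /\ forall y, hcube D Q y -> y 0 i < c])
      hcube D Q =
    \bigcup_m (if unpickle m is Some Q then
      (if `[< Q.1 = k%:Z /\ forall y, hcube D Q y -> y 0 i < c >] then hcube D Q else set0)
      else set0).
  apply/seteqP; split => [x [Q HQ Qx]|x [m _]].
    by exists (pickle Q) => [//|]; rewrite pickleK asboolT.
  by case: unpickle => // Q; case: asboolP => // HQ Qx; exists Q.
apply: bigcup_measurable => m _; case: unpickle => // Q.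
by case: asboolP => // _; exact: mG.
Qed.

(** Half-open dyadic cubes are a pi-system, because two of them are disjoint
    or nested, and they generate the Borel sets: a half-space bounded by a
    coordinate hyperplane is the union of the cubes that it contains. *)
Lemma hcube_measure_unique (m1 m2 : {measure set 'rV[R]_n -> \bar R}) :
  (forall Q, m1 (hcube D Q) = m2 (hcube D Q)) ->
  (forall Q, m1 (hcube D Q) < +oo)%E ->
  forall A, measurable A -> m1 A = m2 A.
Proof.
move=> E fin.
pose g (k : nat) := if unpickle k is Some Q then hcube D Q else set0.
apply: (@measure_unique _ _ _ G g).
- apply/seteqP; split => A mA.
    have mid : measurable_fun [set: T] (fun x : T => x : 'rV[R]_n).
      exact: measurable_fun_rV measurable_coord_G.
    by have := mid measurableT A mA; rewrite setTI.
  apply: (smallest_sub _ _ mA); first exact: sigma_algebra_measurable.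
  by move=> B [->//|[Q ->]]; exact: measurable_hcube.
- have sub P Q : P.1 <= Q.1 -> G (hcube D P `&` hcube D Q).
    move=> PQ; have [[k kQ]|nb] := pselect (below D P Q).
      right; exists Q; rewrite setIidr// => x Qx; rewrite -kQ; exact: hcube_anc.
    left; apply/seteqP; split => // x [Px Qx]; apply: nb.
    by rewrite -Px; apply: below_locate.
  move=> A B [->|[P ->]]; first by rewrite set0I; left.
  move=> [->|[Q ->]]; first by rewrite setI0; left.
  have [PQ|/ltW QP] := leP P.1 Q.1; first exact: sub.
  by rewrite setIC; exact: sub.
- by move=> k; rewrite /g; case: unpickle => [Q|]; [right; exists Q|left].
- apply/seteqP; split => // x _; exists (pickle (locate 0 x)) => //.
  by rewrite /g pickleK; exact: hcube_locate.
- by move=> A [->|[Q ->]]; rewrite ?measure0//.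
- by move=> k; rewrite /g; case: unpickle => [Q|]; rewrite ?measure0// ltry.
Qed.

End sigma_algebra.

Lemma ae_eq_of_hcubes (f g : 'rV[R]_n -> R) :
  measurable_fun [set: 'rV[R]_n] f -> measurable_fun [set: 'rV[R]_n] g ->
  (forall x, 0 <= f x) -> (forall x, 0 <= g x) ->
  locally_finite_integral D (EFin \o f) ->
  (forall Q, \int[leb n]_(x in hcube D Q) (f x)%:E =
             \int[leb n]_(x in hcube D Q) (g x)%:E)%E ->
  {ae leb n, forall x, f x = g x}.
Proof.
move=> mf mg f0 g0 ffin E.
have mid : measurable_fun [set: 'rV[R]_n] (@id 'rV[R]_n) by exact: measurable_id.
have E2 A : measurable A ->
    (\int[leb n]_(x in A) (f x)%:E = \int[leb n]_(x in A) (g x)%:E)%E.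
  apply: (@hcube_measure_unique
    [the {measure set _ -> \bar R} of wimage (leb n) mf f0 mid]
    [the {measure set _ -> \bar R} of wimage (leb n) mg g0 mid]).
  - exact: E.
  - exact: ffin.
apply: (@negligibleS _ _ _ _ (\bigcup_P (hcube D P `&` [set x | f x <> g x]))).
  by move=> x fg; exists (locate 0 x) => //; split => //; exact: hcube_locate.
apply: negligible_bigcup_count => P.
have iP : (leb n).-integrable (hcube D P) (EFin \o f).
  apply/integrableP; split; first exact/measurable_EFinP/measurable_funTS.
  by under eq_integral do rewrite gee0_abs ?lee_fin//; exact: ffin.
have := integral_ae_eq (measurable_hcube D P) iP
  (measurable_funTS ((measurable_EFinP _ _).2 mg)) (fun A _ mA => E2 A mA).
by apply: negligibleS => x [Px fg] /(_ Px) [].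
Qed.

End limit_function.

Section differentiation.
Context (R : realType) (n : nat) (D : dyadic_system R n) (hn : (0 < n)%N).
Variables (p : R) (p1 : 1 < p).
Implicit Types (P Q : dindex n) (x : 'rV[R]_n).
Local Notation locate := (locate D).

Section approximant.
Variable g : 'rV[R]_n -> R.
Hypothesis gLp : g \in Lfun (leb n) p%:E.
Variables (Q0 : dindex n) (e : R).
Hypothesis e01 : 0 < e < 1.
Local Notation Mg := (MD D (EFin \o g)).
Local Notation F := (approx D hn g Q0 e).
Local Notation Z := (Mavg D g).
Local Notation N := ((2 : R) ^+ n).

Let T0 : 0 <= (8 + N) / e.
Proof.
by have /andP[e0 _] := e01; rewrite divr_ge0 ?(ltW e0)// addr_ge0// exprn_ge0.
Qed.

Let Z0 P : 0 <= Z P. Proof. exact: (Mavg_ge0 D hn p1 gLp). Qed.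

Lemma summable_vjump_approx : summable_below D (vjump D F).
Proof.
move=> P; exists (vjump D F P + (8 + N) / e * Z P) => -[|M].
  by rewrite big_ord0 addr_ge0 ?vjump_ge0// mulr_ge0.
rewrite big_ord_recl /= lerD2l; apply: le_trans (sum_vjump_approx D hn p1 gLp Q0 e01 P M).
exact: lexx.
Qed.

Lemma summable_hjump_approx i : summable_below D (hjump F i).
Proof.
move=> P; exists (2 * hjump F i P + 4 * ((8 + N) / e * Z P) +
  2 * ((8 + N) / e * Z (nbr (step false i) P))) => -[|M].
  rewrite big_ord0; apply: addr_ge0; first apply: addr_ge0.
  - by rewrite mulr_ge0// hjump_ge0.
  - by rewrite mulr_ge0// mulr_ge0.
  - by rewrite mulr_ge0// mulr_ge0.
apply: le_trans (sum_hjump D F i P M) _.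
have h1 := sum_vjump_approx D hn p1 gLp Q0 e01 P M.
have h2 := sum_vjump_approx D hn p1 gLp Q0 e01 (nbr (step false i) P) M.
by rewrite lerD// ?lerD2l ler_pM2l.
Qed.

Lemma approx_limit_ae : {ae leb n, forall x, cvgn (fun k => F (locate k%:Z x))}.
Proof. exact: limit_ae summable_vjump_approx. Qed.

Lemma approx_nontangential alpha : 0 < alpha ->
  {ae leb n, forall x,
    nontangential_limit alpha (F \o widx D) x (lim_locate D F x)}.
Proof.
move=> a0; have := all_shifts_ae summable_hjump_approx; have := approx_limit_ae.
apply: filterS2 => x cx vx; apply: nontangential => //.
exact: cvg_lim_locate.
Qed.

Lemma approx_locate_close x k : dcube D (locate k%:Z x) x ->
  (`|F (locate k%:Z x) - uavg D g (locate k%:Z x)|%:E <= e%:E * Mg x)%E.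
Proof.
have /andP[e0 _] := e01.
move=> Px; apply: (@le_trans _ _ (e * maxavg D g (locate k%:Z x))%:E).
  by rewrite lee_fin; exact: (approx_close D hn p1 gLp Q0 e01).
by rewrite EFinM lee_wpmul2l ?lee_fin ?(ltW e0)//; exact: (maxavg_MD p1 gLp).
Qed.

End approximant.

(** The approximants converge almost everywhere along the branch of [x], and
    they are within [e * Mg x] of the averages, where [e] is arbitrary and
    [Mg x] is finite almost everywhere. *)
Lemma uavg_cvg_ae (g : 'rV[R]_n -> R) : g \in Lfun (leb n) p%:E ->
  {ae leb n, forall x, cvgn (fun k => uavg D g (locate k%:Z x))}.
Proof.
move=> gLp; pose e (N : nat) : R := N.+2%:R^-1.
have e01 N : 0 < e N < 1 by rewrite invr_gt0 ltr0n /= invf_lt1 ?ltr0n// ltr1n.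
pose Q0 : dindex n := (0, 0).
have cv : {ae leb n, forall x, forall N,
    cvgn (fun k => approx D hn g Q0 (e N) (locate k%:Z x))}.
  apply: (@negligibleS _ _ _ _ (\bigcup_N [set x |
      ~ cvgn (fun k => approx D hn g Q0 (e N) (locate k%:Z x))])).
    by move=> x /existsNP[N nN]; exists N.
  by apply: negligible_bigcup => N; exact: (approx_limit_ae gLp Q0 (e01 N)).
have fin := finite_ae (measurable_Mg D p1 gLp) (MD_ge0 D _) (Mg_locally_finite D hn p1 gLp).
have := @dcube_ae R n D; move: cv fin; apply: filterS3 => x cx Mfin xd.
apply: cvg_of_approximants => eps eps0.
have [A A0 AE] : exists2 A : R, 0 <= A & MD D (EFin \o g) x = A%:E.
  by exists (fine (MD D (EFin \o g) x)); rewrite ?fineK// fine_ge0// MD_ge0.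
have [N NE] : exists N, e N * A <= eps.
  exists (Num.bound (A / eps)); rewrite /e mulrC ler_pdivrMr ?ltr0n//.
  rewrite -ler_pdivrMl// mulrC.
  have := archi_boundP (divr_ge0 A0 (ltW eps0)) => /ltW /le_trans; apply.
  by rewrite ler_nat -addn2 leq_addr.
exists (fun k => approx D hn g Q0 (e N) (locate k%:Z x)); first exact: cx.
move=> k; rewrite distrC; apply: le_trans NE.
by rewrite -lee_fin EFinM -AE; exact: (approx_locate_close gLp Q0 (e01 N) (xd _)).
Qed.

Section nonnegative.
Variable G : 'rV[R]_n -> R.
Hypothesis GLp : G \in Lfun (leb n) p%:E.
Hypothesis G0 : forall x, 0 <= G x.

Lemma uavg_ge0E P : uavg D G P = wavg D G P.
Proof.
rewrite /uavg; have -> : (fun x => maxe (- (G x)%:E)%E 0%E) = cst 0%E.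
  by apply/funext => x; apply/max_idPr; rewrite -EFinN lee_fin oppr_le0.
rewrite {2}/mean integral0 mul0r subr0 /wavg; congr (mean D _ P).
apply/funext => x; rewrite /absg gee0_abs ?lee_fin//.
by apply/max_idPl; rewrite lee_fin.
Qed.

(** The limit exists by [uavg_cvg_ae].  The maximal function dominates the
    averages, so the integrals of the limit over dyadic cubes are the limits
    of those of the averages, which are eventually the integrals of [G];
    these integrals determine a function almost everywhere. *)
Lemma wavg_cvg_ae :
  {ae leb n, forall x, wavg D G (locate k%:Z x) @[k --> \oo] --> G x}.
Proof.
have mG := Lp_measurable GLp; have w0 P := wavg_ge0 D G P.
pose U x := `|lim_locate D (wavg D G) x|.
have mU : measurable_fun [set: 'rV[R]_n] U.
  apply: (measurableT_comp (@normr_measurable R setT)).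
  exact: measurable_lim_locate.
have cU : {ae leb n, forall x, wavg D G (locate k%:Z x) @[k --> \oo] --> U x}.
  apply: filterS (uavg_cvg_ae GLp) => x.
  under eq_fun do rewrite uavg_ge0E; move=> /cvg_lim_locate/cvg_norm.
  have -> // : (fun k : nat => `|wavg D G (locate k%:Z x)|) =
    (fun k : nat => wavg D G (locate k%:Z x)).
  by apply/funext => k; rewrite ger0_norm.
have EG P : (\int[leb n]_(x in hcube D P) (G x)%:E = (dvol R P * wavg D G P)%:E)%E.
  have := integral_mean (absg_ge0 G) (absg_locally_finite D p1 GLp) P.
  by rewrite /absg; under eq_integral do rewrite gee0_abs ?lee_fin//.
have EU P : (\int[leb n]_(x in hcube D P) (U x)%:E = (dvol R P * wavg D G P)%:E)%E.
  have mP := measurable_hcube D P.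
  have iM : (leb n).-integrable (hcube D P) (MD D (EFin \o G)).
    apply/integrableP; split; first exact: (measurable_funTS (measurable_Mg D p1 GLp)).
    under eq_integral do rewrite gee0_abs ?MD_ge0//.
    exact: (Mg_locally_finite D hn p1 GLp).
  have [] := @dominated_convergence _ _ _ (leb n) _ mP
    (fun k x => (wavg D G (locate k%:Z x))%:E) (EFin \o U) (MD D (EFin \o G)).
  - move=> k; apply: measurable_funTS; apply/measurable_EFinP.
    exact: (@measurable_fun_locate _ _ D k%:Z).
  - exact/measurable_funTS/measurable_EFinP.
  - apply: filterS cU => x cx _; apply: cvg_EFin => //; exact: nearW.
  - exact: iM.
  - apply: filterS (@dcube_ae R n D) => x xd k _.
    rewrite gee0_abs ?lee_fin//.
    apply: (@le_trans _ _ (maxavg D G (locate k%:Z x))%:E).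
      by rewrite lee_fin; exact: (wavg_le_maxavg D p1 GLp).
    exact: (maxavg_MD p1 GLp).
  move=> _ _ /cvg_lim <- //; apply/cvg_lim => //.
  apply: cvg_near_cst; exists `|P.1|%N => // k /= Pk.
  have -> : k%:Z = P.1 + `|k%:Z - P.1|%N%:Z by lia.
  rewrite integral_hcube_locate//; congr (_ * _)%:E.
  by apply: iter_avg_martingale => Q; exact: (avg_wavg D p1 GLp).
have : {ae leb n, forall x, U x = G x}.
  apply: (@ae_eq_of_hcubes R n D) => //.
  - by move=> x; exact: normr_ge0.
  - by move=> P; rewrite [X in (X < _)%E]EU ltry.
  - by move=> P; rewrite EU EG.
by move: cU; apply: filterS2 => x cx <-.
Qed.

End nonnegative.

Lemma Lfun_le (g h : 'rV[R]_n -> R) : g \in Lfun (leb n) p%:E ->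
  measurable_fun [set: 'rV[R]_n] h -> (forall x, `|h x| <= `|g x|) ->
  h \in Lfun (leb n) p%:E.
Proof.
move=> gLp mh hg; apply/andP; split; first by rewrite inE.
rewrite inE /= /finite_norm.
have p0 : 0 < p by exact: lt_trans p1.
have := sub_Lfun_finLfun gLp; rewrite inE /= /finite_norm.
apply: le_lt_trans; rewrite -[leRHS]mul1e; apply: Lnorm_le => //.
rewrite powR1 mul1e; apply: le_integral_ge0 => x _; first exact: poweR_ge0.
by apply: le_poweR; [exact: ltW|exact: abse_ge0|rewrite /= lee_fin].
Qed.

Lemma lebesgue_differentiation (g : 'rV[R]_n -> R) : g \in Lfun (leb n) p%:E ->
  {ae leb n, forall x, uavg D g (locate k%:Z x) @[k --> \oo] --> g x}.
Proof.
move=> gLp; have mg := Lp_measurable gLp.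
pose gp x := Num.max (g x) 0; pose gn x := Num.max (- g x) 0.
have gpLp : gp \in Lfun (leb n) p%:E.
  apply: (Lfun_le gLp); first by apply: measurable_funrpos.
  move=> x; rewrite /gp ger0_norm ?le_max ?lexx ?orbT// ge_max normr_ge0 andbT.
  exact: ler_norm.
have gnLp : gn \in Lfun (leb n) p%:E.
  apply: (Lfun_le gLp); first by apply: measurable_funrneg.
  move=> x; rewrite /gn ger0_norm ?le_max ?lexx ?orbT// ge_max normr_ge0 andbT.
  by rewrite -normrN ler_norm.
have gp0 x : 0 <= gp x by rewrite le_max lexx orbT.
have gn0 x : 0 <= gn x by rewrite le_max lexx orbT.
have := wavg_cvg_ae gnLp gn0; have := wavg_cvg_ae gpLp gp0.
apply: filterS2 => x cp cn.
have -> : g x = gp x - gn x by rewrite /gp /gn maxr_sub.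
have E P : uavg D g P = wavg D gp P - wavg D gn P.
  rewrite /uavg /wavg; congr (mean D _ P - mean D _ P); apply/funext => y.
    by rewrite /absg gee0_abs ?lee_fin// EFin_max.
  by rewrite /absg gee0_abs ?lee_fin// EFin_max EFinN.
by under eq_fun do rewrite E; exact: cvgB.
Qed.

End differentiation.

(** * The theorem *)

Section boundary_values.
Context (R : realType) (n : nat) (D : dyadic_system R n) (hn : (0 < n)%N).
Variables (p : R) (p1 : 1 < p) (g : 'rV[R]_n -> R).
Hypothesis gLp : g \in Lfun (leb n) p%:E.
Variables (Q0 : dindex n) (e : R).
Hypothesis e01 : 0 < e < 1.
Local Notation Mg := (MD D (EFin \o g)).
Local Notation F := (approx D hn g Q0 e).
Local Notation f0 := (lim_locate D F).

(** The inequality [|F - u| <= e * Mg] passes to the limit along the branch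
    of [x], where [u] converges to [g]. *)
Lemma boundary_close_ae :
  {ae leb n, forall x, (`|f0 x - g x|%:E <= e%:E * Mg x)%E}.
Proof.
have e0 : 0 < e by case/andP: e01.
have h1 := approx_limit_ae D hn p1 gLp Q0 e01.
have h2 := lebesgue_differentiation D hn p1 gLp.
have := @dcube_ae R n D; move: h1 h2; apply: filterS3 => x /cvg_lim_locate Fx ux xd.
have H k := approx_locate_close hn p1 gLp Q0 e01 (xd k%:Z); move: H.
have [->|fin] := eqVneq (Mg x) +oo%E; first by rewrite gt0_muley ?lte_fin// leey.
have -> : Mg x = (fine (Mg x))%:E.
  by rewrite fineK// ge0_fin_numE ?MD_ge0// lt_neqAle fin leey.
move=> H; rewrite -EFinM lee_fin.
have c : `|F (locate D k%:Z x) - uavg D g (locate D k%:Z x)| @[k --> \oo] -->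
    `|f0 x - g x| by apply: cvg_norm; exact: cvgB.
apply: (cvgr_to_le c); apply: nearW => k; rewrite -lee_fin EFinM.
by rewrite -EFinM; exact: H.
Qed.

Lemma norm_boundary_close :
  (Lp_norm p (fun x => (f0 x - g x)%R%:E) <=
   (e * maximal_constant n p)%:E * Lp_norm p (EFin \o g))%E.
Proof.
have e0 : 0 < e by case/andP: e01.
have p0 : 0 < p by exact: lt_trans p1.
have mg := Lp_measurable gLp; have mM := measurable_Mg D p1 gLp.
apply: (@le_trans _ _ (e%:E * Lp_norm p Mg)%E); last first.
  rewrite EFinM -muleA lee_wpmul2l ?lee_fin ?(ltW e0)//.
  exact: (Lp_norm_Mg D hn p1 gLp).
have mf : measurable_fun [set: 'rV[R]_n] (fun x => (f0 x - g x)%:E).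
  apply/measurable_EFinP; apply: measurable_funB => //.
  exact: measurable_lim_locate.
apply: Lnorm_le => //; first exact: ltW.
rewrite -ge0_integralZl//; last 3 first.
- apply: (measurableT_comp (measurable_poweR _)).
  by apply: measurableT_comp => //; exact: mM.
- by move=> x _; exact: poweR_ge0.
- by rewrite lee_fin powR_ge0.
apply: ae_ge0_le_integral => //.
- by move=> x _; exact: poweR_ge0.
- apply: (measurableT_comp (measurable_poweR _)).
  by apply: measurableT_comp => //; exact: mf.
- by move=> x _; rewrite mule_ge0 ?poweR_ge0 ?lee_fin ?powR_ge0.
- apply: measurable_funeM; apply: (measurableT_comp (measurable_poweR _)).
  by apply: measurableT_comp => //; exact: mM.
apply: filterS boundary_close_ae => x h _.
have M0 := MD_ge0 D (EFin \o g) x.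
rewrite (gee0_abs M0) -poweR_EFin -poweRM ?lee_fin ?(ltW e0)//.
by apply: le_poweR; [exact: ltW|exact: abse_ge0|rewrite abse_EFin].
Qed.

End boundary_values.

Theorem theorem1p2 (R : realType) (n : nat) (hn : (0 < n)%N)
    (D : dyadic_system R n) (p : R) (hp : 1 < p) :
  exists2 C : R, 0 < C &
  forall (g : 'rV[R]_n -> R) (u : R1n R n -> R) (eps : R),
    g \in Lfun (leb n) p%:E -> is_dyadic_extension D g u -> 0 < eps < 1 ->
  exists (f : R1n R n -> R) (Df : vmeasure R n),
    [/\ whitney_constant D f /\ is_gradient f Df,
        (forall x, ND D (fun z => f z - u z)%R x <=
                   eps%:E * MD D (EFin \o g) x)%E /\
        (forall x, CD D Df x <=
                   (C * eps^-1)%R%:E * MD D (MD D (EFin \o g)) x)%E,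
        (Lp_norm p (NT (fun z => f z - u z)%R) <=
           eps%:E * Lp_norm p (EFin \o g))%E /\
        (Lp_norm p (CT Df) <= (C * eps^-1)%R%:E * Lp_norm p (EFin \o g))%E &
        forall alpha : R, 0 < alpha ->
        exists f0 : 'rV[R]_n -> R,
          [/\ measurable_fun [set: 'rV[R]_n] f0,
              {ae leb n, forall x, nontangential_limit alpha f x (f0 x)} &
              (Lp_norm p (fun x => (f0 x - g x)%R%:E) <=
                 eps%:E * Lp_norm p (EFin \o g))%E]].
Proof.
pose A := maximal_constant n p.
have A0 : 0 < A := maximal_constant_gt0 n hp.
(* Running the construction with [c * eps], where [c * A <= 1] and [c <= 1],
   absorbs the constant [A] of the maximal inequality in the norm estimates
   without affecting the pointwise ones; the loss [1 / c] goes into [C]. *)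
pose c := (1 + A)^-1.
have c0 : 0 < c by rewrite invr_gt0 addr_gt0.
have c1 : c <= 1 by rewrite invf_le1 ?addr_gt0// lerDl ltW.
have cA : c * A <= 1 by rewrite mulrC ler_pdivrMr ?addr_gt0// mul1r lerDr.
have N0 : 0 < (8 + 2 ^+ n : R) by rewrite addr_gt0// exprn_gt0.
pose C1 : R := n.+1%:R * (4 * ((8 + 2 ^+ n) / c)).
pose C2 : R := n.+1%:R * (3 ^+ n * 2 ^+ n) * (7 * ((8 + 2 ^+ n) / c)) * A * A.
have T0 : 0 < (8 + 2 ^+ n) / c := divr_gt0 N0 c0.
have C10 : 0 < C1 by rewrite mulr_gt0// mulr_gt0.
have C20 : 0 < C2 by do 4! apply: mulr_gt0 => //; apply: mulr_gt0; rewrite ?exprn_gt0.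
exists (C1 + C2) => [|g u eps gLp uext /andP[eps0 eps1]]; first exact: addr_gt0.
have e01 : 0 < c * eps < 1.
  by rewrite mulr_gt0//= (le_lt_trans _ eps1)// ger_pMl.
pose Q0 : dindex n := (0, 0).
exists (approx D hn g Q0 (c * eps) \o widx D), (gradient_measure D hn hp gLp Q0 e01).
have G0 : (0 <= Lp_norm p (EFin \o g) :> \bar R)%E by exact: Lnorm_ge0.
have epsc (x : \bar R) : (0 <= x)%E -> ((c * eps)%:E * x <= eps%:E * x)%E.
  by move=> x0; rewrite lee_wpmul2r// lee_fin ger_pMl.
have epsA (x : \bar R) : (0 <= x)%E -> ((c * eps * A)%:E * x <= eps%:E * x)%E.
  by move=> x0; rewrite lee_wpmul2r// lee_fin mulrAC ger_pMl.
split.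
- split; first exact: whitney_constant_approx.
  exact: is_gradient_jump.
- split=> x.
    apply: le_trans (ND_approx hn hp gLp Q0 e01 uext x) _.
    by apply: epsc; exact: MD_ge0.
  apply: le_trans (CD_approx D hn hp gLp Q0 e01 x) _.
  rewrite lee_wpmul2r ?MD_ge0// lee_fin.
  have -> : n.+1%:R * (4 * ((8 + 2 ^+ n) / (c * eps))) = C1 * eps^-1.
    by rewrite /C1 invfM; ring.
  by rewrite ler_pM2r ?invr_gt0// lerDl ltW.
- split.
    apply: le_trans (norm_NT_approx hn hp gLp Q0 e01 uext) _.
    exact: epsA.
  apply: le_trans (norm_CT_approx D hn hp gLp Q0 e01) _.
  rewrite lee_wpmul2r// lee_fin -/A.
  have -> : n.+1%:R * (3 ^+ n * 2 ^+ n) * (7 * ((8 + 2 ^+ n) / (c * eps))) * A * A =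
      C2 * eps^-1 by rewrite /C2 invfM; ring.
  by rewrite ler_pM2r ?invr_gt0// lerDr ltW.
move=> alpha alpha0; exists (lim_locate D (approx D hn g Q0 (c * eps))); split.
- exact: measurable_lim_locate.
- exact: (approx_nontangential D hn hp gLp Q0 e01).
- apply: le_trans (norm_boundary_close D hn hp gLp Q0 e01) _.
  exact: epsA.
Qed.
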